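(* The test statistic $\widehat{\mathcal D}_n$, with the weights and parameters given in the context, has the following moments. Under the null hypothesis $\Sigma=I$, $$\mathbb E_I(\widehat{\mathcal D}_n)=0,\qquad \mathrm{Var}_I(\widehat{\mathcal D}_n)=\frac{2}{n(n-1)p^2}\sum_{1\le i<j\le p}w_{ij}^{*2}=\frac{1}{n(n-1)p}.$$ Also, under the null hypothesis, $$n\sqrt p\,\widehat{\mathcal D}_n\ \overset{d}{\to}\ \mathcal N(0,1).$$ Moreover, under the alternative, if we assume that $\varphi\to0$, $p\,\varphi^{1/\alpha}\to\infty$ and $\alpha>1/2$, we have, for all $\Sigma$ in $Q(\alpha,L,\varphi)$, $$\mathbb E_\Sigma(\widehat{\mathcal D}_n)=\frac1p\sum_{1\le i<j\le p}w^*_{ij}\sigma_{ij}^2\ \ge\ b(\varphi)\qquad\text{and}\qquad \mathrm{Var}_\Sigma(\widehat{\mathcal D}_n)=\frac{T_1}{n(n-1)p^2}+\frac{T_2}{np^2},$$ where $$T_1\le p\cdot(1+o(1))+p\cdot\mathbb E_\Sigma(\widehat{\mathcal D}_n)\cdot O(T\sqrt T),$$ $$T_2\le p\cdot\mathbb E_\Sigma(\widehat{\mathcal D}_n)\cdot O(\sqrt T)+p^{3/2}\cdot\Big(\mathbb E_\Sigma^{3/2}(\widehat{\mathcal D}_n)\cdot O(T^{3/4})+\mathbb E_\Sigma(\widehat{\mathcal D}_n)\cdot o(1)\Big).$$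
   Context: Model: $X_1,\dots,X_n$ are i.i.d. $p$-dimensional Gaussian vectors with law $\mathcal N_p(0,\Sigma)$, $X_k=(X_{k,1},\dots,X_{k,p})^\top$, where $\Sigma=[\sigma_{ij}]_{1\le i,j\le p}$ is a covariance matrix with $\sigma_{ii}=1$ for all $i$. $\mathbb E_\Sigma$ and $\mathrm{Var}_\Sigma$ denote the corresponding expectation and variance, $\mathbb E_\Sigma^{3/2}(\cdot)=(\mathbb E_\Sigma(\cdot))^{3/2}$, and $I$ is the $p\times p$ identity matrix. The null hypothesis is $\Sigma=I$; the alternative is $\Sigma\in Q(\alpha,L,\varphi)$. The parameters $\alpha>0$ and $L>0$ are fixed, $\varphi=\varphi_{n,p}>0$ may depend on $n$ and $p$, and all asymptotics ($o$, $O$, convergence in distribution) are as $n\to\infty$ and $p\to\infty$. Classes: $\mathcal F(\alpha,L)$ is the set of symmetric non-negative definite matrices $\Sigma$ with $\sigma_{ii}=1$ for all $i=1,\dots,p$ and $\frac1p\sum_{1\le i<j\le p}\sigma_{ij}^2|i-j|^{2\alpha}\le L$ for all $p$. Further, $Q(\alpha,L,\varphi)=\{\Sigma\in\mathcal F(\alpha,L):\ \frac1p\sum_{1\le i<j\le p}\sigma_{ij}^2\ge\varphi^2\}$. Test statistic: $$\widehat{\mathcal D}_n=\frac1{n(n-1)p}\sum_{1\le k\ne l\le n}\ \sum_{1\le i<j\le p}w^*_{ij}X_{k,i}X_{k,j}X_{l,i}X_{l,j},\qquad w^*_{ij}=\frac{\lambda}{2b(\varphi)}\Big(1-\Big(\frac{|i-j|}{T}\Big)^{2\alpha}\Big)_+,$$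 where $T=\lfloor C_T(\alpha,L)\,\varphi^{-1/\alpha}\rfloor$, $\lambda=C_\lambda(\alpha,L)\,\varphi^{(2\alpha+1)/\alpha}$, $b(\varphi)=C^{1/2}(\alpha,L)\,\varphi^{2+\frac1{2\alpha}}$, and $$C_T(\alpha,L)=((4\alpha+1)L)^{\frac1{2\alpha}},\quad C_\lambda(\alpha,L)=\frac{2\alpha+1}{2\alpha}((4\alpha+1)L)^{-\frac1{2\alpha}},\quad C(\alpha,L)=\frac{2\alpha+1}{(4\alpha+1)^{1+1/(2\alpha)}}L^{-\frac1{2\alpha}}.$$ The weights and parameters are presented as obtained by solving the problem of maximizing, over weights $w_{ij}\ge0$ with $\frac1p\sum_{1\le i<j\le p}w_{ij}^2=\frac12$, the infimum over $\Sigma\in Q(\alpha,L,\varphi)$ of $\frac1p\sum_{1\le i<j\le p}w_{ij}\sigma_{ij}^2$. They are stated to have the properties $w^*_{ij}\ge0$, $\frac1p\sum_{1\le i<j\le p}w_{ij}^{*2}=\frac12$, $\sup_{i,j}w^*_{ij}\asymp 1/\sqrt T$, as $\varphi\to0$ and $p\,\varphi^{1/\alpha}\to\infty$. The quantities $T_1,T_2$ in the variance are $$T_1=2\,\mathbb E_\Sigma\Big\{\sum_{1\le i<j\le p}w^*_{ij}(X_{1,i}X_{1,j}-\sigma_{ij})(X_{2,i}X_{2,j}-\sigma_{ij})\Big\}^2,\qquad T_2=4\,\mathbb E_\Sigma\Big\{\sum_{1\le i<j\le p}w^*_{ij}(X_{1,i}X_{1,j}-\sigma_{ij})\sigma_{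ij}\Big\}^2.$$
   Formalization: Since the literal forms fail, Var_I = 1/(n(n-1)p) becomes (1+o(1))/(n(n-1)p) and the CLT is stated, both as φ→0 and pφ^{1/α}→∞; E_Σ ≥ b(φ) is stated exactly when C_T φ^{-1/α} is an integer, and as E_Σ ≥ b(φ)(1+o(1)) in general. *)

(* Defs.v *)
From HB Require Import structures.
From mathcomp Require Import all_boot all_order all_algebra.
From mathcomp Require Import all_classical all_reals all_analysis.

Set Implicit Arguments.
Unset Strict Implicit.
Unset Printing Implicit Defensive.

Import Order.TTheory GRing.Theory Num.Theory.
Import numFieldNormedType.Exports.

Local Open Scope classical_set_scope.
Local Open Scope ring_scope.

(* n and p tend to infinity jointly, with no relation imposed between them. *)
Notation np_oo := (filter_prod (\oo : set_system nat) (\oo : set_system nat)).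

Notation "\sum_[ i < j < p ] E" :=
  (\sum_(i < p) \sum_(j < p | (i < j)%N) E)
  (at level 41, E at level 41, i name, j name, p at level 39,
   format "\sum_[ i  <  j  <  p ]  E") : ring_scope.

Section Sampling.
Context {R : realType} {d : measure_display} {Om : measurableType d}.
Variable P : probability Om R.

(* The normal law with mean m and variance v. `normal_prob m s` is a Gaussian
   law only for s != 0, so the point mass at m has to be singled out. *)
Definition normal_law (m v : R) (A : set R) : \bar R :=
  if v == 0 then dirac m A else normal_prob m (Num.sqrt v) A.

(* X ~ N_p(0, Sigma), for a possibly singular covariance matrix: every linear
   combination <a, X> has law N(0, a Sigma a^T). *)
Definition centered_gaussian (p : nat) (X : {RV P >-> p.-tuple R})
    (Sigma : 'M[R]_p) : Prop :=
  forall (a : 'rV[R]_p) (A : set R), measurable A ->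
    P [set w | A (\sum_(i < p) a 0 i * tnth (X w) i)] =
    normal_law 0 ((a *m Sigma *m a^T) 0 0) A.

(* The product rule for subfamilies is the case A k = setT outside of them. *)
Definition mutually_independent (n : nat) (d' : measure_display)
    (E : measurableType d') (X : 'I_n -> {RV P >-> E}) : Prop :=
  forall A : 'I_n -> set E, (forall k, measurable (A k)) ->
    P (\bigcap_(k in [set: 'I_n]) (X k @^-1` A k)) =
    (\prod_(k < n) P (X k @^-1` A k))%E.

Definition iid_gaussian (n p : nat) (X : 'I_n -> {RV P >-> p.-tuple R})
    (Sigma : 'M[R]_p) : Prop :=
  mutually_independent X /\ forall k, centered_gaussian (X k) Sigma.

End Sampling.

(* Convergence in distribution of real random variables, each one living on its
   own probability space: the distribution functions converge at every
   continuity point of the limiting one. *)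
Definition cvg_in_distribution {R : realType} {I : Type} (F : set_system I)
    (d : I -> measure_display) (Om : forall i, measurableType (d i))
    (P : forall i, probability (Om i) R) (Z : forall i, Om i -> R)
    (mu : probability (measurableTypeR R) R) : Prop :=
  forall x : R, {for x, continuous (fun y : R => mu [set` `]-oo, y]])} ->
    (P i [set w | Z i w <= x] @[i --> F]) --> mu [set` `]-oo, x]].

Section Model.
Context {R : realType}.
Variables alpha L : R.

Definition classF (p : nat) : set 'M[R]_p :=
  [set Sigma | [/\ Sigma^T = Sigma,
    forall u : 'rV[R]_p, 0 <= (u *m Sigma *m u^T) 0 0,
    forall i : 'I_p, Sigma i i = 1 &
    p%:R^-1 * (\sum_[i < j < p]
      Sigma i j ^+ 2 * `|i%:R - j%:R| `^ (2 * alpha)) <= L]].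

Definition classQ (phi : R) (p : nat) : set 'M[R]_p :=
  [set Sigma | classF Sigma /\
    phi ^+ 2 <= p%:R^-1 * (\sum_[i < j < p] Sigma i j ^+ 2)].

Definition C_T : R := ((4 * alpha + 1) * L) `^ (1 / (2 * alpha)).

Definition C_lambda : R :=
  (2 * alpha + 1) / (2 * alpha) *
  ((4 * alpha + 1) * L) `^ (- (1 / (2 * alpha))).

Definition C_b : R :=
  (2 * alpha + 1) / (4 * alpha + 1) `^ (1 + 1 / (2 * alpha)) *
  L `^ (- (1 / (2 * alpha))).

(* The bandwidth before taking its integer part. *)
Definition realT (phi : R) : R := C_T * phi `^ (- (1 / alpha)).

Definition T (phi : R) : nat := Num.truncn (realT phi).

Definition lambda (phi : R) : R :=
  C_lambda * phi `^ ((2 * alpha + 1) / alpha).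

Definition b (phi : R) : R :=
  C_b `^ (1 / 2) * phi `^ (2 + 1 / (2 * alpha)).

(* Only phi with 1 <= T phi is meaningful; when T phi = 0 (large phi) the
   convention x / 0 = 0 makes all the weights equal. *)
Definition wstar (phi : R) (i j : nat) : R :=
  lambda phi / (2 * b phi) *
  Num.max 0 (1 - (`|i%:R - j%:R| / (T phi)%:R) `^ (2 * alpha)).

Section Moments.
Context {d : measure_display} {Om : measurableType d}.
Variables (P : probability Om R) (phi : R) (p : nat) (Sigma : 'M[R]_p).

Definition Dhat (n : nat) (X : 'I_n -> {RV P >-> p.-tuple R}) (w : Om) : R :=
  (n%:R * (n%:R - 1) * p%:R)^-1 *
  \sum_(k < n) \sum_(l < n | k != l) \sum_[i < j < p]
    wstar phi i j * tnth (X k w) i * tnth (X k w) j *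
                    tnth (X l w) i * tnth (X l w) j.

Definition T1 (X1 X2 : {RV P >-> p.-tuple R}) : \bar R :=
  (2%:E * 'E_P[fun w => ((\sum_[i < j < p] wstar phi i j *
     (tnth (X1 w) i * tnth (X1 w) j - Sigma i j) *
     (tnth (X2 w) i * tnth (X2 w) j - Sigma i j)) ^+ 2)%R])%E.

Definition T2 (X1 : {RV P >-> p.-tuple R}) : \bar R :=
  (4%:E * 'E_P[fun w => ((\sum_[i < j < p] wstar phi i j *
     (tnth (X1 w) i * tnth (X1 w) j - Sigma i j) * Sigma i j) ^+ 2)%R])%E.

End Moments.
End Model.

(* Main.v *)
(* The weights vanish for |i - j| >= T, and n (n - 1) p Dhat is a U-statistic of
   order two in the vectors X_k. Isserlis' formula and Hoeffding's decomposition
   give its mean and variance exactly, T1 and T2 being quadruple sums of products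
   of covariances. Let W = lambda / (2 b), so that W^2 T is bounded, let S be the
   sum of the sigma_ij^2 and ES the sum of the w_ij sigma_ij^2 over i < j. In T1
   the diagonal terms give p (1 + o(1)) and the other ones at most a multiple of
   W ES + W^2 T^2 S. In T2 the terms with a coincidence of indices are at most a
   multiple of W T ES and the others, by Cauchy-Schwarz, of W^2 T S^(3/2).
   Finally S = O(ES / W), because Sigma belongs to the class and phi is small.

   Under the null hypothesis all the coordinates X_(k,i) are independent: by
   product-to-sum formulas, expectations of products of cosines of coordinates
   are expectations of cosines of linear combinations, and bounded pointwise
   limits of trigonometric sums are all the bounded Borel functions. Cut the
   indices i into blocks of length M T. The normalized statistic Z is then a sum of
   independent within-block terms U, plus a cross-block remainder of variance
   O(1 / M). Each U is a multilinear polynomial of degree 4, hence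
   E U^4 <= 9^4 (E U^2)^2 by hypercontractivity, and a second-order expansion of
   the cosine shows that E cos(t Z + c) tends to exp(- t^2 / 2) cos c. This
   passes to distribution functions since the indicator function of a half-line
   is squeezed, up to small errors and Chebyshev tails, between trigonometric
   sums obtained by iterating z |-> (3 z - z^3) / 2 on a sine. *)

Require Import Defs.
From HB Require Import structures.
From mathcomp Require Import all_boot all_order all_algebra.
From mathcomp Require Import all_classical all_reals all_analysis.
From mathcomp Require Import measurable_realfun zify ring lra.

Set Implicit Arguments.
Unset Strict Implicit.
Unset Printing Implicit Defensive.

Import Order.TTheory GRing.Theory Num.Theory.
Import numFieldNormedType.Exports.

Local Open Scope classical_set_scope.
Local Open Scope ring_scope.

(** * Expectation and independence *)

(** Two features of the definitions shape the proof. First, a Gaussian vector is known only through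
    the laws of its linear combinations. Mixed moments are therefore recovered by polarization, and
    even the independence of the coordinates under the null hypothesis has to be derived; cosines of
    linear combinations are the functions whose means are explicit, hence the detour through
    trigonometric sums. Second, T is an integer part, and the last rows of weights are cut by the
    border of the matrix. The normalization of the squared weights and, because of the integer part,
    the lower bound b thus hold up to factors 1 + o(1). These factors are explicit functions
    [null_rem] and [b_rem] of n and p that do not involve Sigma, so uniformity over the class needs
    no further argument. In the limit theorem every cosine carries a phase c: a sine is a cosine
    with phase shifted by pi / 2, so that addition formulas stay within one family of functions and
    no complex exponential is needed. The order of choices matters: M is fixed by the tolerated
    cross-block variance, and only then is p taken large enough for M T / p to be small. *)

Section Moments.
Context {R : realType} {d : measure_display} {Om : measurableType d}.
Variable P : probability Om R.
Implicit Types f g : Om -> R.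

Definition integ f := P.-integrable setT (EFin \o f).
Definition mean f : R := (\int[P]_w f w)%R.

Lemma integ_meas f : integ f -> measurable_fun setT f.
Proof. by case/integrableP => /measurable_EFinP. Qed.

Lemma le_integ f g : measurable_fun setT f -> (forall w, `|f w| <= g w) ->
  integ g -> integ f.
Proof.
move=> mf fg ig; apply: le_integrable ig => //; first exact/measurable_EFinP.
move=> w _ /=; rewrite lee_fin; apply: le_trans (fg w) _; exact: ler_norm.
Qed.

Lemma integ_cst c : integ (cst c).
Proof. exact: finite_measure_integrable_cst. Qed.

Lemma integD f g : integ f -> integ g -> integ (fun w => f w + g w).
Proof.
move=> hf hg; have := integrableD measurableT hf hg.
by apply: eq_integrable => // w _; rewrite /= EFinD.
Qed.

Lemma integZ c f : integ f -> integ (fun w => c * f w).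
Proof.
move=> hf; have := integrableZl measurableT c hf.
by apply: eq_integrable => // w _; rewrite /= EFinM.
Qed.

Lemma integN f : integ f -> integ (fun w => - f w).
Proof. by move=> /(integZ (-1)); under eq_fun do rewrite mulN1r. Qed.

Lemma integB f g : integ f -> integ g -> integ (fun w => f w - g w).
Proof. by move=> hf hg; apply: integD => //; exact: integN. Qed.

Lemma integ_norm f : integ f -> integ (fun w => `|f w|).
Proof. by move=> /integrable_norm. Qed.

Lemma integ_sum (I : Type) (s : seq I) (A : pred I) (F : I -> Om -> R) :
  (forall i, A i -> integ (F i)) -> integ (fun w => \sum_(i <- s | A i) F i w).
Proof.
move=> iF; elim: s => [|i s IHs].
  by under eq_fun do rewrite big_nil; exact: integ_cst.
case Ai: (A i); under eq_fun do rewrite big_cons Ai //; last exact: IHs.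
by apply: integD => //; exact: iF.
Qed.

Lemma integ_bounded f (M : R) : measurable_fun setT f -> (forall w, `|f w| <= M) ->
  integ f.
Proof. by move=> mf fM; apply: (@le_integ _ (cst M)) => //; exact: integ_cst. Qed.

Lemma meanE f : integ f -> (\int[P]_w (f w)%:E)%E = (mean f)%:E.
Proof. by move=> fi; rewrite /mean /Rintegral fineK //; exact: integrable_fin_num. Qed.

Lemma expectE f : integ f -> ('E_P[f] = (mean f)%:E)%E.
Proof. by move=> fi; rewrite unlock meanE. Qed.

Lemma mean_cst c : mean (cst c) = c.
Proof. by rewrite /mean Rintegral_cst //= probability_setT mulr1. Qed.

Lemma meanD f g : integ f -> integ g ->
  mean (fun w => f w + g w) = mean f + mean g.
Proof. by move=> hf hg; rewrite /mean RintegralD. Qed.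

Lemma meanZ c f : integ f -> mean (fun w => c * f w) = c * mean f.
Proof. by move=> hf; rewrite /mean RintegralZl. Qed.

Lemma meanN f : integ f -> mean (fun w => - f w) = - mean f.
Proof.
by move=> hf; rewrite -[RHS]mulN1r -meanZ//; under [in RHS]eq_fun do rewrite mulN1r.
Qed.

Lemma meanB f g : integ f -> integ g ->
  mean (fun w => f w - g w) = mean f - mean g.
Proof. by move=> hf hg; rewrite meanD// ?meanN//; exact: integN. Qed.

Lemma mean_sum (I : Type) (s : seq I) (A : pred I) (F : I -> Om -> R) :
  (forall i, A i -> integ (F i)) ->
  mean (fun w => \sum_(i <- s | A i) F i w) = \sum_(i <- s | A i) mean (F i).
Proof.
move=> iF; elim: s => [|i s IHs].
  by under eq_fun do rewrite big_nil; rewrite big_nil mean_cst.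
rewrite [RHS]big_cons; case Ai: (A i); under eq_fun do rewrite big_cons Ai //; last exact: IHs.
by rewrite meanD ?IHs//; [exact: iF|exact: integ_sum].
Qed.

Lemma mean_ge0 f : (forall w, 0 <= f w) -> 0 <= mean f.
Proof. by move=> f0; apply: Rintegral_ge0. Qed.

Lemma le_mean f g : integ f -> integ g -> (forall w, f w <= g w) ->
  mean f <= mean g.
Proof. by move=> hf hg fg; apply: le_Rintegral. Qed.

Lemma eq_mean f g : f =1 g -> mean f = mean g.
Proof. by move=> fg; congr mean; apply/funext. Qed.

Lemma le_norm_mean f : integ f -> `|mean f| <= mean (fun w => `|f w|).
Proof. by move=> fi; apply: le_normr_Rintegral. Qed.

Lemma le_mean_norm f g : integ f -> integ g -> (forall w, `|f w| <= g w) ->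
  `|mean f| <= mean g.
Proof.
move=> hf hg fg; apply: le_trans (le_norm_mean hf) _.
by apply: le_mean => //; exact: integ_norm.
Qed.

(** Integrability is not stable under products, whereas the existence of all absolute moments is;
    one closure argument then covers every polynomial in Gaussian coordinates. *)
Definition allmom f :=
  measurable_fun setT f /\ forall k : nat, integ (fun w => `|f w| ^+ k).

Lemma allmom_meas f : allmom f -> measurable_fun setT f. Proof. by case. Qed.

Lemma allmom_integ f : allmom f -> integ f.
Proof.
case=> mf /(_ 1%N) h; apply: le_integ h => // w.
Qed.

Lemma eq_allmom f g : f =1 g -> allmom f -> allmom g.
Proof. by move=> /funext ->. Qed.

Lemma allmom_cst c : allmom (cst c).
Proof. by split => // k; exact: (integ_cst (`|c| ^+ k)). Qed.

Lemma normrD_expr_le (x y : R) k :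
  `|x + y| ^+ k <= 2 ^+ k * (`|x| ^+ k + `|y| ^+ k).
Proof.
have : `|x + y| <= 2 * Num.max `|x| `|y|.
  apply: le_trans (ler_normD _ _) _; rewrite mulr_natl mulr2n.
  by apply: lerD; rewrite le_max lexx ?orbT.
move=> h; apply: (@le_trans _ _ ((2 * Num.max `|x| `|y|) ^+ k)).
  by apply: lerXn2r => //; rewrite nnegrE// mulr_ge0// le_max normr_ge0.
rewrite exprMn ler_pM2l ?exprn_gt0//.
by case: (leP `|x| `|y|) => _; rewrite ?lerDl ?lerDr exprn_ge0.
Qed.

Lemma allmomD f g : allmom f -> allmom g -> allmom (fun w => f w + g w).
Proof.
move=> [mf hf] [mg hg]; have mfg : measurable_fun setT (fun w => f w + g w).
  exact: measurable_funD.
split=> // k; apply: (@le_integ _ (fun w => 2 ^+ k * (`|f w| ^+ k + `|g w| ^+ k))).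
- by apply: measurable_funX; exact: measurableT_comp.
- by move=> w; rewrite ger0_norm ?exprn_ge0//; exact: normrD_expr_le.
- by apply: integZ; exact: integD.
Qed.

Lemma normrM_expr_le (x y : R) k :
  `|x * y| ^+ k <= `|x| ^+ (2 * k) + `|y| ^+ (2 * k).
Proof.
rewrite normrM exprMn mulnC !exprM.
set a := `|x| ^+ k; set b := `|y| ^+ k.
have a0 : 0 <= a by rewrite exprn_ge0.
have b0 : 0 <= b by rewrite exprn_ge0.
have := sqr_ge0 (a - b); nra.
Qed.

Lemma allmomM f g : allmom f -> allmom g -> allmom (fun w => f w * g w).
Proof.
move=> [mf hf] [mg hg]; have mfg : measurable_fun setT (fun w => f w * g w).
  exact: measurable_funM.
split=> // k.
apply: (@le_integ _ (fun w => `|f w| ^+ (2 * k) + `|g w| ^+ (2 * k))).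
- by apply: measurable_funX; exact: measurableT_comp.
- by move=> w; rewrite ger0_norm ?exprn_ge0//; exact: normrM_expr_le.
- exact: integD.
Qed.

Lemma allmomZ c f : allmom f -> allmom (fun w => c * f w).
Proof. by move=> hf; apply: allmomM => //; exact: allmom_cst. Qed.

Lemma allmomN f : allmom f -> allmom (fun w => - f w).
Proof. by move=> /(allmomZ (-1)); under eq_fun do rewrite mulN1r. Qed.

Lemma allmomB f g : allmom f -> allmom g -> allmom (fun w => f w - g w).
Proof. by move=> hf hg; apply: allmomD => //; exact: allmomN. Qed.

Lemma allmomX f k : allmom f -> allmom (fun w => f w ^+ k).
Proof.
move=> hf; elim: k => [|k IHk].
  by under eq_fun do rewrite expr0; exact: allmom_cst.
by under eq_fun do rewrite exprS; exact: allmomM.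
Qed.

Lemma allmom_sum (I : Type) (s : seq I) (A : pred I) (F : I -> Om -> R) :
  (forall i, A i -> allmom (F i)) -> allmom (fun w => \sum_(i <- s | A i) F i w).
Proof.
move=> iF; elim: s => [|i s IHs].
  by under eq_fun do rewrite big_nil; exact: allmom_cst.
case Ai: (A i); under eq_fun do rewrite big_cons Ai //; last exact: IHs.
by apply: allmomD => //; exact: iF.
Qed.

Lemma allmom_Lfun2 f : allmom f -> f \in Lfun P 2%:E.
Proof.
case=> mf h; rewrite inE; apply/andP; split; rewrite inE//=.
rewrite /finite_norm (@lty_poweRy _ _ 2)// poweR_Lnorm//.
have /integrableP[_] := h 2%N; apply: le_lt_trans.
apply: ge0_le_integral => //.
- by move=> x _; exact: poweR_ge0.
- apply: measurableT_comp (measurable_poweR _) _.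
  by apply: measurableT_comp => //; exact/measurable_EFinP.
- apply: measurableT_comp => //; apply/measurable_EFinP.
  by apply: measurable_funX; exact: measurableT_comp.
- move=> x _ /=; by rewrite lee_fin (powR_mulrn 2)// -normrX normr_id.
Qed.

Lemma varE f : allmom f ->
  'V_P[f]%E = (mean (fun w => f w ^+ 2) - mean f ^+ 2)%:E.
Proof.
move=> hf; rewrite varianceE ?allmom_Lfun2// !expectE ?EFinB//.
  exact: allmom_integ.
exact: allmom_integ (allmomX 2 hf).
Qed.

End Moments.

Section PairIndependence.
Context {R : realType} {d : measure_display} {Om : measurableType d}.
Variable P : probability Om R.

Definition indep2 (U V : Om -> R) := forall A B : set R,
  measurable A -> measurable B ->
  (P (U @^-1` A `&` V @^-1` B) = P (U @^-1` A) * P (V @^-1` B))%E.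

(** The joint law of (U, V) agrees with the product of the two laws on rectangles, hence everywhere;
    the identity is then Fubini's theorem transported back to [Om]. *)
Lemma indep2_integral (U V : Om -> R) (F : R * R -> R) :
  measurable_fun setT U -> measurable_fun setT V -> indep2 U V ->
  measurable_fun setT F ->
  integ P (fun w => F (U w, V w)) -> (forall u, integ P (fun w => F (u, V w))) ->
  mean P (fun w => F (U w, V w)) = mean P (fun w => mean P (fun w' => F (U w, V w'))).
Proof.
move=> mU mV UV mF iF iFu.
pose U' : {mfun Om >-> R} := HB.pack U (isMeasurableFun.Build _ _ _ _ U mU).
pose V' : {mfun Om >-> R} := HB.pack V (isMeasurableFun.Build _ _ _ _ V mV).
have mUV : measurable_fun setT (fun w => (U w, V w)) by exact: measurable_fun_pair.
pose UV' : {mfun Om >-> (R * R)%type} := HB.pack (fun w => (U w, V w)) (isMeasurableFun.Build _ _ _ _ _ mUV).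
pose mu1 := distribution P U'; pose mu2 := distribution P V'.
have joint : forall X, measurable X -> (mu1 \x mu2)%E X = distribution P UV' X.
  apply: product_measure_unique => A B mA mB.
  rewrite /mu1 /mu2 /distribution /pushforward /= -UV//.
have iF' : (distribution P UV').-integrable setT (EFin \o F).
  apply: integrable_pushforward => //.
  exact/measurable_EFinP.
have iF2 : (mu1 \x mu2)%E.-integrable setT (EFin \o F).
  have [mF' h] := integrableP _ _ _ iF'.
  apply/integrableP; split => //; apply: le_lt_trans h.
  rewrite (eq_measure_integral (distribution P UV'))// => A mA _.
  exact: joint.
rewrite /mean /Rintegral; congr fine.
transitivity (\int[distribution P UV']_z (F z)%:E)%E.
  rewrite integral_distribution//; exact/measurable_EFinP.
rewrite -(eq_measure_integral _ (fun A mA _ => joint A mA)).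
have GE u : fubini_F mu2 (EFin \o F) u = (\int[P]_w (F (u, V w))%:E)%E.
  rewrite /fubini_F /mu2 (@integral_distribution _ _ _ _ _ P V' (fun v => (F (u, v))%:E))//; last exact: iFu.
  apply/measurable_EFinP; apply: measurableT_comp mF _.
  exact: measurable_fun_pair.
rewrite -(integral12_prod_meas1 iF2) /mu1 integral_distribution//.
- by apply: eq_integral => w _ /=; rewrite GE fineK//; exact: integrable_fin_num (iFu _).
- exact: (measurable_fubini_F iF2).
- have iG := integrable_fubini_F iF2; have [mG hG] := integrableP _ _ _ iG.
  apply/integrableP; split; first exact: measurableT_comp mG _.
  rewrite -(@ge0_integral_distribution _ _ _ _ _ P U'
    (fun u => `|fubini_F mu2 (EFin \o F) u|)%E)//.
  exact: measurableT_comp.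
Qed.

Lemma indep2_mean (U V : Om -> R) : allmom P U -> allmom P V -> indep2 U V ->
  mean P (fun w => U w * V w) = mean P U * mean P V.
Proof.
move=> hU hV UV.
have VE u : mean P (fun w' => u * V w') = mean P V * u.
  by rewrite (meanZ u (allmom_integ hV)) mulrC.
rewrite (@indep2_integral U V (fun z => z.1 * z.2))//.
- have -> : (fun w => mean P (fun w' => (U w, V w').1 * (U w, V w').2)) =
            (fun w => mean P V * U w) by apply/funext => w; exact: VE.
  by rewrite (meanZ _ (allmom_integ hU)) mulrC.
- exact: allmom_meas hU.
- exact: allmom_meas hV.
- exact: measurable_funM.
- by apply: allmom_integ; exact: allmomM.
- by move=> u; apply: allmom_integ; exact: (allmomZ u hV).
Qed.

End PairIndependence.

Section Family.
Context {R : realType} {d : measure_display} {Om : measurableType d}.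
Variable P : probability Om R.
Context {I : finType} {d' : measure_display} {E : measurableType d'}.
Variable X : I -> Om -> E.
Hypothesis mX : forall c, measurable_fun setT (X c).
Implicit Types (J K : pred I) (U V : Om -> R).

Definition independent_family := forall A : I -> set E, (forall c, measurable (A c)) ->
  P (\bigcap_(c in [set: I]) (X c @^-1` A c)) = (\prod_c P (X c @^-1` A c))%E.

(** A pi-system that generates the sigma-algebra of the X c with c in J. The sets [A c] are given
    for all c, even outside of J, so that two such families can be merged by a case distinction. *)
Definition cylinders (J : pred I) : set (set Om) :=
  [set B | exists2 A : I -> set E, (forall c, measurable (A c)) &
     B = \bigcap_(c in [set c | J c]) (X c @^-1` A c)].

(* A Variant, so that unification never unfolds the auxiliary sigma-algebra. *)
Variant depends_on (J : pred I) (U : Om -> R) : Prop := DependsOn of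
  measurable_fun (setT : set (g_sigma_algebraType (cylinders J))) U.

Lemma depends_cst J c : depends_on J (cst c).
Proof. by split; exact: measurable_cst. Qed.

Lemma dependsD J U V : depends_on J U -> depends_on J V ->
  depends_on J (fun w => U w + V w).
Proof. by case=> hU [hV]; split; exact: measurable_funD. Qed.

Lemma dependsM J U V : depends_on J U -> depends_on J V ->
  depends_on J (fun w => U w * V w).
Proof. by case=> hU [hV]; split; exact: measurable_funM. Qed.

Lemma depends_sum J (K : Type) (s : seq K) (A : pred K) (F : K -> Om -> R) :
  (forall i, A i -> depends_on J (F i)) ->
  depends_on J (fun w => \sum_(i <- s | A i) F i w).
Proof.
move=> iF; elim: s => [|i s IHs].
  by under eq_fun do rewrite big_nil; exact: depends_cst.
case Ai: (A i); under eq_fun do rewrite big_cons Ai //; last exact: IHs.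
by apply: dependsD => //; exact: iF.
Qed.

Lemma depends_comp J c (f : E -> R) : J c -> measurable_fun setT f ->
  depends_on J (f \o X c).
Proof.
move=> Jc mf; split=> _ B mB; rewrite setTI; apply: sub_gen_smallest.
exists (fun c' => if c' == c then f @^-1` B else setT).
  move=> c'; case: eqP => // _; rewrite -[X in measurable X]setTI; exact: mf.
apply/seteqP; split => [w fB c' _|w h] /=; first by case: eqP => // ->.
by have := h c Jc; rewrite /= eqxx.
Qed.

Lemma depends_sub (J K : pred I) U : (forall c, J c -> K c) -> depends_on J U ->
  depends_on K U.
Proof.
move=> JK [hU]; split=> _ B mB; have := hU measurableT B mB; rewrite !setTI.
apply: smallest_sub; first exact: smallest_sigma_algebra.
move=> _ [A mA ->]; apply: sub_gen_smallest.
exists (fun c => if J c then A c else setT); first by move=> c; case: ifP.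
apply/seteqP; split => [w h c /= Kc|w h c /= Jc].
  by case: ifP => // Jc; exact: h.
by have := h c (JK _ Jc); rewrite /= Jc.
Qed.

Lemma cylinders_setI J : setI_closed (cylinders J).
Proof.
move=> _ _ [A mA ->] [B mB ->]; exists (fun c => A c `&` B c).
  by move=> c; exact: measurableI.
by rewrite -bigcapI; apply: eq_bigcapr => c _; rewrite preimage_setI.
Qed.

Lemma cylinders_meas J : cylinders J `<=` measurable.
Proof.
move=> _ [A mA ->]; apply: fin_bigcap_measurable => // c _.
by rewrite -[X in measurable X]setTI; exact: mX.
Qed.

Lemma sigma_cylinders_meas J : <<s cylinders J >> `<=` measurable.
Proof.
apply: smallest_sub; first exact: sigma_algebra_measurable.
exact: cylinders_meas.
Qed.

Lemma depends_meas J U : depends_on J U -> measurable_fun setT U.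
Proof.
move=> [hU] _ B mB; apply: sigma_cylinders_meas; exact: (hU measurableT B mB).
Qed.

Hypothesis ind : independent_family.

Lemma prob_cylinder (J : pred I) (A : I -> set E) : (forall c, measurable (A c)) ->
  P (\bigcap_(c in [set c | J c]) (X c @^-1` A c)) =
  (\prod_(c | J c) P (X c @^-1` A c))%E.
Proof.
move=> mA; pose A' c := if J c then A c else setT.
rewrite [LHS](_ : _ = P (\bigcap_(c in [set: I]) (X c @^-1` A' c))); last first.
  congr (P _); apply/seteqP; split => [w h c _|w h c /= Jc].
    by rewrite /A' /=; case: ifP => // Jc; exact: h.
  by have := h c Logic.I; rewrite /A' Jc.
rewrite ind; last by move=> c; rewrite /A'; case: ifP.
rewrite [RHS]big_mkcond; apply: eq_bigr => c _; rewrite /A'; case: ifP => // _.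
by rewrite preimage_setT probability_setT.
Qed.

Lemma indep_cylinders (J K : pred I) B C : (forall c, J c -> ~~ K c) ->
  cylinders J B -> cylinders K C -> (P (B `&` C) = P B * P C)%E.
Proof.
move=> JK [A mA ->] [A' mA' ->].
pose A'' c := if J c then A c else A' c.
rewrite [LHS](_ : _ = P (\bigcap_(c in [set c | J c || K c]) (X c @^-1` A'' c))); last first.
  congr (P _); apply/seteqP; split => [w [h1 h2] c /=|w h].
    rewrite /A''; case: ifP => [Jc _|_ /= Kc]; [exact: h1|exact: h2].
  split=> c /= hc.
    by have := h c; rewrite /= /A'' hc; exact.
  have := h c; rewrite /= /A'' hc orbT; case: ifP => [/JK|_]; last exact.
  by rewrite hc.
rewrite !prob_cylinder//; last by move=> c; rewrite /A''; case: ifP.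
rewrite (bigID J)/=; congr (_ * _)%E.
  apply: eq_big => [c|c /andP[_ Jc]]; last by rewrite /A'' Jc.
  by case: (J c); rewrite ?andbT ?andbF.
apply: eq_big => [c|c /andP[_ /negbTE Jc]]; last by rewrite /A'' Jc.
by have := JK c; case: (J c) => //=; rewrite ?andbT // => /(_ isT)/negbTE ->.
Qed.

(** For a fixed C in H, the events B independent of C form a lambda-system, and it contains the
    pi-system G. *)
Lemma indep_extend (G H : set (set Om)) : setI_closed G ->
  G `<=` measurable -> H `<=` measurable ->
  (forall B C, G B -> H C -> (P (B `&` C) = P B * P C)%E) ->
  forall B C, <<s G >> B -> H C -> (P (B `&` C) = P B * P C)%E.
Proof.
move=> GI Gm Hm GH B C sB HC; have mC := Hm _ HC.
have sGm : <<s G >> `<=` measurable.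
  by apply: smallest_sub => //; exact: sigma_algebra_measurable.
pose D := [set B | measurable B /\ (P (B `&` C) = P B * P C)%E].
suff : <<s G >> `<=` D by move=> /(_ _ sB)[].
apply: lambda_system_subset => //.
- apply/dynkin_lambda_system; split.
  + by split => //; rewrite setTI probability_setT mul1e.
  + move=> A [mA hA]; split; first exact: measurableC.
    rewrite setIC -setDE measureD//=; last by rewrite -ge0_fin_numE// fin_num_measure.
    rewrite probability_setC// muleBl ?fin_num_measure//.
    by rewrite mul1e setIC hA.
  + move=> F tF hF; have mF n : measurable (F n) by case: (hF n).
    split; first exact: bigcup_measurable.
    rewrite setI_bigcupl !measure_bigcup//=; last 2 first.
      by move=> n _; exact: measurableI.
      by apply: trivIset_setIr.
    rewrite -(fineK (fin_num_measure P _ mC)) muleC -nneseriesZl//=.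
    apply: eq_eseriesr => n _; rewrite fineK ?fin_num_measure// muleC.
    by case: (hF n).
- by move=> A GA; split; [exact: Gm|exact: GH].
Qed.

(* Dynkin's lemma is applied on each side in turn. *)
Lemma indep_depends (J K : pred I) U V : (forall c, J c -> ~~ K c) ->
  depends_on J U -> depends_on K V -> indep2 P U V.
Proof.
move=> JK [hU] [hV] A B mA mB.
have sA : <<s cylinders J >> (U @^-1` A).
  by have := hU measurableT A mA; rewrite setTI.
have sB : <<s cylinders K >> (V @^-1` B).
  by have := hV measurableT B mB; rewrite setTI.
apply: (@indep_extend (cylinders J) (<<s cylinders K >>)) => //.
- exact: cylinders_setI.
- exact: cylinders_meas.
- exact: sigma_cylinders_meas.
- move=> C D hC hD; rewrite setIC muleC.
  apply: (@indep_extend (cylinders K) (cylinders J)) => //.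
  + exact: cylinders_setI.
  + exact: cylinders_meas.
  + exact: cylinders_meas.
  + by move=> C' D' hC' hD'; rewrite setIC muleC; exact: (indep_cylinders JK).
Qed.

Lemma depends_mean (J K : pred I) U V : (forall c, J c -> ~~ K c) ->
  depends_on J U -> depends_on K V -> allmom P U -> allmom P V ->
  mean P (fun w => U w * V w) = mean P U * mean P V.
Proof.
by move=> JK hU hV mU mV; apply: indep2_mean => //; exact: (indep_depends JK).
Qed.

End Family.

(** * Gaussian variables and vectors *)

Section IntegralDerivative.
Context {R : realType}.
Local Notation mu := (@lebesgue_measure R).

Lemma integral_symitv_cvg (f : R -> R) : mu.-integrable setT (EFin \o f) ->
  (\int[mu]_(x in `[(- n%:R)%R, n%:R%R]) (f x)%:E)%E @[n --> \oo] -->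
  (\int[mu]_x (f x)%:E)%E.
Proof.
move=> fi; pose f_ (n : nat) := (EFin \o f) \_ `[- n%:R, n%:R].
have mf : measurable_fun setT (EFin \o f) by case/integrableP: fi.
have := @dominated_convergence _ _ _ mu setT measurableT f_ (EFin \o f)
  (abse \o (EFin \o f)).
case => //.
- move=> n; apply/(measurable_restrictT _ _).1 => //.
  exact: measurable_funTS.
- apply: aeW => x _; apply: cvg_near_cst; near=> n.
  rewrite /f_ patchE mem_set// /= in_itv /= -ler_norml.
  by near: n; exact: nbhs_infty_ger.
- exact: integrable_abse.
- apply: aeW => x n _; rewrite /f_ patchE; case: ifP => // _.
  by rewrite /= normr0 lee_fin.
move=> _ _; apply: cvg_trans; apply: near_eq_cvg; near=> n.
by rewrite /f_ [RHS]integral_mkcond.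
Unshelve. all: by end_near. Qed.

(** The fundamental theorem of calculus on [-n, n]: the decay hypothesis makes F(n) - F(-n) at most
    2 C / n. Gaussian integration by parts takes for F a density times a function of polynomial
    growth. *)
Lemma integral_derivative_eq0 (F f : R -> R) (C : R) :
  (forall x : R, is_derive x 1 F (f x)) -> continuous f ->
  mu.-integrable setT (EFin \o f) ->
  (forall x, `|x| * `|F x| <= C) ->
  (\int[mu]_x (f x)%:E)%E = 0%E.
Proof.
move=> dF cf fi FC.
have h1 := integral_symitv_cvg fi.
have cF : continuous F.
  move=> x; apply/differentiable_continuous/derivable1_diffP; exact: ex_derive.
have h2 : (\int[mu]_(x in `[(- n%:R)%R, n%:R%R]) (f x)%:E)%E @[n --> \oo] --> (0 : \bar R)%E.
  suff : ((F n%:R - F (- n%:R))%:E @[n --> \oo] --> (0 : \bar R)%E).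
    apply: cvg_trans; apply: near_eq_cvg; near=> n.
    rewrite (@continuous_FTC2 _ _ F) ?EFinB//.
    - by rewrite gtrN// ltr0n; near: n; exact: nbhs_infty_gt.
    - by apply: continuous_subspaceT => x; exact: cf.
    - split; first by move=> x _; exact: ex_derive.
      + by apply: cvg_at_right_filter; exact: cF.
      + by apply: cvg_at_left_filter; exact: cF.
    - by move=> x _; rewrite derive1E derive_val.
  apply/fine_cvgP; split; first by near=> n.
  apply/cvgrPdist_le => e e0; near=> n.
  have n0 : 0 < n%:R :> R by rewrite ltr0n; near: n; exact: nbhs_infty_gt.
  rewrite sub0r normrN; apply: le_trans (ler_normB _ _) _.
  have FCn y : `|y| = n%:R -> `|F y| <= C / n%:R.
    by move=> yn; rewrite ler_pdivlMr// mulrC -{1}yn.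
  apply: (@le_trans _ _ (C / n%:R + C / n%:R)).
    by apply: lerD; apply: FCn; rewrite ?normrN ger0_norm// ltW.
  rewrite -mulrDl ler_pdivrMr// mulrC -ler_pdivrMr//.
  by near: n; exact: nbhs_infty_ger.
exact: (cvg_unique _ h1 h2).
Unshelve. all: by end_near. Qed.

End IntegralDerivative.

Section Gaussian.
Context {R : realType}.
Local Notation mu := (@lebesgue_measure R).

(** From |x|^k <= 1 + x^(2 k) and y^k / k! <= exp y at y = a x^2. *)
Lemma normr_expr_le_expR (a : R) (k : nat) : 0 < a ->
  exists C, 0 < C /\ forall x, `|x| ^+ k <= C * expR (a * x ^+ 2).
Proof.
move=> a0; exists (1 + k`!%:R / a ^+ k).
have h0 : 0 <= k`!%:R / a ^+ k by rewrite divr_ge0// exprn_ge0// ltW.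
split; first by rewrite ltr_pwDl.
move=> x; have y0 : 0 <= a * x ^+ 2 by rewrite mulr_ge0 ?sqr_ge0// ltW.
have hk : (a * x ^+ 2) ^+ k <= k`!%:R * expR (a * x ^+ 2).
  case: k h0 => [|k] _.
    by rewrite expr0 fact0 mul1r -expR0 ler_expR.
  have := expR_ge1Dxn k y0 => h.
  rewrite [leRHS]mulrC -ler_pdivrMr ?ltr0n ?fact_gt0//.
  by apply: le_trans h; rewrite lerDr.
have e1 : 1 <= expR (a * x ^+ 2) by rewrite -expR0 ler_expR.
have h1 : `|x| ^+ k <= 1 + x ^+ (2 * k).
  rewrite exprM -(real_normK (num_real x)) -exprM mulnC exprM.
  set b := `|x| ^+ k; have b0 : 0 <= b by rewrite exprn_ge0.
  have := sqr_ge0 (b - 1); nra.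
apply: le_trans h1 _; rewrite mulrDl mul1r; apply: lerD => //.
rewrite mulrAC ler_pdivlMr ?exprn_gt0//.
by rewrite [x ^+ _]exprM -exprMn mulrC.
Qed.

Definition gaussE (a x : R) : R := expR (- (a * x ^+ 2)).

Lemma is_derive_pow k (x : R) : is_derive x 1 (fun x : R => x ^+ k.+1) (k.+1%:R * x ^+ k).
Proof.
elim: k => [|k IHk].
  by apply: is_derive_eq; rewrite expr0 mulr1.
rewrite (_ : (fun x : R => x ^+ k.+2) = (fun x => x * x ^+ k.+1)); last first.
  by apply/funext => y; rewrite exprS.
apply: is_derive_eq; rewrite /GRing.scale/= -[k.+2%:R]natr1 exprS; ring.
Qed.

Lemma is_derive_gaussE (a x : R) :
  is_derive x 1 (gaussE a) (- (2 * a * x) * gaussE a x).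
Proof.
have h : is_derive x 1 (fun x : R => - (a * x ^+ 2)) (- (2 * a * x)).
  apply: is_derive_eq; rewrite /GRing.scale /=; ring.
rewrite mulrC; exact: (@is_derive1_comp _ expR _ x _ _ (is_derive_expR _) h).
Qed.

Lemma continuous_derive (F : R -> R) (f : R -> R) :
  (forall x : R, is_derive x 1 F (f x)) -> continuous F.
Proof.
by move=> dF x; apply/differentiable_continuous/derivable1_diffP; exact: ex_derive.
Qed.

Lemma continuous_gaussE (a : R) : continuous (gaussE a).
Proof. exact: (continuous_derive (is_derive_gaussE a)). Qed.

Lemma measurable_gaussE (a : R) : measurable_fun [set: R] (gaussE a).
Proof. apply: continuous_measurable_fun; exact: continuous_gaussE. Qed.

Variable s : R.
Hypothesis s0 : s != 0.
Let a : R := (s ^+ 2 *+ 2)^-1.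

Let a_gt0 : 0 < a.
Proof. by rewrite invr_gt0 pmulrn_lgt0// exprn_even_gt0. Qed.

Lemma normal_pdf_gaussE (x : R) : normal_pdf 0 s x = normal_peak s * gaussE a x.
Proof.
by rewrite normal_pdfE// /normal_fun subr0 mulNr [x ^+ 2 / _]mulrC.
Qed.

Lemma integrable_gaussE_poly (f : R -> R) (k : nat) (C : R) :
  measurable_fun setT f ->
  (forall x, `|f x| <= C * (1 + `|x| ^+ k)) ->
  mu.-integrable setT (EFin \o (fun x => f x * gaussE a x)).
Proof.
move=> mf fk.
have C0 : 0 <= C.
  have := le_trans (normr_ge0 _) (fk 0) => h.
  rewrite -(pmulr_lge0 _ (_ : 0 < 1 + `|0 : R| ^+ k))//.
(* Half of the exponent absorbs the polynomial; the other half is the Gaussian density of standard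
   deviation s sqrt 2, known to be integrable. *)
pose t := s * Num.sqrt 2.
have t0 : t != 0 by rewrite mulf_neq0// gt_eqF// sqrtr_gt0.
have tE : (t ^+ 2 *+ 2)^-1 = a / 2.
  by rewrite /t exprMn sqr_sqrtr// /a; field; rewrite s0.
have [D [D0 DE]] := @normr_expr_le_expR (a / 2) k (divr_gt0 a_gt0 (ltr0Sn _ 1)).
have key x : (1 + `|x| ^+ k) * gaussE a x <= (1 + D) * expR (- (a / 2 * x ^+ 2)).
  have -> : gaussE a x = expR (- (a / 2 * x ^+ 2)) * expR (- (a / 2 * x ^+ 2)).
    by rewrite -expRD /gaussE; congr expR; field.
  rewrite mulrA ler_pM2r ?expR_gt0// mulrDl mul1r; apply: lerD.
    rewrite -expR0 ler_expR oppr_le0 mulr_ge0 ?sqr_ge0//.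
    by rewrite divr_ge0// ltW.
  by rewrite -ler_pdivlMr ?expR_gt0// -expRN opprK.
have hi := @integrable_normal_pdf R 0 t.
have := integrableZl measurableT (C * (1 + D) / normal_peak t) hi.
apply: le_integrable => //.
  apply/measurable_EFinP/measurable_funM => //.
  exact: measurable_gaussE.
move=> x _ /=; rewrite normal_pdfE// /normal_fun subr0 mulNr.
rewrite lee_fin [leRHS]ger0_norm; last first.
  rewrite !mulr_ge0 ?invr_ge0 ?normal_peak_ge0 ?expR_ge0//.
  by rewrite addr_ge0// ltW.
rewrite normrM [`|gaussE _ _|]ger0_norm ?expR_ge0//.
apply: (@le_trans _ _ (C * ((1 + `|x| ^+ k) * gaussE a x))).
  by rewrite mulrA ler_wpM2r ?expR_ge0.
have -> : C * (1 + D) / normal_peak t * (normal_peak t * expR (- (x ^+ 2 / (t ^+ 2 *+ 2)))) =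
  C * ((1 + D) * expR (- (a / 2 * x ^+ 2))).
  rewrite tE (mulrC (x ^+ 2)); field; rewrite gt_eqF//; exact: normal_peak_gt0.
by rewrite ler_wpM2l.
Qed.

(** The change of variables produces a Radon-Nikodym derivative, which coincides almost everywhere
    with [normal_pdf] because both integrate to the same measure over every measurable set. *)
Lemma ge0_integral_normal_prob (f : R -> \bar R) :
  (forall x, 0 <= f x)%E -> measurable_fun setT f ->
  (\int[normal_prob 0 s]_x f x = \int[mu]_x (f x * (normal_pdf 0 s x)%:E))%E.
Proof.
move=> f0 mf.
have dom := @normal_prob_dominates R 0 s.
rewrite -(Radon_Nikodym_SigmaFinite.change_of_variables dom)//.
have ig := Radon_Nikodym_SigmaFinite.f_integrable dom.
apply: ae_eq_integral => //.
- by apply: emeasurable_funM => //; exact: (measurable_int _ ig).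
- by apply: emeasurable_funM => //; apply/measurable_EFinP; exact: measurable_normal_pdf.
- apply: ae_eqe_mul2l => /=; apply: integral_ae_eq => //=.
  + by apply/measurable_EFinP; exact: measurable_normal_pdf.
  + move=> E _ mE; rewrite -Radon_Nikodym_SigmaFinite.f_integral//.
Qed.

Lemma integrable_normal_prob (f : R -> R) : measurable_fun setT f ->
  mu.-integrable setT (EFin \o (fun x => f x * gaussE a x)) ->
  integ (normal_prob 0 s) f /\
  mean (normal_prob 0 s) f = normal_peak s * (\int[mu]_x (f x * gaussE a x))%R.
Proof.
move=> mf fi.
have fi' : mu.-integrable setT (fun x => (f x)%:E * (normal_pdf 0 s x)%:E)%E.
  have := integrableZl measurableT (normal_peak s) fi.
  apply: eq_integrable => // x _ /=.
  by rewrite normal_pdf_gaussE -!EFinM mulrCA.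
have mf' : measurable_fun setT (EFin \o f) by exact/measurable_EFinP.
have nn : integ (normal_prob 0 s) f.
  apply/integrableP; split => //.
  rewrite ge0_integral_normal_prob//; last exact: measurableT_comp.
  have /integrableP[_] := fi'; apply: le_lt_trans.
  apply: ge0_le_integral => //.
  - by move=> x _; rewrite mule_ge0// lee_fin normal_pdf_ge0.
  - apply: emeasurable_funM; first exact: measurableT_comp.
    by apply/measurable_EFinP; exact: measurable_normal_pdf.
  - by apply: measurableT_comp => //; case/integrableP: fi'.
  - move=> x _; rewrite /= normrM (ger0_norm (normal_pdf_ge0 _ _ _)) EFinM//.
split => //.
(* The change of measure is known for nonnegative functions; f is then written as |f| - (|f| -
   f). *)
have pos (h : R -> R) : (forall x, 0 <= h x) -> measurable_fun setT h ->
    mu.-integrable setT (EFin \o (fun x => h x * gaussE a x)) ->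
    mean (normal_prob 0 s) h = normal_peak s * (\int[mu]_x (h x * gaussE a x))%R.
  move=> h0 mh hi; rewrite -RintegralZl// /mean /Rintegral; congr fine.
  rewrite ge0_integral_normal_prob//; last exact/measurable_EFinP.
  by apply: eq_integral => x _; rewrite normal_pdf_gaussE -EFinM mulrCA.
have mg : measurable_fun setT (fun x => `|f x|) by exact: measurableT_comp.
have ig : mu.-integrable setT (EFin \o (fun x => `|f x| * gaussE a x)).
  have := integrable_norm fi; apply: eq_integrable => // x _ /=.
  by rewrite normrM [`|gaussE _ _|]ger0_norm ?expR_ge0.
have ih : mu.-integrable setT (EFin \o (fun x => (`|f x| - f x) * gaussE a x)).
  have := integrableB measurableT ig fi; apply: eq_integrable => // x _ /=.
  by rewrite mulrBl.
have -> : mean (normal_prob 0 s) f = mean (normal_prob 0 s) (fun x => `|f x|) -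
    mean (normal_prob 0 s) (fun x => `|f x| - f x).
  rewrite -meanB; last 2 first.
  - exact: integ_norm.
  - by apply: integB => //; exact: integ_norm.
  by apply: eq_mean => x; rewrite opprB addrC subrK.
rewrite !pos//; last 2 first.
- by move=> x; rewrite subr_ge0 ler_norm.
- exact: measurable_funB.
rewrite -mulrBr -RintegralB//; congr (_ * _); apply: eq_Rintegral => x _.
by rewrite -mulrBl opprB addrC subrK.
Qed.

Lemma normal_poly (f : R -> R) (k : nat) (C : R) :
  measurable_fun setT f -> (forall x, `|f x| <= C * (1 + `|x| ^+ k)) ->
  integ (normal_prob 0 s) f /\
  mean (normal_prob 0 s) f = normal_peak s * (\int[mu]_x (f x * gaussE a x))%R.
Proof. by move=> mf hf; apply: integrable_normal_prob => //; exact: integrable_gaussE_poly hf. Qed.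

Lemma allmom_normal : allmom (normal_prob 0 s) idfun.
Proof.
split; first exact: measurable_id.
move=> k; have mX : measurable_fun setT (fun x : R => `|x| ^+ k).
  by apply: measurable_funX; apply: continuous_measurable_fun; exact: norm_continuous.
have bX (x : R) : `| `|x| ^+ k | <= 1 * (1 + `|x| ^+ k).
  by rewrite mul1r normrX normr_id lerDr.
exact: (normal_poly mX bX).1.
Qed.

(* Integration by parts against the Gaussian density. *)
Lemma stein_normal (f f' : R -> R) (k : nat) (C : R) :
  (forall x : R, is_derive x 1 f (f' x)) -> continuous f' ->
  (forall x, `|f x| <= C * (1 + `|x| ^+ k)) ->
  (forall x, `|f' x| <= C * (1 + `|x| ^+ k)) ->
  mean (normal_prob 0 s) (fun x => x * f x) = s ^+ 2 * mean (normal_prob 0 s) f'.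
Proof.
move=> df cf' fk f'k.
have cf := continuous_derive df.
have mf : measurable_fun setT f by exact: continuous_measurable_fun.
have mf' : measurable_fun setT f' by exact: continuous_measurable_fun.
have C0 : 0 <= C.
  have := le_trans (normr_ge0 _) (fk 0) => h.
  by rewrite -(pmulr_lge0 _ (_ : 0 < 1 + `|0 : R| ^+ k)).
have xfk x : `|x * f x| <= (2 * C) * (1 + `|x| ^+ k.+1).
  rewrite normrM.
  apply: (@le_trans _ _ (`|x| * (C * (1 + `|x| ^+ k)))); first by rewrite ler_wpM2l.
  rewrite exprS; set y := `|x|; have y0 : 0 <= y by rewrite normr_ge0.
  have z0 : 0 <= y ^+ k by rewrite exprn_ge0.
  have [y1|y1] := leP y 1.
    have : y * y ^+ k >= 0 by rewrite mulr_ge0. nra.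
  have h : 1 <= y ^+ k by rewrite exprn_ege1// ltW.
  have : C * (y * y ^+ k - y) >= 0.
    by rewrite mulr_ge0// -[X in _ - X]mulr1 -mulrBr mulr_ge0// subr_ge0.
  nra.
have mxf : measurable_fun setT (fun x : R => x * f x) by exact: measurable_funM.
have [i1 ->] := normal_poly mxf xfk.
have [i2 ->] := normal_poly mf' f'k.
have j1 := integrable_gaussE_poly mxf xfk.
have j2 := integrable_gaussE_poly mf' f'k.
have j3 : mu.-integrable setT (EFin \o (fun x => f' x * gaussE a x - (2 * a) * (x * f x * gaussE a x))).
  have := integrableB measurableT j2 (integrableZl measurableT (2 * a) j1).
  by apply: eq_integrable => // x _ /=.
have : (\int[mu]_x (f' x * gaussE a x - (2 * a) * (x * f x * gaussE a x)))%R = 0.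
  rewrite /Rintegral.
  have [D [D0 DE]] := @normr_expr_le_expR a 1 a_gt0.
  have [D' [D'0 D'E]] := @normr_expr_le_expR a k.+1 a_gt0.
  have dfg (x : R) : is_derive x 1 (fun x => f x * gaussE a x)
      (f' x * gaussE a x - 2 * a * (x * f x * gaussE a x)).
    have := df x; have := is_derive_gaussE a x => h1 h2.
    apply: is_derive_eq; rewrite /GRing.scale/=; ring.
  rewrite (integral_derivative_eq0 (C := C * (D + D')) dfg)//.
  - move=> x; apply: cvgB.
      by apply: cvgM; [exact: cf'|exact: continuous_gaussE].
    apply: cvgM; first exact: cvg_cst.
    apply: cvgM; last exact: continuous_gaussE.
    by apply: cvgM; [exact: cvg_id|exact: cf].
  - move=> x; rewrite normrM [`|gaussE _ _|]ger0_norm ?expR_ge0//.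
    rewrite /gaussE expRN mulrA ler_pdivrMr ?expR_gt0//.
    apply: (@le_trans _ _ (`|x| * (C * (1 + `|x| ^+ k)))); first by rewrite ler_wpM2l.
    rewrite mulrCA -mulrA ler_wpM2l// mulrDr mulr1 -exprS mulrDl lerD//.
    by have := DE x; rewrite expr1.
rewrite RintegralB//=; last first.
  have := integrableZl measurableT (2 * a) j1.
  by apply: eq_integrable => // x _.
rewrite RintegralZl//= => /eqP; rewrite subr_eq0 => /eqP ->.
rewrite /a; set J := Rintegral _ _ _; field; rewrite ?s0//.
Qed.

Lemma mean_normal1 : mean (normal_prob 0 s) idfun = 0.
Proof.
have := @stein_normal (cst 1) (cst 0) 0 1.
rewrite mean_cst mulr0; under eq_mean do rewrite mulr1; apply.
- by move=> x; exact: cvg_cst.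
- by move=> x; rewrite /= normr1 expr0 mul1r lerDl.
- by move=> x; rewrite /= normr0 expr0 mul1r.
Qed.

Lemma mean_normalSS k : mean (normal_prob 0 s) (fun x => x ^+ k.+2) =
  s ^+ 2 * k.+1%:R * mean (normal_prob 0 s) (fun x => x ^+ k).
Proof.
have N k' := allmom_integ (allmomX k' allmom_normal).
have := @stein_normal (fun x => x ^+ k.+1) (fun x => k.+1%:R * x ^+ k) k.+1 (k.+1%:R * 2).
rewrite (meanZ _ (N k)) mulrA; under eq_mean do rewrite exprS; apply.
- exact: is_derive_pow.
- by move=> x; apply: cvgM; [exact: cvg_cst|exact: exprn_continuous].
- move=> x; rewrite normrX; have : 0 <= `|x| ^+ k.+1 by rewrite exprn_ge0.
  have : 1 <= k.+1%:R :> R by rewrite ler1n. nra.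
- move=> x; rewrite normrM normr_nat -mulrA ler_wpM2l// normrX.
  set y := `|x|; have y0 : 0 <= y by rewrite normr_ge0.
  have z0 : 0 <= y ^+ k by rewrite exprn_ge0.
  rewrite exprS; have [y1|y1] := leP y 1.
    have : y ^+ k <= 1 by rewrite exprn_ile1.
    have : y * y ^+ k >= 0 by rewrite mulr_ge0. nra.
  have : y ^+ k <= y * y ^+ k by rewrite ler_peMl// ltW. nra.
Qed.

(** Differentiation under the integral followed by integration by parts gives G'(t) = - s^2 t G(t),
    so that G(t) exp(s^2 t^2 / 2) is constant. *)
Lemma mean_normal_cos (r c : R) :
  mean (normal_prob 0 s) (fun x => cos (r * x + c)) = expR (- (s ^+ 2 * r ^+ 2 / 2)) * cos c.
Proof.
pose G t := mean (normal_prob 0 s) (fun x => cos (t * x + c)).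
have dcos (t x : R) : is_derive t 1 (fun t => cos (t * x + c)) (- (x * sin (t * x + c))).
  have h : is_derive t 1 (fun t => t * x + c) x.
    by apply: is_derive_eq; rewrite /GRing.scale/=; ring.
  have := @is_derive1_comp _ cos _ t _ _ (is_derive_cos _) h.
  by rewrite mulNr mulrC.
have dsin (t x : R) : is_derive x 1 (fun x => sin (t * x + c)) (t * cos (t * x + c)).
  have h : is_derive x 1 (fun x => t * x + c) t.
    by apply: is_derive_eq; rewrite /GRing.scale/=; ring.
  have := @is_derive1_comp _ sin _ x _ _ (is_derive_sin _) h.
  by rewrite mulrC.
have mcos (t : R) : measurable_fun setT (fun x => cos (t * x + c)).
  apply: measurableT_comp; first by apply: continuous_measurable_fun; exact: continuous_cos.
  by apply: measurable_funD => //; exact: measurable_funM.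
have icos t : integ (normal_prob 0 s) (fun x => cos (t * x + c)).
  have b1 (x : R) : `|cos (t * x + c)| <= 1 * (1 + `|x| ^+ 0).
    by rewrite mul1r expr0; apply: le_trans (cos_max _) _; rewrite lerDl.
  exact: (normal_poly (mcos t) b1).1.
have dG (t : R) : is_derive t 1 G (- (s ^+ 2 * t) * G t).
  have key : (G^`()%classic) t = - (s ^+ 2 * t) * G t /\ derivable G t 1.
    have ht : `]t - 1, t + 1[%classic t by rewrite /= in_itv/= ltrBlDr ltrDl ltr01.
    have iabs : (normal_prob 0 s).-integrable setT (EFin \o (fun x : R => `|x|)).
      exact: integ_norm (allmom_integ allmom_normal).
    have d1 (x y : R) : derivable (fun t : R => cos (t * y + c)) x 1.
      by have := dcos x y; move=> ?; exact: ex_derive.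
    have d1E (x y : R) : partial1of2 (fun t y : R => cos (t * y + c)) x y = - (y * sin (x * y + c)).
      by rewrite partial1of2E; have := dcos x y; move=> ?; rewrite derive_val.
    have bd (x y : R) : `|partial1of2 (fun t y : R => cos (t * y + c)) x y| <= `|y|.
      by rewrite d1E normrN normrM ler_piMr// sin_max.
    split; last first.
      exact: (@derivable_under_integral _ _ _ (normal_prob 0 s)
        (fun t y : R => cos (t * y + c)) setT measurableT t _ _ ht
        (fun x _ => icos x) (fun x y _ _ => d1 x y) (fun y : R => `|y|)
        (fun y => normr_ge0 y) iabs (fun x y _ _ => bd x y)).
    rewrite (@differentiation_under_integral _ _ _ (normal_prob 0 s)
      (fun t y : R => cos (t * y + c)) setT measurableT t _ _ ht
      (fun x _ => icos x) (fun x y _ _ => d1 x y) (fun y : R => `|y|)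
      (fun y => normr_ge0 y) iabs (fun x y _ _ => bd x y)).
    have := @stein_normal (fun x => sin (t * x + c)) (fun x => t * cos (t * x + c)) 0 (1 + `|t|) => st.
    transitivity (- mean (normal_prob 0 s) (fun x => x * sin (t * x + c))).
      rewrite -meanN; first by apply: eq_mean => x; rewrite d1E.
      have ms : measurable_fun setT (fun x : R => x * sin (t * x + c)).
        apply: measurable_funM => //; apply: measurableT_comp.
          by apply: continuous_measurable_fun; exact: continuous_sin.
        by apply: measurable_funD => //; exact: measurable_funM.
      have bs (x : R) : `|x * sin (t * x + c)| <= 1 * (1 + `|x| ^+ 1).
        rewrite normrM expr1 mul1r; have := sin_max (t * x + c).
        have := normr_ge0 x; nra.
      exact: (normal_poly ms bs).1.
    rewrite st.
    - by rewrite (meanZ _ (icos t)) mulrA mulNr.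
    - have h : forall x : R, is_derive x 1 (fun x => cos (t * x + c)) (- (t * sin (t * x + c))).
        move=> x; have h : is_derive x 1 (fun x => t * x + c) t.
          by apply: is_derive_eq; rewrite /GRing.scale/=; ring.
        have := @is_derive1_comp _ cos _ x _ _ (is_derive_cos _) h.
        by rewrite mulNr mulrC.
      by move=> x; apply: cvgM; [exact: cvg_cst|exact: (continuous_derive h)].
    - move=> x; rewrite expr0; have := sin_max (t * x + c).
      have := normr_ge0 t; nra.
    - move=> x; rewrite expr0 normrM; have := cos_max (t * x + c).
      have := normr_ge0 t; have := normr_ge0 (cos (t * x + c)); nra.
  by split; [exact: key.2|rewrite -derive1E key.1].
pose H t := G t * expR (s ^+ 2 / 2 * t ^+ 2).
have dH (t : R) : is_derive t 1 H 0.
  have h : is_derive t 1 (fun t : R => s ^+ 2 / 2 * t ^+ 2) (s ^+ 2 * t).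
    by apply: is_derive_eq; rewrite /GRing.scale/=; field.
  have := @is_derive1_comp _ expR _ t _ _ (is_derive_expR _) h => h2.
  have h1 := dG t.
  apply: is_derive_eq; rewrite /GRing.scale/=; ring.
have := is_derive_0_is_cst r 0 dH; rewrite /H expr0n/= mulr0 expR0 mulr1.
have -> : G 0 = cos c.
  rewrite /G -[RHS](mean_cst (normal_prob 0 s)); apply: eq_mean => x /=.
  by rewrite mul0r add0r.
move=> <-; rewrite -[LHS]/(G r) mulrCA -expRD.
by rewrite [X in expR X](_ : _ = 0) ?expR0 ?mulr1//; ring.
Qed.

End Gaussian.

Section GaussianVariable.
Context {R : realType} {d : measure_display} {Om : measurableType d}.
Variable P : probability Om R.

Lemma law_mean (nu : probability (measurableTypeR R) R) (X : Om -> R) (f : R -> R) :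
  measurable_fun setT X ->
  (forall A : set R, measurable A -> P (X @^-1` A) = nu A) ->
  measurable_fun setT f -> integ nu f ->
  integ P (fun w => f (X w)) /\ mean P (fun w => f (X w)) = mean nu f.
Proof.
move=> mX hX mf fi.
have mX' : @measurable_fun _ _ Om (measurableTypeR R) setT X by exact: mX.
pose X' : {mfun Om >-> measurableTypeR R} := HB.pack X (@isMeasurableFun.Build _ _ Om (measurableTypeR R) X mX').
have eqm A : measurable A -> nu A = distribution P X' A by move=> /hX <-.
have mf' : measurable_fun setT (EFin \o f) by exact/measurable_EFinP.
have iP : integ P (fun w => f (X w)).
  apply/integrableP; split; first exact: measurableT_comp mf' mX.
  have /integrableP[_] := fi.
  rewrite (eq_measure_integral (distribution P X')); last by move=> A mA _; exact: eqm.
  by rewrite ge0_integral_distribution//; exact: measurableT_comp.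
split => //; rewrite /mean /Rintegral; congr fine.
rewrite [RHS](eq_measure_integral (distribution P X')); last by move=> A mA _; exact: eqm.
by rewrite integral_distribution.
Qed.

Variables (X : Om -> R) (v : R).
Hypotheses (v0 : 0 <= v) (mX : measurable_fun setT X).
Hypothesis lawX : forall A : set R, measurable A -> P (X @^-1` A) = normal_law 0 v A.

Lemma gaussian_mean (f : R -> R) : measurable_fun setT f ->
  (v != 0 -> integ (normal_prob 0 (Num.sqrt v)) f) ->
  integ P (fun w => f (X w)) /\
  mean P (fun w => f (X w)) = if v == 0 then f 0 else mean (normal_prob 0 (Num.sqrt v)) f.
Proof.
move=> mf fi; have [ve|vn] := eqVneq v 0; last first.
  apply: law_mean => //; last exact: fi.
  by move=> A mA; rewrite lawX// /normal_law (negbTE vn).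
have [|||i1 ->] := @law_mean (@dirac _ (measurableTypeR R) 0 R) X f mX => //.
- by move=> A mA; rewrite lawX// /normal_law ve eqxx.
- apply/integrableP; split; first exact/measurable_EFinP.
  rewrite integral_dirac//; last by apply/measurableT_comp => //; exact/measurable_EFinP.
  by rewrite diracT mul1e ltry.
split => //; rewrite /mean /Rintegral integral_dirac//; last exact/measurable_EFinP.
by rewrite diracT mul1e.
Qed.

Let sv : v != 0 -> Num.sqrt v != 0.
Proof. by move=> vn; rewrite gt_eqF// sqrtr_gt0 lt_neqAle eq_sym vn. Qed.

Lemma allmom_gaussian : allmom P X.
Proof.
split => // k; apply: (proj1 (@gaussian_mean (fun x : R => `|x| ^+ k) _ _)).
  by apply: measurable_funX; apply: continuous_measurable_fun; exact: norm_continuous.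
by move=> /sv vn; have [_] := allmom_normal vn; exact.
Qed.

Lemma gaussian_moment k : mean P (fun w => X w ^+ k) =
  if v == 0 then 0 ^+ k else mean (normal_prob 0 (Num.sqrt v)) (fun x => x ^+ k).
Proof.
apply: (proj2 (@gaussian_mean (fun x : R => x ^+ k) _ _)).
  by apply: continuous_measurable_fun; exact: exprn_continuous.
by move=> /sv vn; exact: allmom_integ (allmomX k (allmom_normal vn)).
Qed.

Lemma gaussian_moment1 : mean P X = 0.
Proof.
have := gaussian_moment 1; under eq_mean do rewrite expr1; move=> ->.
by rewrite expr1; case: eqP => // /eqP vn; rewrite -[RHS](mean_normal1 (sv vn)).
Qed.

Lemma gaussian_moment2 : mean P (fun w => X w ^+ 2) = v.
Proof.
rewrite gaussian_moment; case: eqP => [->|/eqP vn]; first by rewrite expr0n.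
rewrite (mean_normalSS (sv vn)) sqr_sqrtr// mulr1.
by rewrite (mean_cst _ 1) mulr1.
Qed.

Lemma gaussian_moment3 : mean P (fun w => X w ^+ 3) = 0.
Proof.
rewrite gaussian_moment; case: eqP => [_|/eqP vn]; first by rewrite expr0n.
by rewrite (mean_normalSS (sv vn)) (mean_normal1 (sv vn)) mulr0.
Qed.

Lemma gaussian_moment4 : mean P (fun w => X w ^+ 4) = 3 * v ^+ 2.
Proof.
rewrite gaussian_moment; case: eqP => [->|/eqP vn]; first by rewrite !expr0n/= mulr0.
rewrite !(mean_normalSS (sv vn)) sqr_sqrtr// mulr1 (mean_cst _ 1); ring.
Qed.

Lemma gaussian_cos (r c : R) :
  mean P (fun w => cos (r * X w + c)) = expR (- (v * r ^+ 2 / 2)) * cos c.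
Proof.
have cc : continuous (fun x : R => cos (r * x + c)).
  move=> x; apply: continuous_comp; last exact: continuous_cos.
  apply: cvgD; last exact: cvg_cst.
  by apply: cvgM; [exact: cvg_cst|exact: cvg_id].
rewrite (proj2 (@gaussian_mean (fun x : R => cos (r * x + c)) _ _)).
- case: eqP => [->|/eqP vn].
    by rewrite mulr0 add0r !mul0r oppr0 expR0 mul1r.
  by rewrite (mean_normal_cos (sv vn)) sqr_sqrtr.
- exact: continuous_measurable_fun.
- move=> vn; apply: (@integ_bounded _ _ _ _ _ 1); first exact: continuous_measurable_fun.
  by move=> x; exact: cos_max.
Qed.

End GaussianVariable.

Section Isserlis.
Context {R : realType} {d : measure_display} {Om : measurableType d}.
Variables (P : probability Om R) (p : nat) (Y : {RV P >-> p.-tuple R}).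
Variable Sigma : 'M[R]_p.
Hypothesis symS : Sigma^T = Sigma.
Hypothesis psdS : forall u : 'rV[R]_p, 0 <= (u *m Sigma *m u^T) 0 0.
Hypothesis hG : centered_gaussian Y Sigma.

Let y i w := tnth (Y w) i.

Lemma measurable_coord i : measurable_fun setT (y i).
Proof. by apply: measurableT_comp (measurable_tnth i) _. Qed.

Let lin (a : 'rV[R]_p) w := \sum_(i < p) a 0 i * y i w.

Let measurable_lin a : measurable_fun setT (lin a).
Proof.
apply: measurable_sum => i; apply: measurable_funM => //.
exact: measurable_coord.
Qed.

Let q (a : 'rV[R]_p) := (a *m Sigma *m a^T) 0 0.

Let lin_law a (A : set R) : measurable A -> P (lin a @^-1` A) = normal_law 0 (q a) A.
Proof. exact: hG. Qed.

Let lin_delta i w : lin (delta_mx 0 i) w = y i w.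
Proof.
rewrite /lin (bigD1 i)//= mxE !eqxx mul1r big1 ?addr0// => j ji.
by rewrite mxE eqxx (negbTE ji) mul0r.
Qed.

Let linD a b w : lin (a + b) w = lin a w + lin b w.
Proof. by rewrite /lin -big_split/=; apply: eq_bigr => i _; rewrite mxE mulrDl. Qed.

Let linZ c a w : lin (c *: a) w = c * lin a w.
Proof. by rewrite /lin mulr_sumr; apply: eq_bigr => i _; rewrite mxE mulrA. Qed.

Lemma allmom_lin a : allmom P (lin a).
Proof. exact: (allmom_gaussian (psdS a) (measurable_lin a) (@lin_law a)). Qed.

Lemma allmom_coord i : allmom P (y i).
Proof. by apply: eq_allmom (allmom_lin (delta_mx 0 i)) => w; rewrite lin_delta. Qed.

Let B (a b : 'rV[R]_p) := (a *m Sigma *m b^T) 0 0.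

Let BDl a a' b : B (a + a') b = B a b + B a' b.
Proof. by rewrite /B !mulmxDl mxE. Qed.
Let BDr a b b' : B a (b + b') = B a b + B a b'.
Proof. by rewrite /B linearD/= mulmxDr mxE. Qed.
Let BZl c a b : B (c *: a) b = c * B a b.
Proof. by rewrite /B -!scalemxAl mxE. Qed.
Let BZr c a b : B a (c *: b) = c * B a b.
Proof. by rewrite /B linearZ/= -!scalemxAr mxE. Qed.
Let Bdelta i j : B (delta_mx 0 i) (delta_mx 0 j) = Sigma i j.
Proof. by rewrite /B -rowE trmx_delta -colE !mxE. Qed.

Let Bsym i j : Sigma i j = Sigma j i.
Proof. by rewrite -[in LHS]symS mxE. Qed.

Lemma mean_coord2 i j : mean P (fun w => y i w * y j w) = Sigma i j.
Proof.
have M a := gaussian_moment2 (psdS a) (measurable_lin a) (@lin_law a).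
have I2 a := allmom_integ (allmomX 2 (allmom_lin a)).
pose ei : 'rV[R]_p := delta_mx 0 i; pose ej : 'rV[R]_p := delta_mx 0 j.
(* Polarization 2 x y = (x + y)^2 - x^2 - y^2, since only linear combinations have a known law. *)
transitivity (mean P (fun w => 2^-1 * (lin (ei + ej) w ^+ 2 +
    (-1) * (lin ei w ^+ 2 + lin ej w ^+ 2)))).
  by apply: eq_mean => w; rewrite linD !lin_delta; field.
have h1 := integD (I2 ei) (I2 ej).
have h2 := integZ (-1) h1.
rewrite (meanZ _ (integD (I2 _) h2)) (meanD (I2 _) h2) (meanZ _ h1) (meanD (I2 _) (I2 _)).
rewrite !M -![(_ *m _ *m _) 0 0]/(B _ _) !(BDl, BDr) !Bdelta (Bsym j i); by field.
Qed.

Let signs : seq (R * R * R) := [:: (1, 1, 1); (1, 1, -1); (1, -1, 1); (1, -1, -1);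
  (-1, 1, 1); (-1, 1, -1); (-1, -1, 1); (-1, -1, -1)].

(* Polarization: [192 x y z v] is the sum over signs of
   [s t u (x + s y + t z + u v)^4]. *)
Lemma mean_coord4 i j k l :
  mean P (fun w => y i w * y j w * (y k w * y l w)) =
  Sigma i j * Sigma k l + Sigma i k * Sigma j l + Sigma i l * Sigma j k.
Proof.
have M a := gaussian_moment4 (psdS a) (measurable_lin a) (@lin_law a).
have I4 a := allmom_integ (allmomX 4 (allmom_lin a)).
pose e i : 'rV[R]_p := delta_mx 0 i.
pose a s := e i + s.1.1 *: e j + s.1.2 *: e k + s.2 *: e l.
transitivity (mean P (fun w => \sum_(s <- signs)
    (s.1.1 * s.1.2 * s.2 / 192) * lin (a s) w ^+ 4)).
  apply: eq_mean => w; under eq_bigr do rewrite /a !(linD, linZ) !lin_delta.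
  by rewrite !big_cons big_nil /=; field.
rewrite mean_sum; last by move=> s _; exact: integZ.
under eq_bigr do rewrite (meanZ _ (I4 _)) M.
under eq_bigr do rewrite -[(_ *m _ *m _) 0 0]/(B _ _) /a !(BDl, BDr, BZl, BZr) !Bdelta.
rewrite !big_cons big_nil /= (Bsym j i) (Bsym k i) (Bsym l i) (Bsym k j) (Bsym l j) (Bsym l k).
by field.
Qed.

Lemma cov_coord2 i j k l :
  mean P (fun w => (y i w * y j w - Sigma i j) * (y k w * y l w - Sigma k l)) =
  Sigma i k * Sigma j l + Sigma i l * Sigma j k.
Proof.
have A2 i' j' := allmomM (allmom_coord i') (allmom_coord j').
have h1 := allmom_integ (allmomM (A2 i j) (A2 k l)).
have h2 := integZ (- Sigma k l) (allmom_integ (A2 i j)).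
have h3 := integZ (- Sigma i j) (allmom_integ (A2 k l)).
have h4 := integ_cst P (Sigma i j * Sigma k l).
transitivity (mean P (fun w => y i w * y j w * (y k w * y l w) +
  (- Sigma k l * (y i w * y j w) + (- Sigma i j * (y k w * y l w) + Sigma i j * Sigma k l)))).
  by apply: eq_mean => w; ring.
rewrite (meanD h1 (integD h2 (integD h3 h4))) (meanD h2 (integD h3 h4)) (meanD h3 h4).
rewrite (meanZ _ (allmom_integ (A2 i j))) (meanZ _ (allmom_integ (A2 k l))).
rewrite (mean_cst P (Sigma i j * Sigma k l)) !mean_coord2 mean_coord4; ring.
Qed.

End Isserlis.

(** * Mean and variance of the statistic *)

Section Hoeffding.
Context {R : realType} {d : measure_display} {Om : measurableType d}.
Variable P : probability Om R.
Context {n : nat} {d' : measure_display} {E : measurableType d'}.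
Variable X : 'I_n -> Om -> E.
Hypothesis mX : forall k, measurable_fun setT (X k).
Hypothesis indX : independent_family P X.
Variables (F : finType) (phi : F -> E -> R) (m : F -> R) (C : F -> F -> R) (W : F -> R).
Hypothesis mphi : forall e, measurable_fun setT (phi e).
Hypothesis momphi : forall k e, allmom P (fun w => phi e (X k w)).
Hypothesis mean_phi : forall k e, mean P (fun w => phi e (X k w)) = m e.
Hypothesis cov_phi : forall k e e',
  mean P (fun w => (phi e (X k w) - m e) * (phi e' (X k w) - m e')) = C e e'.

(** [Lk] and [Q] are the linear and the degenerate parts of the decomposition for the kernel sum_e
    W_e phi_e(x) phi_e(y). *)
Let Y k e w := phi e (X k w) - m e.
Let Lk k w := \sum_e W e * Y k e w * m e.
Let Q k l w := \sum_e W e * Y k e w * Y l e w.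

Let momY k e : allmom P (Y k e).
Proof. by apply: allmomB => //; exact: allmom_cst. Qed.

Let meanY k e : mean P (Y k e) = 0.
Proof.
by rewrite /Y meanB ?(mean_cst P (m e)) ?mean_phi ?subrr//; [exact: allmom_integ|exact: integ_cst].
Qed.

Let depY k e : depends_on X (pred1 k) (Y k e).
Proof.
apply: dependsD; last exact: depends_cst.
by apply: (@depends_comp _ _ _ _ _ _ _ _ k (phi e)) => //=.
Qed.

Let depL k : depends_on X (pred1 k) (Lk k).
Proof.
apply: depends_sum => e _; apply: dependsM; last exact: depends_cst.
by apply: dependsM; [exact: depends_cst|exact: depY].
Qed.

Let momL k : allmom P (Lk k).
Proof.
apply: allmom_sum => e _; apply: allmomM; last exact: allmom_cst.
by apply: allmomM; [exact: allmom_cst|exact: momY].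
Qed.

Let momQ k l : allmom P (Q k l).
Proof.
apply: allmom_sum => e _; apply: allmomM; last exact: momY.
by apply: allmomM; [exact: allmom_cst|exact: momY].
Qed.

Let depQ k l : depends_on X (pred2 k l) (Q k l).
Proof.
have dk e : depends_on X (pred2 k l) (Y k e).
  by apply: depends_sub _ (depY k e) => c /= ->.
have dl e : depends_on X (pred2 k l) (Y l e).
  by apply: depends_sub _ (depY l e) => c /= ->; rewrite orbT.
apply: depends_sum => e _; apply: dependsM => //.
by apply: dependsM => //; exact: depends_cst.
Qed.

(** A centred factor attached to an index that V does not involve kills the mean; all the
    orthogonality relations below come down to this. *)
Let mean0 (J : pred 'I_n) V k e : ~~ J k -> depends_on X J V -> allmom P V ->
  mean P (fun w => V w * Y k e w) = 0.
Proof.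
move=> Jk dV mV; rewrite (depends_mean mX indX _ dV (depY k e))// ?meanY ?mulr0//.
by move=> c Jc /=; apply: contraNneq Jk => <-.
Qed.

Let mean0L (J : pred 'I_n) V k : ~~ J k -> depends_on X J V -> allmom P V ->
  mean P (fun w => V w * Lk k w) = 0.
Proof.
move=> Jk dV mV.
have I1 e := allmom_integ (allmomM mV (momY k e)).
transitivity (mean P (fun w => \sum_e (W e * m e) * (V w * Y k e w))).
  by apply: eq_mean => w; rewrite mulr_sumr; apply: eq_bigr => e _; ring.
rewrite mean_sum; last by move=> e _; exact: integZ.
by apply: big1 => e _; rewrite (meanZ _ (I1 e)) (mean0 e Jk dV mV) mulr0.
Qed.

Let mean0Q (J : pred 'I_n) V k l : k != l -> ~~ J l -> depends_on X J V -> allmom P V ->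
  mean P (fun w => V w * Q k l w) = 0.
Proof.
move=> kl Jl dV mV.
have I1 e := allmomM mV (momY k e).
have I2 e := allmom_integ (allmomM (I1 e) (momY l e)).
transitivity (mean P (fun w => \sum_e W e * (V w * Y k e w * Y l e w))).
  by apply: eq_mean => w; rewrite mulr_sumr; apply: eq_bigr => e _; ring.
rewrite mean_sum; last by move=> e _; exact: integZ.
apply: big1 => e _; rewrite (meanZ _ (I2 e)) (@mean0 (predU J (pred1 k)) _ l e) ?mulr0//.
- by rewrite /= negb_or Jl eq_sym.
- apply: dependsM; first by apply: depends_sub _ dV => c /= ->.
  by apply: depends_sub _ (depY k e) => c /= ->; rewrite orbT.
Qed.

Let Qsym k l w : Q k l w = Q l k w.
Proof. by apply: eq_bigr => e _; rewrite mulrAC. Qed.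

(** [varL] and [varQ] are the second moments of one linear term [Lk] and of one degenerate term
    [Q]. *)
Definition varL := \sum_e \sum_e' W e * m e * (W e' * m e') * C e e'.
Definition varQ := \sum_e \sum_e' W e * W e' * C e e' ^+ 2.

Lemma mean_sqr_linear k : mean P (fun w => (\sum_e W e * (phi e (X k w) - m e) * m e) ^+ 2) = varL.
Proof.
have I1 e e' := allmom_integ (allmomM (momY k e) (momY k e')).
transitivity (mean P (fun w => \sum_e \sum_e' (W e * m e * (W e' * m e')) * (Y k e w * Y k e' w))).
  apply: eq_mean => w; rewrite expr2 mulr_suml; apply: eq_bigr => e _.
  by rewrite mulr_sumr; apply: eq_bigr => e' _; rewrite /Y; ring.
rewrite mean_sum; last by move=> e _; apply: integ_sum => e' _; exact: integZ.
apply: eq_bigr => e _; rewrite mean_sum; last by move=> e' _; exact: integZ.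
by apply: eq_bigr => e' _; rewrite (meanZ _ (I1 e e')) cov_phi.
Qed.

Lemma mean_sqr_quadratic k l : k != l ->
  mean P (fun w => (\sum_e W e * (phi e (X k w) - m e) * (phi e (X l w) - m e)) ^+ 2) = varQ.
Proof.
move=> kl; have I1 k' e e' := allmomM (momY k' e) (momY k' e').
have I2 e e' := allmom_integ (allmomM (I1 k e e') (I1 l e e')).
transitivity (mean P (fun w => \sum_e \sum_e' (W e * W e') *
    ((Y k e w * Y k e' w) * (Y l e w * Y l e' w)))).
  apply: eq_mean => w; rewrite expr2 mulr_suml; apply: eq_bigr => e _.
  by rewrite mulr_sumr; apply: eq_bigr => e' _; rewrite /Y; ring.
rewrite mean_sum; last by move=> e _; apply: integ_sum => e' _; exact: integZ.
apply: eq_bigr => e _; rewrite mean_sum; last by move=> e' _; exact: integZ.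
apply: eq_bigr => e' _; rewrite (meanZ _ (I2 e e')); congr (_ * _).
rewrite (depends_mean mX indX _ (dependsM (depY k e) (depY k e')) (dependsM (depY l e) (depY l e')))//.
  by rewrite !cov_phi expr2.
by move=> c /= /eqP ->.
Qed.

Definition ustat w := \sum_(k < n) \sum_(l < n | k != l) \sum_e W e * phi e (X k w) * phi e (X l w).

Let M := \sum_e W e * m e ^+ 2.
Let nR : R := n%:R.

Let card_ne (k : 'I_n) : \sum_(l < n | k != l) (1 : R) = nR - 1.
Proof.
have : \sum_(l < n) (1 : R) = nR by rewrite sumr_const card_ord.
by rewrite (bigD1 k)//= => <-; rewrite addrAC subrr add0r; apply: eq_bigl => l; rewrite eq_sym.
Qed.

(** Expanding (m + Y)(m + Y') in each pair (k, l) gives M + Lk + Ll + Q, and each index lies in 2 (n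
    - 1) ordered pairs. *)
Let ustatE w : ustat w = nR * (nR - 1) * M + (2 * (nR - 1) * (\sum_k Lk k w) +
  \sum_k \sum_(l < n | k != l) Q k l w).
Proof.
have key (k l : 'I_n) : \sum_e W e * phi e (X k w) * phi e (X l w) =
    M + (Lk k w + Lk l w) + Q k l w.
  rewrite /M /Lk /Q -!big_split /=; apply: eq_bigr => e _; rewrite /Y; ring.
have c1 (a : R) (k : 'I_n) : \sum_(l < n | k != l) a = (nR - 1) * a.
  by rewrite -(card_ne k) mulr_suml; apply: eq_bigr => l _; rewrite mul1r.
have s1 : \sum_(k < n) \sum_(l < n | k != l) M = nR * ((nR - 1) * M).
  by under eq_bigr do rewrite c1; rewrite sumr_const card_ord -mulr_natl.
have s2 : \sum_(k < n) \sum_(l < n | k != l) Lk k w = (nR - 1) * (\sum_k Lk k w).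
  by under eq_bigr do rewrite c1; rewrite -mulr_sumr.
have s3 : \sum_(k < n) \sum_(l < n | k != l) Lk l w = (nR - 1) * (\sum_k Lk k w).
  rewrite (exchange_big_dep xpredT)//= -s2; apply: eq_bigr => l _.
  by apply: eq_bigl => k; rewrite eq_sym.
rewrite /ustat; under eq_bigr do under eq_bigr do rewrite key.
under eq_bigr do rewrite !big_split /=.
rewrite !big_split /= s1 s2 s3; ring.
Qed.

Let momSL : allmom P (fun w => \sum_k Lk k w).
Proof. by apply: allmom_sum => k _. Qed.

Let momSQ : allmom P (fun w => \sum_k \sum_(l < n | k != l) Q k l w).
Proof. by apply: allmom_sum => k _; apply: allmom_sum. Qed.

Lemma allmom_ustat : allmom P ustat.
Proof.
rewrite (_ : ustat = fun w => nR * (nR - 1) * M + (2 * (nR - 1) * (\sum_k Lk k w) +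
  \sum_k \sum_(l < n | k != l) Q k l w)); last by apply/funext => w; exact: ustatE.
apply: allmomD; first exact: allmom_cst.
by apply: allmomD => //; exact: allmomZ.
Qed.

Let mean_SL : mean P (fun w => \sum_k Lk k w) = 0.
Proof.
rewrite mean_sum; last by move=> k _; exact: allmom_integ.
apply: big1 => k _.
have := @mean0L pred0 (cst 1) k isT (depends_cst _ _ _) (allmom_cst _ _).
by under eq_mean do rewrite mul1r.
Qed.

Let mean_SQ : mean P (fun w => \sum_k \sum_(l < n | k != l) Q k l w) = 0.
Proof.
rewrite mean_sum; last by move=> k _; apply: integ_sum => l _; exact: allmom_integ.
apply: big1 => k _; rewrite mean_sum; last by move=> l _; exact: allmom_integ.
apply: big1 => l kl.
have := @mean0Q pred0 (cst 1) k l kl isT (depends_cst _ _ _) (allmom_cst _ _).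
by under eq_mean do rewrite mul1r.
Qed.

Lemma mean_ustat : mean P ustat = nR * (nR - 1) * M.
Proof.
have IL := allmom_integ momSL; have IQ := allmom_integ momSQ.
have IL2 := integZ (2 * (nR - 1)) IL.
rewrite (eq_mean P ustatE) (meanD (integ_cst P _) (integD IL2 IQ)) (meanD IL2 IQ).
by rewrite (meanZ _ IL) mean_SL mean_SQ mulr0 !addr0 (mean_cst P (nR * (nR - 1) * M)).
Qed.

Let mean_SL2 : mean P (fun w => (\sum_k Lk k w) ^+ 2) = nR * varL.
Proof.
have I2 k l := allmom_integ (allmomM (momL k) (momL l)).
transitivity (mean P (fun w => \sum_k \sum_l Lk k w * Lk l w)).
  apply: eq_mean => w; rewrite expr2 mulr_suml; apply: eq_bigr => k _.
  by rewrite mulr_sumr.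
rewrite mean_sum; last by move=> k _; apply: integ_sum.
rewrite /nR -[X in X%:R]card_ord -sum1_card natr_sum mulr_suml.
apply: eq_bigr => k _; rewrite mean_sum// (bigD1 k)//= big1 ?addr0.
  by rewrite mul1r -(mean_sqr_linear k); apply: eq_mean => w; rewrite expr2.
move=> l lk; apply: (@mean0L (pred1 k)) => //.
Qed.

Let mean_SLQ : mean P (fun w => (\sum_k Lk k w) * (\sum_k \sum_(l < n | k != l) Q k l w)) = 0.
Proof.
have I2 j k l := allmom_integ (allmomM (momL j) (momQ k l)).
transitivity (mean P (fun w => \sum_j \sum_k \sum_(l < n | k != l) Lk j w * Q k l w)).
  apply: eq_mean => w; rewrite mulr_suml; apply: eq_bigr => j _.
  by rewrite mulr_sumr; apply: eq_bigr => k _; rewrite mulr_sumr.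
rewrite mean_sum; last by move=> j _; apply: integ_sum => k _; apply: integ_sum.
apply: big1 => j _; rewrite mean_sum; last by move=> k _; apply: integ_sum.
apply: big1 => k _; rewrite mean_sum//; apply: big1 => l kl.
have [ljE|lj] := eqVneq l j; last by apply: (@mean0Q (pred1 j)).
under eq_mean do rewrite Qsym; apply: (@mean0Q (pred1 j)) => //.
  by rewrite eq_sym.
by rewrite /= -ljE.
Qed.

(** Unless {k', l'} = {k, l}, one of k' and l' is foreign to {k, l} and its centred factor kills the
    mean. Pairs being ordered, both orders count, whence the factor 2 in [mean_SQ2]. *)
Let mean_QQ k l k' l' : k != l -> k' != l' ->
  mean P (fun w => Q k l w * Q k' l' w) =
  varQ * (((k' == k) && (l' == l))%:R + ((k' == l) && (l' == k))%:R).
Proof.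
move=> kl kl'; have [h1|h1] := boolP ((k' == k) && (l' == l)).
  move: (h1) => /andP[/eqP -> /eqP ->]; rewrite (negbTE kl) /= addr0 mulr1.
  by rewrite -(mean_sqr_quadratic kl); apply: eq_mean => w; rewrite expr2.
have [h2|h2] := boolP ((k' == l) && (l' == k)).
  move: (h2) => /andP[/eqP -> /eqP ->]; rewrite add0r mulr1.
  rewrite -(mean_sqr_quadratic kl); apply: eq_mean => w; rewrite expr2.
  by rewrite (Qsym l k).
rewrite addr0 mulr0.
have [hk|hk] := boolP (k' \in [:: k; l]); last first.
  under eq_mean do rewrite (Qsym k').
  apply: (@mean0Q (pred2 k l)) => //; first by rewrite eq_sym.
  by move: hk; rewrite !inE.
apply: (@mean0Q (pred2 k l)) => //=.
move: h1 h2 hk kl'; rewrite !inE => h1 h2 /orP[] /eqP e; subst k'.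
  by move: h1; rewrite eqxx/= => /negbTE ->; rewrite orbF eq_sym.
by move: h2; rewrite eqxx/= => /negbTE ->; rewrite eq_sym => /negbTE ->.
Qed.

Let mean_SQ2 : mean P (fun w => (\sum_k \sum_(l < n | k != l) Q k l w) ^+ 2) =
  2 * (nR * (nR - 1)) * varQ.
Proof.
have I2 k l k' l' := allmom_integ (allmomM (momQ k l) (momQ k' l')).
transitivity (mean P (fun w => \sum_k \sum_(l < n | k != l)
    \sum_k' \sum_(l' < n | k' != l') Q k l w * Q k' l' w)).
  apply: eq_mean => w; rewrite expr2 mulr_suml; apply: eq_bigr => k _.
  rewrite mulr_suml; apply: eq_bigr => l _; rewrite mulr_sumr.
  by apply: eq_bigr => k' _; rewrite mulr_sumr.
rewrite mean_sum; last first.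
  by move=> k _; apply: integ_sum => l _; apply: integ_sum => k' _; apply: integ_sum.
transitivity (\sum_(k < n) \sum_(l < n | k != l) (2 * varQ)).
  apply: eq_bigr => k _; rewrite mean_sum; last first.
    by move=> l _; apply: integ_sum => k' _; apply: integ_sum.
  apply: eq_bigr => l kl; rewrite mean_sum; last by move=> k' _; apply: integ_sum.
  transitivity (\sum_(k' < n) \sum_(l' < n | k' != l')
     varQ * (((k' == k) && (l' == l))%:R + ((k' == l) && (l' == k))%:R)).
    apply: eq_bigr => k' _; rewrite mean_sum//; apply: eq_bigr => l' kl'.
    exact: mean_QQ.
  under eq_bigr do rewrite -mulr_sumr; rewrite -mulr_sumr mulrC; congr (_ * _).
  have one (a b : 'I_n) : a != b -> \sum_(k' < n) \sum_(l' < n | k' != l')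
      ((k' == a) && (l' == b))%:R = 1 :> R.
    move=> ab; rewrite (bigD1 a)//= (bigD1 b)//= !eqxx /= big1 ?addr0 ?big1 ?addr0//.
      by move=> k' /negbTE ->; rewrite big1.
    by move=> l' /andP[_ /negbTE ->].
  under eq_bigr do rewrite big_split/=.
  by rewrite big_split/= !one// eq_sym.
have c1 (a : R) (k : 'I_n) : \sum_(l < n | k != l) a = (nR - 1) * a.
  by rewrite -(card_ne k) mulr_suml; apply: eq_bigr => l _; rewrite mul1r.
under eq_bigr do rewrite c1; rewrite sumr_const card_ord -mulr_natl -/nR; ring.
Qed.

Lemma mean_sqr_ustat : mean P (fun w => (ustat w - mean P ustat) ^+ 2) =
  4 * (nR - 1) ^+ 2 * nR * varL + 2 * (nR * (nR - 1)) * varQ.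
Proof.
pose SL w := \sum_k Lk k w; pose SQ w := \sum_k \sum_(l < n | k != l) Q k l w.
have I1 := allmom_integ (allmomX 2 momSL).
have I2 := allmom_integ (allmomM momSL momSQ).
have I3 := allmom_integ (allmomX 2 momSQ).
transitivity (mean P (fun w => 4 * (nR - 1) ^+ 2 * SL w ^+ 2 +
    (4 * (nR - 1) * (SL w * SQ w) + SQ w ^+ 2))).
  by apply: eq_mean => w; rewrite ustatE mean_ustat /SL /SQ; ring.
rewrite (meanD (integZ _ I1) (integD (integZ _ I2) I3)) (meanD (integZ _ I2) I3).
rewrite (meanZ _ I1) (meanZ _ I2) mean_SL2 mean_SLQ mean_SQ2; ring.
Qed.

End Hoeffding.

Section GaussianUStat.
Context {R : realType} {d : measure_display} {Om : measurableType d}.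
Variables (P : probability Om R) (n p : nat) (X : 'I_n -> {RV P >-> p.-tuple R}).
Variable Sigma : 'M[R]_p.
Hypothesis symS : Sigma^T = Sigma.
Hypothesis psdS : forall u : 'rV[R]_p, 0 <= (u *m Sigma *m u^T) 0 0.
Hypothesis hX : iid_gaussian X Sigma.
Variable W : 'I_p -> 'I_p -> R.

Definition gstat w := \sum_(k < n) \sum_(l < n | k != l) \sum_[i < j < p]
    W i j * tnth (X k w) i * tnth (X k w) j * tnth (X l w) i * tnth (X l w) j.

(* Variances of the linear and of the quadratic Hoeffding components. *)
Definition gvarL := \sum_[i < j < p] \sum_[k < l < p]
  W i j * Sigma i j * (W k l * Sigma k l) * (Sigma i k * Sigma j l + Sigma i l * Sigma j k).

Definition gvarQ := \sum_[i < j < p] \sum_[k < l < p]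
  W i j * W k l * (Sigma i k * Sigma j l + Sigma i l * Sigma j k) ^+ 2.

Let phi (e : 'I_p * 'I_p) (x : p.-tuple R) := tnth x e.1 * tnth x e.2.
(** The general decomposition sums over a full finite type, so the constraint i < j is carried by a
    vanishing weight. *)
Let W' (e : 'I_p * 'I_p) := if (e.1 < e.2)%N then W e.1 e.2 else 0.
Let m (e : 'I_p * 'I_p) := Sigma e.1 e.2.
Let C (e f : 'I_p * 'I_p) := Sigma e.1 f.1 * Sigma e.2 f.2 + Sigma e.1 f.2 * Sigma e.2 f.1.

Let sum_lt (G : 'I_p * 'I_p -> R -> R) : (forall e, G e 0 = 0) ->
  \sum_e G e (W' e) = \sum_[i < j < p] G (i, j) (W i j).
Proof.
move=> G0; rewrite pair_big_dep /= [RHS]big_mkcond /=; apply: eq_bigr => e _.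
by rewrite /W'; case: e => i j /=; case: ifP.
Qed.

Let mX k : measurable_fun setT (X k). Proof. by []. Qed.

Let indX : independent_family P X. Proof. by case: hX. Qed.

Let mphi e : measurable_fun setT (phi e).
Proof. by apply: measurable_funM; exact: measurable_tnth. Qed.

Let mc k i := allmom_coord psdS (hX.2 k) i.

Let momphi k e : allmom P (fun w => phi e (X k w)).
Proof. by apply: allmomM; exact: mc. Qed.

Let mean_phi k e : mean P (fun w => phi e (X k w)) = m e.
Proof. exact: (mean_coord2 symS psdS (hX.2 k)). Qed.

Let cov_phi k e f :
  mean P (fun w => (phi e (X k w) - m e) * (phi f (X k w) - m f)) = C e f.
Proof. exact: (cov_coord2 symS psdS (hX.2 k)). Qed.

Let gstatE : gstat = ustat X phi W'.
Proof.
apply/funext => w; apply: eq_bigr => k _; apply: eq_bigr => l _.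
rewrite (@sum_lt (fun e c => c * phi e (X k w) * phi e (X l w))); last first.
  by move=> e; rewrite !mul0r.
by apply: eq_bigr => i _; apply: eq_bigr => j _; rewrite /phi /=; ring.
Qed.

Lemma allmom_gstat : allmom P gstat.
Proof. by rewrite gstatE; exact: (allmom_ustat m W' momphi). Qed.

Lemma mean_gstat : mean P gstat = n%:R * (n%:R - 1) * (\sum_[i < j < p] W i j * Sigma i j ^+ 2).
Proof.
rewrite gstatE (mean_ustat mX indX W' mphi momphi mean_phi); congr (_ * _).
by rewrite (@sum_lt (fun e c => c * m e ^+ 2))// => e; rewrite mul0r.
Qed.

Let gvarLE : varL m C W' = gvarL.
Proof.
rewrite /varL (@sum_lt (fun e c => \sum_e' c * m e * (W' e' * m e') * C e e')); last first.
  by move=> e; apply: big1 => f _; rewrite !mul0r.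
apply: eq_bigr => i _; apply: eq_bigr => j _.
by rewrite (@sum_lt (fun e' c => W i j * m (i, j) * (c * m e') * C (i, j) e'))// => e; rewrite !(mul0r, mulr0).
Qed.

Let gvarQE : varQ C W' = gvarQ.
Proof.
rewrite /varQ (@sum_lt (fun e c => \sum_e' c * W' e' * C e e' ^+ 2)); last first.
  by move=> e; apply: big1 => f _; rewrite !mul0r.
apply: eq_bigr => i _; apply: eq_bigr => j _.
by rewrite (@sum_lt (fun e' c => W i j * c * C (i, j) e' ^+ 2))// => e; rewrite !(mul0r, mulr0).
Qed.

Lemma mean_sqr_gstat : mean P (fun w => (gstat w - mean P gstat) ^+ 2) =
  4 * (n%:R - 1) ^+ 2 * n%:R * gvarL + 2 * (n%:R * (n%:R - 1)) * gvarQ.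
Proof.
by rewrite gstatE (mean_sqr_ustat mX indX W' mphi momphi mean_phi cov_phi) gvarLE gvarQE.
Qed.

Let momY k e : allmom P (fun w => phi e (X k w) - m e).
Proof. by apply: allmomB => //; exact: allmom_cst. Qed.

Lemma expect_sqr_linear k :
  ('E_P[fun w => ((\sum_[i < j < p] W i j *
     (tnth (X k w) i * tnth (X k w) j - Sigma i j) * Sigma i j) ^+ 2)%R] = gvarL%:E)%E.
Proof.
rewrite -gvarLE -(mean_sqr_linear W' momphi cov_phi k) -expectE; last first.
  apply/allmom_integ/allmomX/allmom_sum => e _.
  by apply: allmomM; [apply: allmomM => //; exact: allmom_cst|exact: allmom_cst].
congr expectation; apply/funext => w; congr (_ ^+ 2).
by rewrite (@sum_lt (fun e c => c * (phi e (X k w) - m e) * m e))// => e; rewrite !mul0r.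
Qed.

Lemma expect_sqr_quadratic k l : k != l ->
  ('E_P[fun w => ((\sum_[i < j < p] W i j *
     (tnth (X k w) i * tnth (X k w) j - Sigma i j) *
     (tnth (X l w) i * tnth (X l w) j - Sigma i j)) ^+ 2)%R] = gvarQ%:E)%E.
Proof.
move=> kl; rewrite -gvarQE -(mean_sqr_quadratic mX indX W' mphi momphi cov_phi kl) -expectE; last first.
  apply/allmom_integ/allmomX/allmom_sum => e _.
  by apply: allmomM => //; apply: allmomM => //; exact: allmom_cst.
congr expectation; apply/funext => w; congr (_ ^+ 2).
by rewrite (@sum_lt (fun e c => c * (phi e (X k w) - m e) * (phi e (X l w) - m e)))// => e; rewrite !mul0r.
Qed.

End GaussianUStat.

Section DhatMoments.
Context {R : realType} {d : measure_display} {Om : measurableType d}.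
Variables (alpha L phi : R) (P : probability Om R) (n p : nat).
Variables (X : 'I_n -> {RV P >-> p.-tuple R}) (Sigma : 'M[R]_p).
Hypothesis symS : Sigma^T = Sigma.
Hypothesis psdS : forall u : 'rV[R]_p, 0 <= (u *m Sigma *m u^T) 0 0.
Hypothesis hX : iid_gaussian X Sigma.
Hypotheses (n_gt1 : (1 < n)%N) (p_gt0 : (0 < p)%N).
Local Notation w_ := (fun i j : 'I_p => wstar alpha L phi i j).

Let c : R := (n%:R * (n%:R - 1) * p%:R)^-1.

Lemma DhatE w : Dhat alpha L phi X w = c * gstat X w_ w.
Proof. by []. Qed.

Let n0 : (n%:R : R) != 0. Proof. by rewrite pnatr_eq0 -lt0n ltnW. Qed.

Let n1 : (n%:R - 1 : R) != 0.
Proof. by rewrite subr_eq0 (eqr_nat R n 1) gtn_eqF. Qed.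

Let p0 : (p%:R : R) != 0.
Proof. by rewrite pnatr_eq0 -lt0n. Qed.

Let momG := allmom_gstat psdS hX w_.

Lemma expect_Dhat : 'E_P[Dhat alpha L phi X]%E =
  (p%:R^-1 * (\sum_[i < j < p] wstar alpha L phi i j * Sigma i j ^+ 2))%:E.
Proof.
rewrite expectE; last exact: (allmom_integ (allmomZ c momG)).
rewrite (eq_mean P DhatE) (meanZ _ (allmom_integ momG)) (mean_gstat symS psdS hX w_).
congr EFin; rewrite /c mulrA; congr (_ * _).
by field; rewrite p0 n0 n1.
Qed.

Lemma var_Dhat_gvar : 'V_P[Dhat alpha L phi X]%E =
  (2 * gvarQ Sigma w_ / (n%:R * (n%:R - 1) * p%:R ^+ 2) +
   4 * gvarL Sigma w_ / (n%:R * p%:R ^+ 2))%:E.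
Proof.
have momD := allmomZ c momG.
have I1 := allmom_integ momD; have I2 := allmom_integ (allmomX 2 momD).
rewrite varE//; congr EFin.
have -> : mean P (fun w => Dhat alpha L phi X w ^+ 2) - mean P (Dhat alpha L phi X) ^+ 2 =
    c ^+ 2 * mean P (fun w => (gstat X w_ w - mean P (gstat X w_)) ^+ 2).
  have J1 := allmom_integ momG; have J2 := allmom_integ (allmomX 2 momG).
  set M := mean P (gstat X w_).
  transitivity (c ^+ 2 * (mean P (fun w => gstat X w_ w ^+ 2) - M ^+ 2)).
    rewrite (eq_mean P DhatE) (meanZ c J1) -/M mulrBr -exprMn; congr (_ - _).
    by rewrite -(meanZ _ J2); apply: eq_mean => w; rewrite DhatE exprMn.
  congr (_ * _); symmetry.
  transitivity (mean P (fun w => gstat X w_ w ^+ 2 + (- (2 * M) * gstat X w_ w + M ^+ 2))).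
    by apply: eq_mean => w; ring.
  have J3 := integZ (- (2 * M)) J1; have J4 := integ_cst P (M ^+ 2).
  rewrite (meanD J2 (integD J3 J4)) (meanD J3 J4) (meanZ _ J1) (mean_cst P (M ^+ 2)) -/M; ring.
rewrite (mean_sqr_gstat symS psdS hX w_) /c.
move: (gvarL _ _) (gvarQ _ _) => VL VQ.
by field; rewrite p0 n0 n1.
Qed.

Lemma T1E (k l : 'I_n) : k != l ->
  T1 alpha L phi Sigma (X k) (X l) = (2 * gvarQ Sigma w_)%:E.
Proof. by move=> kl; rewrite /T1 (expect_sqr_quadratic symS psdS hX w_ kl) EFinM. Qed.

Lemma T2E (k : 'I_n) : T2 alpha L phi Sigma (X k) = (4 * gvarL Sigma w_)%:E.
Proof. by rewrite /T2 (expect_sqr_linear symS psdS hX w_ k) EFinM. Qed.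

Lemma var_Dhat (k l : 'I_n) : k != l -> ('V_P[Dhat alpha L phi X] =
  T1 alpha L phi Sigma (X k) (X l) * ((n%:R * (n%:R - 1) * p%:R ^+ 2)^-1)%:E +
  T2 alpha L phi Sigma (X k) * ((n%:R * p%:R ^+ 2)^-1)%:E)%E.
Proof. by move=> kl; rewrite var_Dhat_gvar T1E// T2E -!EFinM -EFinD. Qed.

End DhatMoments.

Section NullCase.
Context {R : realType} (p : nat).
Implicit Type W : 'I_p -> 'I_p -> R.

Lemma sym_1 : (1%:M : 'M[R]_p)^T = 1%:M. Proof. exact: trmx1. Qed.

Lemma psd_1 (u : 'rV[R]_p) : 0 <= (u *m 1%:M *m u^T) 0 0.
Proof. by rewrite mulmx1 mxE sumr_ge0// => i _; rewrite mxE -expr2 sqr_ge0. Qed.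

Lemma gvarL_1 W : gvarL 1%:M W = 0.
Proof.
apply: big1 => i _; apply: big1 => j ij; apply: big1 => k _; apply: big1 => l _.
by rewrite [1%:M i j]mxE -val_eqE/= (ltn_eqF ij) mulr0 !mul0r.
Qed.

(** Besides (k, l) = (i, j), the bracket could be nonzero only for (k, l) = (j, i), which the orders
    i < j and k < l exclude. *)
Lemma gvarQ_1 W : gvarQ 1%:M W = \sum_[i < j < p] W i j ^+ 2.
Proof.
apply: eq_bigr => i _; apply: eq_bigr => j ij.
rewrite (bigD1 i)//= [X in _ + X]big1 ?addr0; last first.
  move=> k ki; apply: big1 => l kl; rewrite !mxE -!val_eqE/=.
  move: ki; rewrite -val_eqE/= eq_sym => /negbTE ->.
  have [e1|] := eqVneq (val i) (val l); have [e2|] := eqVneq (val j) (val k);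
    rewrite ?(mul0r, mulr0, addr0, expr0n)/= ?mulr0//.
  by move: ij kl; rewrite e1 e2 => lk kl; have := ltn_trans lk kl; rewrite ltnn.
rewrite (bigD1 j)//= [X in _ + X]big1 ?addr0; last first.
  move=> l /andP[il lj]; rewrite !mxE eqxx -!val_eqE/= (ltn_eqF il) mul0r addr0.
  by move: lj; rewrite -val_eqE/= eq_sym => /negbTE ->; rewrite mulr0 expr0n/= mulr0.
by rewrite !mxE !eqxx -val_eqE/= (ltn_eqF ij) mul0r addr0 mulr1 expr1n mulr1.
Qed.

End NullCase.

(** * Variance bounds under the alternative *)

Section BandSums.
Context {R : realType} (p T : nat).

(** The condition |i - j| < T, written without truncated subtraction. *)
Definition band (i j : 'I_p) := (i < j + T)%N && (j < i + T)%N.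

Lemma card_band (i : 'I_p) : (#|[pred j | band i j]| <= 2 * T)%N.
Proof.
case: (posnP T) => [T0|T0].
  rewrite T0 muln0 leqn0; apply/eqP/eq_card0 => j; rewrite !inE /band; lia.
(* Inside the band, j + T - i ranges over 1, ..., 2 T - 1, so [inord] never takes its default value
   there. *)
pose f (j : 'I_p) : 'I_(2 * T).-1.+1 := inord (j + T - i).
have hT : (2 * T).-1.+1 = (2 * T)%N by lia.
rewrite -[leqRHS]hT -[leqRHS]card_ord.
have inj : {in [pred j | band i j] &, injective f}.
  move=> j k; rewrite !inE /band => hj hk /(congr1 val).
  rewrite /f /= !inordK; try lia.
  by move=> h; apply: val_inj => /=; lia.
by rewrite -(card_in_image inj) max_card.
Qed.

Lemma sum_band (i : 'I_p) : \sum_j (band i j)%:R <= 2 * T%:R :> R.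
Proof.
rewrite -natrM -natr_sum ler_nat; apply: leq_trans (card_band i).
rewrite -sum1_card [leqRHS]big_mkcond; apply: leq_sum => j _.
by rewrite inE; case: (band i j).
Qed.

Variables (W : R) (w : 'I_p -> 'I_p -> R) (Sigma : 'M[R]_p).
Hypothesis symS : forall i j, Sigma i j = Sigma j i.
Hypothesis diagS : forall i, Sigma i i = 1.
Hypothesis le1S : forall i j, `|Sigma i j| <= 1.
Hypothesis W0 : 0 <= W.
Hypothesis wsym : forall i j, w i j = w j i.
Hypothesis w0 : forall i j, 0 <= w i j.
Hypothesis wW : forall i j, w i j <= W * (band i j)%:R.

(** Off-diagonal part of |Sigma|. By [SD], products of covariances expand according to which indices
    coincide, and only [D] has to be summed. *)
Let D i j := if i == j then 0 else `|Sigma i j|.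
Let D0 i j : 0 <= D i j. Proof. by rewrite /D; case: ifP. Qed.
Let Dsym i j : D i j = D j i. Proof. by rewrite /D eq_sym symS. Qed.
Let D1 i j : D i j <= 1. Proof. by rewrite /D; case: ifP. Qed.
Let D2_le1 i j : D i j ^+ 2 <= 1. Proof. by rewrite expr_le1. Qed.
Let SD i j : `|Sigma i j| <= (i == j)%:R + D i j.
Proof. by rewrite /D; case: eqP => // _; rewrite ?addr0 ?add0r. Qed.

Definition sqsum := \sum_[i < j < p] Sigma i j ^+ 2.
Definition wsqsum := \sum_[i < j < p] w i j * Sigma i j ^+ 2.
Local Notation S := sqsum.
Local Notation ES := wsqsum.

Lemma sum_sym_lt (f : 'I_p -> 'I_p -> R) : (forall i j, f i j = f j i) ->
  (forall i, f i i = 0) -> \sum_i \sum_j f i j = 2 * (\sum_[i < j < p] f i j).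
Proof.
move=> fs f0.
transitivity (\sum_(i < p) (\sum_(j < p | (i < j)%N) f i j + \sum_(j < p | (j < i)%N) f i j)).
  apply: eq_bigr => i _; rewrite (bigID (fun j : 'I_p => (i < j)%N))/=; congr (_ + _).
  rewrite [LHS]big_mkcond [RHS]big_mkcond; apply: eq_bigr => j _.
  by case: ltngtP => // /val_inj ->; rewrite f0.
rewrite big_split/= mulr_natl mulr2n; congr (_ + _).
rewrite (exchange_big_dep xpredT)//=; apply: eq_bigr => i _.
by apply: eq_bigr.
Qed.

Let sumD2 : \sum_i \sum_j D i j ^+ 2 = 2 * S.
Proof.
rewrite sum_sym_lt; last 2 first.
- by move=> i j; rewrite Dsym.
- by move=> i; rewrite /D eqxx expr0n.
congr (_ * _); apply: eq_bigr => i _; apply: eq_bigr => j ij.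
by rewrite /D -val_eqE/= (ltn_eqF ij) real_normK ?num_real.
Qed.

Let sumwD2 : \sum_i \sum_j w i j * D i j ^+ 2 = 2 * ES.
Proof.
rewrite sum_sym_lt; last 2 first.
- by move=> i j; rewrite Dsym wsym.
- by move=> i; rewrite /D eqxx expr0n/= mulr0.
congr (_ * _); apply: eq_bigr => i _; apply: eq_bigr => j ij.
by rewrite /D -val_eqE/= (ltn_eqF ij) real_normK ?num_real.
Qed.

Lemma sqsum_ge0 : 0 <= S.
Proof. by apply: sumr_ge0 => i _; apply: sumr_ge0 => j _; exact: sqr_ge0. Qed.

Lemma wsqsum_ge0 : 0 <= ES.
Proof.
by apply: sumr_ge0 => i _; apply: sumr_ge0 => j _; rewrite mulr_ge0// sqr_ge0.
Qed.

Let row_w i : \sum_j w i j <= 2 * W * T%:R.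
Proof.
rewrite mulrAC [_ * W]mulrC; apply: (@le_trans _ _ (W * \sum_j (band i j)%:R)).
  by rewrite mulr_sumr; apply: ler_sum => j _; exact: wW.
by rewrite ler_wpM2l// sum_band.
Qed.

Let quad (f : 'I_p -> 'I_p -> 'I_p -> 'I_p -> R) := \sum_i \sum_j \sum_k \sum_l f i j k l.

Let le_quad f g : (forall i j k l, f i j k l <= g i j k l) -> quad f <= quad g.
Proof. by move=> fg; do 4 (apply: ler_sum => ? _); exact: fg. Qed.

Let eq_quad f g : (forall i j k l, f i j k l = g i j k l) -> quad f = quad g.
Proof. by move=> fg; do 4 (apply: eq_bigr => ? _); exact: fg. Qed.

Let quadD f g : quad (fun i j k l => f i j k l + g i j k l) = quad f + quad g.
Proof.
rewrite /quad -big_split; apply: eq_bigr => i _; rewrite -big_split; apply: eq_bigr => j _.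
by rewrite -big_split; apply: eq_bigr => k _; rewrite -big_split.
Qed.

Let quadZ c f : quad (fun i j k l => c * f i j k l) = c * quad f.
Proof. by rewrite /quad; do 4 (rewrite mulr_sumr; apply: eq_bigr => ? _). Qed.

Let quad_swap12 f : quad f = quad (fun i j k l => f j i k l).
Proof. by rewrite /quad exchange_big. Qed.

Let quad_swap34 f : quad f = quad (fun i j k l => f i j l k).
Proof. by apply: eq_bigr => i _; apply: eq_bigr => j _; rewrite exchange_big. Qed.

(** The free indices j and l are summed first, each row costing r; what remains is the full sum of
    D^2, equal to 2 S. *)
Let quad_rows (v : 'I_p -> 'I_p -> R) r : (forall i j, 0 <= v i j) ->
  (forall i, \sum_j v i j <= r) ->
  quad (fun i j k l => v i j * v k l * D i k ^+ 2) <= 2 * r ^+ 2 * S.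
Proof.
move=> v0 vr; have r0 (i : 'I_p) : 0 <= \sum_j v i j by apply: sumr_ge0.
rewrite /quad; under eq_bigr do rewrite exchange_big /=.
apply: (@le_trans _ _ (\sum_i \sum_k r ^+ 2 * D i k ^+ 2)); last first.
  under eq_bigr do rewrite -mulr_sumr.
  by rewrite -mulr_sumr sumD2 mulrA [r ^+ 2 * 2]mulrC.
apply: ler_sum => i _; apply: ler_sum => k _.
have -> : \sum_j \sum_l v i j * v k l * D i k ^+ 2 =
    (\sum_j v i j) * (\sum_l v k l) * D i k ^+ 2.
  rewrite mulr_suml mulr_suml; apply: eq_bigr => j _.
  by rewrite mulr_sumr mulr_suml.
by rewrite ler_wpM2r ?sqr_ge0// expr2 ler_pM.
Qed.

Let ordered_le_quad f : (forall i j k l, 0 <= f i j k l) ->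
  \sum_[i < j < p] \sum_[k < l < p] f i j k l <= quad f.
Proof.
move=> f0; have pos i j k : 0 <= \sum_l f i j k l by apply: sumr_ge0.
apply: ler_sum => i _; rewrite big_mkcond; apply: ler_sum => j _.
case: ifP => _; last by apply: sumr_ge0.
apply: ler_sum => k _; rewrite big_mkcond; apply: ler_sum => l _.
by case: ifP.
Qed.

Let sum_diag_lt (g : 'I_p -> 'I_p -> 'I_p -> 'I_p -> R) :
  \sum_[i < j < p] \sum_[k < l < p] ((i == k) && (j == l))%:R * g i j k l =
  \sum_[i < j < p] g i j i j.
Proof.
apply: eq_bigr => i _; apply: eq_bigr => j ij.
rewrite (bigD1 i)//= [X in _ + X]big1 ?addr0; last first.
  by move=> k ki; apply: big1 => l _; rewrite eq_sym (negbTE ki) mul0r.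
rewrite (bigD1 j)//= !eqxx/= mul1r big1 ?addr0// => l /andP[_ lj].
by rewrite eq_sym (negbTE lj) mul0r.
Qed.

Let sumlt_le (f g : 'I_p -> 'I_p -> R) :
  (forall i j : 'I_p, (i < j)%N -> f i j <= g i j) ->
  \sum_[i < j < p] f i j <= \sum_[i < j < p] g i j.
Proof. by move=> fg; apply: ler_sum => i _; apply: ler_sum => j ij; exact: fg. Qed.

Let sumltD (f g : 'I_p -> 'I_p -> R) :
  \sum_[i < j < p] (f i j + g i j) = \sum_[i < j < p] f i j + \sum_[i < j < p] g i j.
Proof. by rewrite -big_split; apply: eq_bigr => i _; rewrite -big_split. Qed.

Let w_le i j : w i j <= W.
Proof. by apply: le_trans (wW i j) _; rewrite ler_piMr// lern1; case: (band i j). Qed.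

Let S2 i j : Sigma i j ^+ 2 <= 1.
Proof. by rewrite -[leLHS]real_normK ?num_real// expr_le1. Qed.

Let SDsqr i j : i != j -> Sigma i j ^+ 2 = D i j ^+ 2.
Proof. by move=> /negbTE ij; rewrite /D ij real_normK ?num_real. Qed.

(** At least one factor is off-diagonal: it is kept, and the other one is bounded by 1. *)
Let prod_le i k j l : (i != k) || (j != l) ->
  Sigma i k ^+ 2 * Sigma j l ^+ 2 <= D i k ^+ 2 + D j l ^+ 2.
Proof.
have p1 a b : 0 <= Sigma a b ^+ 2 by exact: sqr_ge0.
have p2 a b : 0 <= D a b ^+ 2 by exact: sqr_ge0.
case/orP => h; rewrite -(SDsqr h).
- by apply: le_trans (_ : Sigma i k ^+ 2 <= _); rewrite ?ler_piMr// lerDl.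
- by apply: le_trans (_ : Sigma j l ^+ 2 <= _); rewrite ?ler_piMl// lerDr.
Qed.

Let off i j k l := D i k ^+ 2 + D j l ^+ 2 + (D i l ^+ 2 + D j k ^+ 2).

(** For equal pairs the covariance is 1 + s^2 with s = Sigma_ij, and (1 + s^2)^2 <= 1 + 3 s^2
    because s^2 <= 1. For distinct pairs, (x + y)^2 <= 2 (x^2 + y^2) and both products contain an
    off-diagonal factor. *)
Let cov_le (i j k l : 'I_p) : (i < j)%N -> (k < l)%N ->
  (Sigma i k * Sigma j l + Sigma i l * Sigma j k) ^+ 2 <=
  ((i == k) && (j == l))%:R * (1 + 3 * Sigma i j ^+ 2) + 2 * off i j k l.
Proof.
move=> ij kl; have off0 : 0 <= off i j k l by rewrite /off !addr_ge0// sqr_ge0.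
move: off0; have [/andP[/eqP <- /eqP <-]|h] := boolP ((i == k) && (j == l)) => off0.
  rewrite !diagS (symS j i) mul1r; apply: ler_wpDr; first by rewrite mulr_ge0.
  have := S2 i j; have := sqr_ge0 (Sigma i j).
  rewrite !mul1r -expr2; set x := Sigma i j ^+ 2; nra.
rewrite mul0r add0r; rewrite negb_and in h.
have h1 := prod_le h.
have h2 : Sigma i l ^+ 2 * Sigma j k ^+ 2 <= D i l ^+ 2 + D j k ^+ 2.
  apply: prod_le; rewrite -negb_and; apply/negP => /andP[/eqP e1 /eqP e2].
  by move: ij kl; rewrite e1 e2 => lk kl; have := ltn_trans lk kl; rewrite ltnn.
apply: (@le_trans _ _ (2 * ((Sigma i k * Sigma j l) ^+ 2 + (Sigma i l * Sigma j k) ^+ 2))).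
  have := sqr_ge0 (Sigma i k * Sigma j l - Sigma i l * Sigma j k).
  move: (_ * _) (_ * _) => x y; nra.
by rewrite ler_pM2l// !exprMn; apply: lerD.
Qed.

Lemma gvarQ_le : gvarQ Sigma w <=
  \sum_[i < j < p] w i j ^+ 2 + 3 * W * ES + 64 * (W * T%:R) ^+ 2 * S.
Proof.
rewrite /gvarQ.
apply: (@le_trans _ _ (\sum_[i < j < p] \sum_[k < l < p]
  (((i == k) && (j == l))%:R * (w i j * w k l * (1 + 3 * Sigma i j ^+ 2)) +
   w i j * w k l * (2 * off i j k l)))).
  apply: sumlt_le => i j ij; apply: sumlt_le => k l kl.
  rewrite [X in _ <= X + _]mulrCA -mulrDr; apply: ler_wpM2l; first by rewrite mulr_ge0.
  exact: cov_le.
have -> : \sum_[i < j < p] \sum_[k < l < p]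
  (((i == k) && (j == l))%:R * (w i j * w k l * (1 + 3 * Sigma i j ^+ 2)) +
   w i j * w k l * (2 * off i j k l)) =
   \sum_[i < j < p] (w i j * w i j * (1 + 3 * Sigma i j ^+ 2)) +
   \sum_[i < j < p] \sum_[k < l < p] (w i j * w k l * (2 * off i j k l)).
  rewrite -(sum_diag_lt (fun i j k l => w i j * w k l * (1 + 3 * Sigma i j ^+ 2))) -sumltD.
  apply: eq_bigr => i _; apply: eq_bigr => j _.
  by rewrite -sumltD.
apply: lerD.
  rewrite /ES mulr_sumr -big_split/=; apply: ler_sum => i _.
  rewrite mulr_sumr -big_split/=; apply: ler_sum => j _.
  rewrite mulrDr mulr1 -expr2 lerD2l.
  have := sqr_ge0 (Sigma i j); move: (Sigma i j ^+ 2) => x x0.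
  have : w i j * (w i j * x) <= W * (w i j * x) by rewrite ler_wpM2r// mulr_ge0.
  move: (w i j) => y; nra.
apply: le_trans (ordered_le_quad _) _.
  by move=> i j k l; rewrite !mulr_ge0// /off !addr_ge0// sqr_ge0.
have q1 := quad_rows w0 row_w.
have q2 : quad (fun i j k l => w i j * w k l * D j l ^+ 2) <= 2 * (2 * W * T%:R) ^+ 2 * S.
  by rewrite quad_swap12 quad_swap34; apply: le_trans q1; apply: le_quad => i j k l; rewrite (wsym j) (wsym l).
have q3 : quad (fun i j k l => w i j * w k l * D i l ^+ 2) <= 2 * (2 * W * T%:R) ^+ 2 * S.
  by rewrite quad_swap34; apply: le_trans q1; apply: le_quad => i j k l; rewrite (wsym l).
have q4 : quad (fun i j k l => w i j * w k l * D j k ^+ 2) <= 2 * (2 * W * T%:R) ^+ 2 * S.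
  by rewrite quad_swap12; apply: le_trans q1; apply: le_quad => i j k l; rewrite (wsym j).
have -> : quad (fun i j k l => w i j * w k l * (2 * off i j k l)) =
  2 * (quad (fun i j k l => w i j * w k l * D i k ^+ 2) +
       quad (fun i j k l => w i j * w k l * D j l ^+ 2) +
      (quad (fun i j k l => w i j * w k l * D i l ^+ 2) +
       quad (fun i j k l => w i j * w k l * D j k ^+ 2))).
  by rewrite -!quadD -quadZ; apply: eq_quad => i j k l; rewrite /off; ring.
(* 64 collects the 2 of [cov_le], the number 4 of quadruple sums, and 2 (2 W T)^2 for each of
   them. *)
have -> : 64 * (W * T%:R) ^+ 2 * S = 2 * (4 * (2 * (2 * W * T%:R) ^+ 2 * S)) by ring.
rewrite ler_pM2l//; move: (quad _) (quad _) (quad _) (quad _) q1 q2 q3 q4 => a1 a2 a3 a4.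
by lra.
Qed.

Let sum_delta (i : 'I_p) (f : 'I_p -> R) : \sum_k (i == k)%:R * f k = f i.
Proof.
rewrite (bigD1 i)//= eqxx mul1r big1 ?addr0// => k ki.
by rewrite eq_sym (negbTE ki) mul0r.
Qed.

Let wD i j := w i j * D i j.
Let wD0 i j : 0 <= wD i j. Proof. by rewrite mulr_ge0. Qed.

Let quad_dd : quad (fun i j k l => wD i j * wD k l * ((i == k)%:R * (j == l)%:R)) <= 2 * W * ES.
Proof.
have -> : quad (fun i j k l => wD i j * wD k l * ((i == k)%:R * (j == l)%:R)) =
    \sum_i \sum_j wD i j * wD i j.
  apply: eq_bigr => i _; apply: eq_bigr => j _.
  rewrite -(sum_delta i (fun k => wD i j * wD k j)); apply: eq_bigr => k _.
  rewrite -(sum_delta j (fun l => (i == k)%:R * (wD i j * wD k l))); apply: eq_bigr => l _; by ring.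
rewrite mulrAC -sumwD2 mulrC mulr_sumr; apply: ler_sum => i _; rewrite mulr_sumr; apply: ler_sum => j _.
by rewrite /wD mulrACA -expr2 -mulrA ler_wpM2r// mulr_ge0// sqr_ge0.
Qed.

Let quad_dD : quad (fun i j k l => wD i j * wD k l * ((i == k)%:R * D j l)) <= 4 * (W * T%:R) * ES.
Proof.
have -> : quad (fun i j k l => wD i j * wD k l * ((i == k)%:R * D j l)) =
    \sum_i \sum_j \sum_l wD i j * wD i l * D j l.
  apply: eq_bigr => i _; apply: eq_bigr => j _.
  rewrite -(sum_delta i (fun k => \sum_l wD i j * wD k l * D j l)); apply: eq_bigr => k _.
  by rewrite mulr_sumr; apply: eq_bigr => l _; by ring.
(* Here D_jl <= 1, and 2 x y <= x^2 + y^2 leaves one weight of row i free, whose sum is at most 2 W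
   T. *)
apply: (@le_trans _ _ (\sum_i \sum_j \sum_l (2^-1 * (w i l * (w i j * D i j ^+ 2)) +
    2^-1 * (w i j * (w i l * D i l ^+ 2))))).
  apply: ler_sum => i _; apply: ler_sum => j _; apply: ler_sum => l _.
  apply: (@le_trans _ _ (wD i j * wD i l)); first by rewrite ler_piMr// mulr_ge0.
  rewrite /wD; have h : 0 <= w i j * w i l * (D i j - D i l) ^+ 2.
    by rewrite mulr_ge0 ?sqr_ge0 ?mulr_ge0.
  move: h; move: (w i j) (w i l) (D i j) (D i l) => a b x y h.
  have -> : a * x * (b * y) = 2^-1 * (b * (a * x ^+ 2)) + 2^-1 * (a * (b * y ^+ 2)) -
    2^-1 * (a * b * (x - y) ^+ 2) by field.
  by rewrite gerBl mulr_ge0// invr_ge0.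
have e1 : \sum_i \sum_j \sum_l w i l * (w i j * D i j ^+ 2) <= 2 * W * T%:R * (2 * ES).
  rewrite -sumwD2 mulr_sumr; apply: ler_sum => i _; rewrite mulr_sumr; apply: ler_sum => j _.
  by rewrite -mulr_suml ler_wpM2r// mulr_ge0// sqr_ge0.
have e2 : \sum_i \sum_j \sum_l w i j * (w i l * D i l ^+ 2) <= 2 * W * T%:R * (2 * ES).
  by under eq_bigr do rewrite exchange_big.
have -> : \sum_i \sum_j \sum_l (2^-1 * (w i l * (w i j * D i j ^+ 2)) + 2^-1 * (w i j * (w i l * D i l ^+ 2))) =
  2^-1 * (\sum_i \sum_j \sum_l w i l * (w i j * D i j ^+ 2)) +
  2^-1 * (\sum_i \sum_j \sum_l w i j * (w i l * D i l ^+ 2)).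
  rewrite !mulr_sumr -big_split; apply: eq_bigr => i _; rewrite !mulr_sumr -big_split; apply: eq_bigr => j _.
  by rewrite !mulr_sumr -big_split.
move: e1 e2; move: (\sum_i _) (\sum_i _) => x y e1 e2.
have -> : 4 * (W * T%:R) * ES = 2 * W * T%:R * (2 * ES) by ring.
by lra.
Qed.

Let quad_Dd : quad (fun i j k l => wD i j * wD k l * (D i k * (j == l)%:R)) <= 4 * (W * T%:R) * ES.
Proof.
rewrite quad_swap12 quad_swap34; apply: le_trans quad_dD; apply: le_quad => i j k l.
rewrite /wD (wsym j) (wsym l) (Dsym j i) (Dsym l k).
by rewrite [D j l * _]mulrC.
Qed.

(** To be used with V_ij = |i - j|^(2 alpha) and c = T^(-2 alpha): the smoothness condition of the
    class bounds the part of S that the decreasing weights miss. *)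
Lemma sqsum_le (c M : R) (V : 'I_p -> 'I_p -> R) :
  0 <= c -> (forall i j, W * (1 - c * V i j) <= w i j) ->
  \sum_[i < j < p] Sigma i j ^+ 2 * V i j <= M -> W * (S - c * M) <= ES.
Proof.
move=> c0 wV VM.
apply: (@le_trans _ _ (\sum_[i < j < p] W * (1 - c * V i j) * Sigma i j ^+ 2)); last first.
  by apply: sumlt_le => i j _; rewrite ler_wpM2r// sqr_ge0.
have -> : \sum_[i < j < p] W * (1 - c * V i j) * Sigma i j ^+ 2 =
    W * (S - c * \sum_[i < j < p] Sigma i j ^+ 2 * V i j).
  rewrite mulrBr /S !mulr_sumr -sumrB; apply: eq_bigr => i _.
  by rewrite !mulr_sumr -sumrB; apply: eq_bigr => j _; ring.
by rewrite ler_wpM2l// lerD2l lerN2 ler_wpM2l.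
Qed.

Hypothesis T0 : (0 < T)%N.

Let quad_DD : quad (fun i j k l => wD i j * wD k l * (D i k * D j l)) <=
  2 * T%:R * W ^+ 2 * Num.sqrt (2 * S) ^+ 3.
Proof.
pose B i j : R := (band i j)%:R.
have B0 i j : 0 <= B i j by rewrite /B.
have B1 i j : B i j <= 1 by rewrite /B lern1; case: (band i j).
(* Cauchy-Schwarz, as AM-GM with a parameter th that is optimized below. *)
have key th : 0 < th -> quad (fun i j k l => wD i j * wD k l * (D i k * D j l)) <=
    W ^+ 2 * (th / 2) * (2 * (2 * T%:R) ^+ 2 * S) + W ^+ 2 / (2 * th) * (2 * S) ^+ 2.
  move=> th0.
  apply: (@le_trans _ _ (quad (fun i j k l =>
      W ^+ 2 * (th / 2) * (B i j * B k l * D i k ^+ 2) + W ^+ 2 / (2 * th) * (D i j ^+ 2 * D k l ^+ 2)))).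
    apply: le_quad => i j k l.
    apply: (@le_trans _ _ (W ^+ 2 * (B i j * B k l) * ((D i k * D j l) * (D i j * D k l)))).
      have -> : wD i j * wD k l * (D i k * D j l) =
          (w i j * w k l) * ((D i k * D j l) * (D i j * D k l)) by rewrite /wD; ring.
      rewrite ler_wpM2r ?mulr_ge0//.
      have -> : W ^+ 2 * (B i j * B k l) = (W * B i j) * (W * B k l) by ring.
      by apply: ler_pM => //; exact: wW.
    have h : (D i k * D j l) * (D i j * D k l) <=
        th / 2 * D i k ^+ 2 + (2 * th)^-1 * (D i j ^+ 2 * D k l ^+ 2).
      apply: (@le_trans _ _ (th / 2 * (D i k * D j l) ^+ 2 + (2 * th)^-1 * (D i j ^+ 2 * D k l ^+ 2))).
        rewrite -exprMn; move: (D i k * D j l) (D i j * D k l) => x y.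
        have := sqr_ge0 (th * x - y) => hh.
        have -> : th / 2 * x ^+ 2 + (2 * th)^-1 * y ^+ 2 = x * y + (2 * th)^-1 * (th * x - y) ^+ 2.
          by field; rewrite gt_eqF.
        by rewrite lerDl mulr_ge0// invr_ge0 mulr_ge0// ltW.
      by rewrite lerD2r ler_wpM2l ?(divr_ge0 (ltW th0))// exprMn ler_piMr// sqr_ge0.
    have BB0 : 0 <= B i j * B k l by rewrite mulr_ge0.
    have BB1 : B i j * B k l <= 1 by rewrite mulr_ile1.
    have y0 : 0 <= (2 * th)^-1 * (D i j ^+ 2 * D k l ^+ 2).
      by rewrite mulr_ge0// ?invr_ge0 ?mulr_ge0 ?sqr_ge0// ltW.
    have -> : W ^+ 2 * (th / 2) * (B i j * B k l * D i k ^+ 2) + W ^+ 2 / (2 * th) * (D i j ^+ 2 * D k l ^+ 2) =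
      W ^+ 2 * ((B i j * B k l) * (th / 2 * D i k ^+ 2) + (2 * th)^-1 * (D i j ^+ 2 * D k l ^+ 2)) by ring.
    rewrite -mulrA ler_wpM2l ?sqr_ge0//.
    apply: le_trans (ler_wpM2l BB0 h) _.
    by rewrite mulrDr lerD2l ler_piMl.
  rewrite quadD !quadZ; apply: lerD.
    rewrite ler_wpM2l//; first by rewrite mulr_ge0 ?sqr_ge0// divr_ge0// ltW.
    exact: (quad_rows B0 sum_band).
  rewrite ler_wpM2l//; first by rewrite divr_ge0 ?sqr_ge0// mulr_ge0// ltW.
  rewrite expr2 -[in leRHS]sumD2 mulr_suml; apply: ler_sum => i _.
  rewrite mulr_suml; apply: ler_sum => j _; rewrite mulr_sumr; apply: ler_sum => k _.
  by rewrite mulr_sumr.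
have TR : 0 < T%:R :> R by rewrite ltr0n.
(* The optimal parameter vanishes with S, so S = 0 is settled separately with th = 1. *)
have [S0|Sn] := eqVneq S 0.
  have := key 1 ltr01; rewrite S0 !mulr0 expr0n/= mulr0 addr0.
  by rewrite sqrtr0 expr0n/= mulr0.
have Sp : 0 < 2 * S by rewrite mulr_gt0// lt_neqAle eq_sym Sn sqsum_ge0.
have s0 : 0 < Num.sqrt (2 * S) by rewrite sqrtr_gt0.
set s := Num.sqrt (2 * S) in s0 *.
have sE : 2 * S = s ^+ 2 by rewrite sqr_sqrtr// ltW.
(* This choice balances the two terms of [key], each of which becomes T W^2 s^3. *)
apply: le_trans (key (s / (2 * T%:R)) _) _; first by rewrite divr_gt0// mulr_gt0.
have -> : 2 * (2 * T%:R) ^+ 2 * S = (2 * T%:R) ^+ 2 * s ^+ 2 by rewrite -sE; ring.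
rewrite sE; clearbody s.
by rewrite le_eqVlt; apply/orP; left; apply/eqP; field; rewrite !gt_eqF.
Qed.

(** For k < l the two products of covariances are the values of one quadruple term at (k, l) and at
    (l, k), so the ordered sum is dominated by the full sum of [g]. Expanding each |Sigma| as delta
    + D then leaves the four sums bounded above. *)
Lemma gvarL_le : gvarL Sigma w <=
  (2 * W + 8 * (W * T%:R)) * ES + 2 * T%:R * W ^+ 2 * Num.sqrt (2 * S) ^+ 3.
Proof.
pose g i j k l := wD i j * wD k l * (`|Sigma i k| * `|Sigma j l|).
have g0 i j k l : 0 <= g i j k l by rewrite !mulr_ge0.
have gk i j k : g i j k k = 0 by rewrite /g /wD [D k k]/D eqxx !(mulr0, mul0r).
have wDE (i j : 'I_p) : (i < j)%N -> w i j * `|Sigma i j| = wD i j.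
  by move=> ij; rewrite /wD /D -val_eqE/= (ltn_eqF ij).
apply: (@le_trans _ _ (quad g)).
  apply: (@le_trans _ _ (\sum_[i < j < p] \sum_[k < l < p] (g i j k l + g i j l k))).
    apply: sumlt_le => i j ij; apply: sumlt_le => k l kl.
    apply: le_trans (ler_norm _) _; rewrite normrM mulrC.
    rewrite !normrM (ger0_norm (w0 i j)) (ger0_norm (w0 k l)) wDE// wDE//.
    rewrite /g [wD l k]/wD wsym Dsym -/(wD k l) -mulrDr mulrC ler_wpM2l ?mulr_ge0//.
    by rewrite -!normrM ler_normD.
  apply: ler_sum => i _; rewrite big_mkcond; apply: ler_sum => j _.
  have pos : 0 <= \sum_k \sum_l g i j k l by apply: sumr_ge0 => k _; apply: sumr_ge0.
  case: ifP => // _.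
  have -> : \sum_k \sum_l g i j k l =
      \sum_(k < p) (\sum_(l < p | (k < l)%N) g i j k l + \sum_(l < p | (l < k)%N) g i j k l).
    apply: eq_bigr => k _; rewrite (bigID (fun l : 'I_p => (k < l)%N))/=; congr (_ + _).
    rewrite [LHS]big_mkcond [RHS]big_mkcond; apply: eq_bigr => l _.
    by case: ltngtP => // /val_inj ->; rewrite gk.
  rewrite big_split/= sumltD lerD2l [leRHS](exchange_big_dep xpredT)//=.
apply: (@le_trans _ _ (quad (fun i j k l => wD i j * wD k l * ((i == k)%:R * (j == l)%:R)) +
  quad (fun i j k l => wD i j * wD k l * ((i == k)%:R * D j l)) +
  (quad (fun i j k l => wD i j * wD k l * (D i k * (j == l)%:R)) +
   quad (fun i j k l => wD i j * wD k l * (D i k * D j l))))).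
  rewrite -!quadD; apply: le_quad => i j k l; rewrite -!mulrDr /g ler_wpM2l ?mulr_ge0//.
  rewrite [leRHS](_ : _ = ((i == k)%:R + D i k) * ((j == l)%:R + D j l)); last by ring.
  by apply: ler_pM.
move: quad_dd quad_dD quad_Dd quad_DD; move: (quad _) (quad _) (quad _) (quad _).
by move=> x1 x2 x3 x4; lra.
Qed.

End BandSums.

Section PowerSums.
Context {R : realType}.

Lemma powR_nat2 (x : R) : 0 <= x -> x `^ 2 = x ^+ 2.
Proof. by move=> x0; rewrite (powR_mulrn 2). Qed.

Lemma powR_inv (x r : R) : 0 <= x -> (x^-1) `^ r = (x `^ r)^-1.
Proof. by move=> x0; rewrite -[x^-1]powR_inv1// -powRrM mulN1r powRN. Qed.

(** The middle term is the integral of y^b over [x, x + 1], handled through the mean value theorem.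
    The point x = 0 is treated apart because the derivative of y^(b + 1) is used for y > 0 only. *)
Lemma powR_increment (b x : R) : 0 < b -> 0 <= x ->
  x `^ b <= ((x + 1) `^ (b + 1) - x `^ (b + 1)) / (b + 1) <= (x + 1) `^ b.
Proof.
move=> b0; rewrite le_eqVlt => /predU1P[<-|x0].
  rewrite !powR0 ?gt_eqF// ?addr_gt0// add0r powR1 subr0 div1r invr_ge0 addr_ge0 ?ltW//=.
  by rewrite invf_lt1 ?addr_gt0// ltrDr.
have b10 : 0 < b + 1 by rewrite addr_gt0.
have dF (y : R) : x <= y -> is_derive y 1 (fun y => y `^ (b + 1)) ((b + 1) * y `^ b).
  move=> xy; have y0 := lt_le_trans x0 xy.
  by have := is_derive1_powR (b + 1) y0; rewrite addrK.
have [|||c] := @MVT R (fun y => y `^ (b + 1)) (fun y => (b + 1) * y `^ b) x (x + 1).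
- by rewrite ltrDl.
- by move=> y; rewrite in_itv/= => /andP[/ltW xy _]; exact: dF.
- apply: derivable_within_continuous => y; rewrite in_itv/= => /andP[xy _].
  by have := dF y xy; move=> ?; exact: ex_derive.
rewrite in_itv/= => /andP[xc cx] ->.
rewrite [x + 1 - x]addrAC subrr add0r mulr1 mulrAC divff ?gt_eqF// mul1r.
have c0 := lt_trans x0 xc; have x10 := addr_gt0 x0 (@ltr01 R).
by apply/andP; split; apply: (ge0_ler_powR (ltW b0)); rewrite ?nnegrE ltW.
Qed.

Lemma power_sum_bounds (b : R) (n : nat) : 0 < b ->
  n%:R `^ (b + 1) / (b + 1) <= \sum_(1 <= m < n.+1) m%:R `^ b <=
  n%:R `^ (b + 1) / (b + 1) + n%:R `^ b.
Proof.
move=> b0; have b10 : 0 < b + 1 by rewrite addr_gt0.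
elim: n => [|n /andP[IH1 IH2]].
  by rewrite big_geq// !powR0 ?gt_eqF// mul0r addr0 lexx.
have /andP[h1 h2] := powR_increment b0 (ler0n R n).
rewrite big_nat_recr//=; rewrite -natr1 in h1 h2 *.
rewrite mulrBl in h1 h2; lra.
Qed.

End PowerSums.

(** * Closed forms for the weights, and consequences of membership in the class *)

Section ModelParameters.
Context {R : realType}.
Variables (alpha L : R).
Hypotheses (alpha_gt0 : 0 < alpha) (L_gt0 : 0 < L).

(** The inverse of twice the integral of (1 - x^(2 alpha))^2 over [0, 1]: with peak^2 = kappa / t,
    the squared weights of a full row sum to about 1/2. *)
Definition kappa : R := (2 * alpha + 1) * (4 * alpha + 1) / (16 * alpha ^+ 2).

Lemma kappa_gt0 : 0 < kappa.
Proof. by rewrite divr_gt0 ?mulr_gt0 ?addr_gt0 ?mulr_gt0 ?exprn_gt0. Qed.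

Section Phi.
Variable phi : R.
Hypothesis phi_gt0 : 0 < phi.

(** In terms of phi, u, a and the square root s of [C_b], all the parameters are rational
    expressions; real exponents are removed once and [field] proves the identities. *)
Let u := phi `^ (1 / (2 * alpha)).
Let A := (4 * alpha + 1) * L.
Let a := A `^ (1 / (2 * alpha)).

Let a20 : 0 < 2 * alpha. Proof. by rewrite mulr_gt0. Qed.
Let a4 : 0 < 4 * alpha + 1. Proof. by rewrite addr_gt0 ?mulr_gt0. Qed.
Let a2 : 0 < 2 * alpha + 1. Proof. by rewrite addr_gt0 ?mulr_gt0. Qed.
Let A_gt0 : 0 < A. Proof. by rewrite mulr_gt0. Qed.
Let u_gt0 : 0 < u. Proof. exact: powR_gt0. Qed.
Let a_gt0 : 0 < a. Proof. exact: powR_gt0. Qed.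

Let phi_1a : phi `^ (1 / alpha) = u ^+ 2.
Proof.
rewrite -powR_nat2 ?powR_ge0// -powRrM; congr (_ `^ _); field.
by rewrite gt_eqF.
Qed.

Lemma realT_phi : realT alpha L phi = C_T alpha L / phi `^ (1 / alpha).
Proof. by rewrite /realT powRN. Qed.

Let realTE : realT alpha L phi = a / u ^+ 2.
Proof. by rewrite realT_phi phi_1a. Qed.

Lemma realT_gt0 : 0 < realT alpha L phi.
Proof. by rewrite realTE divr_gt0// exprn_gt0. Qed.

Lemma realT_powR : realT alpha L phi `^ (2 * alpha) = (4 * alpha + 1) * L / phi ^+ 2.
Proof.
rewrite realTE powRM ?invr_ge0 ?exprn_ge0 ?ltW//; congr (_ * _).
  by rewrite /a -powRrM divfK ?gt_eqF// powRr1// ltW.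
rewrite -[_^-1]powR_inv1 ?exprn_ge0 ?ltW// -powR_nat2 ?ltW// -!powRrM.
rewrite -(powR_nat2 (ltW phi_gt0)) -powRN; congr (_ `^ _); field.
by rewrite gt_eqF.
Qed.

Let lambdaE : lambda alpha L phi = (2 * alpha + 1) / (2 * alpha) / a * (phi ^+ 2 * u ^+ 2).
Proof.
rewrite /lambda /C_lambda powRN -/A -/a; congr (_ * _).
rewrite -phi_1a -(powR_nat2 (ltW phi_gt0)) -powRD ?(gt_eqF phi_gt0) ?implybT//.
by congr (_ `^ _); field; rewrite gt_eqF.
Qed.

Let C_bE : C_b alpha L = (2 * alpha + 1) / (4 * alpha + 1) / a.
Proof.
rewrite /C_b powRN powRD ?(gt_eqF a4) ?implybT// powRr1 ?(ltW a4)// /a /A powRM ?ltW//.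
by field; rewrite !gt_eqF// powR_gt0.
Qed.

Let s := C_b alpha L `^ (1 / 2).
Let s_gt0 : 0 < s.
Proof. by rewrite powR_gt0// C_bE !divr_gt0. Qed.
Let s_sqr : s ^+ 2 = (2 * alpha + 1) / (4 * alpha + 1) / a.
Proof.
by rewrite -powR_nat2 ?ltW// -powRrM divfK// powRr1 C_bE// !divr_ge0// ltW.
Qed.

Let bE : b alpha L phi = s * (phi ^+ 2 * u).
Proof.
rewrite /b -/s; congr (_ * _).
by rewrite powRD ?(gt_eqF phi_gt0) ?implybT// powR_nat2 ?(ltW phi_gt0).
Qed.

Definition peak := lambda alpha L phi / (2 * b alpha L phi).

Let peakE : peak = (2 * alpha + 1) / (4 * alpha) * u / (a * s).
Proof. by rewrite /peak lambdaE bE; field; rewrite !gt_eqF// ?exprn_gt0. Qed.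

Lemma peak_gt0 : 0 < peak.
Proof. by rewrite peakE !(divr_gt0, mulr_gt0). Qed.

Lemma peak_sqr : peak ^+ 2 = kappa / realT alpha L phi.
Proof.
rewrite peakE realTE; have -> : ((2 * alpha + 1) / (4 * alpha) * u / (a * s)) ^+ 2 =
  ((2 * alpha + 1) / (4 * alpha) * u) ^+ 2 / (a ^+ 2 * s ^+ 2).
  by field; rewrite !gt_eqF.
by rewrite s_sqr /kappa; field; rewrite !gt_eqF.
Qed.

(** The last factor is 1 - 1 / (4 alpha + 1). By [realT_powR] this says b = peak (phi^2 - L / t^(2
    alpha)), which is the lower bound [classQ_mean_ge] when T equals t. *)
Lemma b_peak : b alpha L phi = peak * phi ^+ 2 * (4 * alpha / (4 * alpha + 1)).
Proof.
have e : s ^+ 2 / s = s by rewrite expr2 mulfK// gt_eqF.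
rewrite peakE bE -[in LHS]e s_sqr; field.
by rewrite !gt_eqF.
Qed.

Local Notation t := (realT alpha L phi).
Local Notation TT := (T alpha L phi).

Lemma T_le : TT%:R <= t.
Proof. by rewrite truncn_le ltW// realT_gt0. Qed.

Lemma T_gt : t < TT%:R + 1.
Proof. by rewrite natr1; exact: truncnS_gt. Qed.

Lemma wstarE i j : wstar alpha L phi i j =
  peak * Num.max 0 (1 - (`|i%:R - j%:R| / TT%:R) `^ (2 * alpha)).
Proof. by []. Qed.

Lemma wstar_ge0 i j : 0 <= wstar alpha L phi i j.
Proof. by rewrite wstarE mulr_ge0 ?(ltW peak_gt0)// le_max lexx. Qed.

Lemma wstar_sym i j : wstar alpha L phi i j = wstar alpha L phi j i.
Proof. by rewrite !wstarE distrC. Qed.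

Lemma wstar_far i j : (0 < TT)%N -> (i + TT <= j)%N -> wstar alpha L phi i j = 0.
Proof.
move=> T0 ij; have iT : (i <= j)%N := leq_trans (leq_addr _ _) ij.
have x1 : 1 <= (j - i)%:R / TT%:R :> R.
  by rewrite ler_pdivlMr ?ltr0n// mul1r ler_nat leq_subRL.
have h : 1 <= ((j - i)%:R / TT%:R) `^ (2 * alpha) :> R.
  have := @ge0_ler_powR R (2 * alpha) (ltW a20) 1 _ ler01 (le_trans ler01 x1) x1.
  by rewrite powR1.
rewrite wstarE distrC -natrB// normr_nat max_l ?mulr0//.
by rewrite subr_le0.
Qed.

Lemma wstar_le_peak i j : wstar alpha L phi i j <= peak.
Proof.
rewrite wstarE ler_piMr ?(ltW peak_gt0)// ge_max ler01 gerBl powR_ge0//.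
Qed.

Lemma wstar_le_band p (i j : 'I_p) : (0 < TT)%N ->
  wstar alpha L phi i j <= peak * (band TT i j)%:R.
Proof.
move=> T0; rewrite /band; have [h1|h1] := ltnP i (j + TT); last first.
  by rewrite wstar_sym wstar_far// mulr0.
have [h2|h2] := ltnP j (i + TT); last by rewrite wstar_far// mulr0.
by rewrite mulr1; exact: wstar_le_peak.
Qed.

Lemma wstar_ge i j : (0 < TT)%N ->
  peak * (1 - (TT%:R `^ (2 * alpha))^-1 * `|i%:R - j%:R| `^ (2 * alpha)) <= wstar alpha L phi i j.
Proof.
move=> T0; rewrite wstarE ler_wpM2l ?(ltW peak_gt0)// le_max; apply/orP; right.
by rewrite powRM ?invr_ge0// powR_inv// mulrC.
Qed.

Section SquaredWeights.
Variable p : nat.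
Hypotheses (p_gt0 : (0 < p)%N) (T0 : (0 < TT)%N) (Tp : (TT <= p)%N).

Let h (m : nat) : R := wstar alpha L phi 0 m.+1 ^+ 2.

Let h0 m : 0 <= h m. Proof. exact: sqr_ge0. Qed.

Let row_sumE i : \sum_(j < p | (i < j)%N) wstar alpha L phi i j ^+ 2 = \sum_(m < p - i.+1) h m.
Proof.
rewrite -(big_geq_mkord i.+1 p xpredT (fun j => wstar alpha L phi i j ^+ 2)) [LHS](big_addn 0 p i.+1) big_mkord.
apply: eq_bigr => m _; rewrite /h !wstarE; congr ((_ * Num.max _ (_ - (_ / _) `^ _)) ^+ 2).
by rewrite addnS -addSn natrD opprD addrCA subrr addr0 sub0r.
Qed.

(** Sum of the squared weights along a row that the border does not cut; a weight depends on |i - j|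
    only. *)
Let F := \sum_(m < TT) h m.

Let h_far m : (TT <= m.+1)%N -> h m = 0.
Proof. by move=> Tm; rewrite /h wstar_far// expr0n. Qed.

Let F_ge0 : 0 <= F. Proof. by apply: sumr_ge0. Qed.

Let sum_far N : (TT <= N)%N -> \sum_(m < N) h m = F.
Proof.
move=> TN; rewrite -(subnKC TN) big_split_ord/= [X in _ + X]big1 ?addr0//.
by move=> m _; apply: h_far => /=; rewrite -addnS leq_addr.
Qed.

Let sum_near N : \sum_(m < N) h m <= F.
Proof.
have [TN|/ltnW NT] := leqP TT N; first by rewrite sum_far.
rewrite /F -(subnKC NT) big_split_ord/= lerDl; exact: sumr_ge0.
Qed.

Let total_le : \sum_[i < j < p] wstar alpha L phi i j ^+ 2 <= p%:R * F.
Proof.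
apply: (@le_trans _ _ (\sum_(i < p) F)); last by rewrite sumr_const card_ord mulr_natl.
by apply: ler_sum => i _; rewrite row_sumE.
Qed.

(** Weights at distance T or more vanish, so only the last T rows can be cut. *)
Let total_ge : (p%:R - TT%:R) * F <= \sum_[i < j < p] wstar alpha L phi i j ^+ 2.
Proof.
apply: (@le_trans _ _ (\sum_(i < p) (if (i < p - TT)%N then F else 0))).
  rewrite -big_mkcond/= -(big_ord_widen p (fun=> F)) ?leq_subr//.
  by rewrite sumr_const card_ord -[F *+ _]mulr_natl natrB.
apply: ler_sum => i _; rewrite row_sumE; case: ifP => iT; last exact: sumr_ge0.
by rewrite sum_far//; move: iT; clear; lia.
Qed.

(** Expanding the square leaves two power sums, each within 1 of its integral after division by the
    power of T. These errors cost at most 4 kappa, and replacing T by t costs at most 1. *)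
Let F_bound : `|2 * F - 1| <= (4 * kappa + 1) / t.
Proof.
have TR : 0 < TT%:R :> R by rewrite ltr0n.
have t0 := realT_gt0.
pose P b := \sum_(1 <= m < TT.+1) (m%:R : R) `^ b.
have FE : F = peak ^+ 2 * (TT%:R - 2 * (P (2 * alpha) / TT%:R `^ (2 * alpha)) +
    P (4 * alpha) / TT%:R `^ (4 * alpha)).
  have PE c : P c = \sum_(m < TT) (m.+1%:R : R) `^ c by rewrite /P big_add1 big_mkord.
  transitivity (\sum_(m < TT) peak ^+ 2 * (1 - 2 * ((m.+1%:R `^ (2 * alpha)) / TT%:R `^ (2 * alpha)) +
      (m.+1%:R `^ (4 * alpha)) / TT%:R `^ (4 * alpha))).
    apply: eq_bigr => m _; rewrite /h wstarE sub0r normrN normr_nat exprMn; congr (_ * _).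
    have mT : m.+1%:R / TT%:R <= 1 :> R by rewrite ler_pdivrMr// mul1r ler_nat.
    have le1 : (m.+1%:R / TT%:R) `^ (2 * alpha) <= 1 :> R.
      have := @ge0_ler_powR R (2 * alpha) (ltW a20) (m.+1%:R / TT%:R) 1.
      by rewrite powR1; apply; rewrite ?nnegrE ?divr_ge0.
    rewrite max_r ?subr_ge0// powRM ?invr_ge0// powR_inv//.
    have -> : 4 * alpha = 2 * alpha * 2 by ring.
    rewrite !(powRrM _ (2 * alpha)) !powR_nat2 ?powR_ge0//.
    by field; rewrite gt_eqF// powR_gt0.
  rewrite -mulr_sumr; congr (_ * _); rewrite big_split/= sumrB sumr_const card_ord !PE.
  by rewrite -mulr_sumr -!mulr_suml.
have xb c : 0 < c -> TT%:R / (c + 1) <= P c / TT%:R `^ c <= TT%:R / (c + 1) + 1.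
  move=> c0; have /andP[h1 h2] := power_sum_bounds TT c0.
  have Tc : 0 < TT%:R `^ c :> R by exact: powR_gt0.
  have e : TT%:R `^ (c + 1) = TT%:R `^ c * TT%:R :> R.
    by rewrite powRD ?(gt_eqF TR) ?implybT// powRr1// ltW.
  have e2 : TT%:R / (c + 1) * TT%:R `^ c = TT%:R `^ c * TT%:R / (c + 1) by ring.
  rewrite e -/(P c) in h1 h2; rewrite ler_pdivlMr// ler_pdivrMr//.
  by rewrite mulrDl mul1r !e2 h1 h2.
have a40 : 0 < 4 * alpha by rewrite mulr_gt0.
have /andP[x1 x2] := xb _ a20; have /andP[y1 y2] := xb _ a40.
rewrite FE peak_sqr; move: (P _ / _) (P _ / _) x1 x2 y1 y2 => y x x1 x2 y1 y2.
have k0 := kappa_gt0.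
have key : 2 * kappa * (TT%:R - 2 * (TT%:R / (2 * alpha + 1)) + TT%:R / (4 * alpha + 1)) = TT%:R.
  by rewrite /kappa; field; rewrite !gt_eqF.
have Tl := T_le; have Tg := T_gt.
have -> : 2 * (kappa / t * (TT%:R - 2 * x + y)) - 1 =
    (2 * kappa * (TT%:R - 2 * x + y) - t) / t by field; rewrite gt_eqF.
rewrite normrM [`|t^-1|]gtr0_norm ?invr_gt0// ler_wpM2r ?invr_ge0 ?(ltW t0)//.
rewrite ler_norml; move: key Tl Tg x1 x2 y1 y2 k0.
move: (TT%:R / (2 * alpha + 1)) (TT%:R / (4 * alpha + 1)) => X Y key Tl Tg x1 x2 y1 y2 k0.
apply/andP; split; nra.
Qed.

(** The first error is that of a full row; the second accounts for the T cut rows, each missing at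
    most F <= kappa. *)
Lemma sum_sqr_wstar : `|2 / p%:R * (\sum_[i < j < p] wstar alpha L phi i j ^+ 2) - 1| <=
  (4 * kappa + 1) / t + 2 * kappa * (t / p%:R).
Proof.
have pR : 0 < p%:R :> R by rewrite ltr0n.
have t0 := realT_gt0.
have Fk : F <= kappa.
  apply: (@le_trans _ _ (\sum_(m < TT) peak ^+ 2)).
    apply: ler_sum => m _; apply: lerXn2r; rewrite ?nnegrE ?wstar_ge0 ?(ltW peak_gt0)//.
    exact: wstar_le_peak.
  rewrite sumr_const card_ord -mulr_natl peak_sqr mulrCA ler_piMr ?(ltW kappa_gt0)//.
  by rewrite ler_pdivrMr// mul1r T_le.
have h1 : `|2 / p%:R * (\sum_[i < j < p] wstar alpha L phi i j ^+ 2) - 2 * F| <= 2 * kappa * (t / p%:R).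
  move: total_le total_ge; move: (\sum_(i < p) _) => x x1 x2.
  have -> : 2 / p%:R * x - 2 * F = - (2 / p%:R * (p%:R * F - x)) by field; rewrite gt_eqF.
  rewrite normrN ger0_norm; last by rewrite mulr_ge0 ?divr_ge0 ?subr_ge0// ltW.
  have -> : 2 * kappa * (t / p%:R) = 2 / p%:R * (t * kappa) by ring.
  rewrite ler_wpM2l ?divr_ge0 ?(ltW pR)//.
  apply: (@le_trans _ _ (TT%:R * F)); first by lra.
  by apply: ler_pM => //; exact: T_le.
have h2 := F_bound.
have -> : 2 / p%:R * (\sum_[i < j < p] wstar alpha L phi i j ^+ 2) - 1 =
  (2 / p%:R * (\sum_[i < j < p] wstar alpha L phi i j ^+ 2) - 2 * F) + (2 * F - 1).
  by rewrite addrA subrK.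
by apply: le_trans (ler_normD _ _) _; rewrite addrC; apply: lerD.
Qed.

End SquaredWeights.

Section ClassQ.
Variables (p : nat) (Sigma : 'M[R]_p).
Hypotheses (p_gt0 : (0 < p)%N) (QS : classQ alpha L phi Sigma) (T0 : (0 < TT)%N).
Let w i j : R := wstar alpha L phi i j.

Lemma classQ_sym : Sigma^T = Sigma. Proof. by case: QS => -[]. Qed.
Lemma classQ_psd (v : 'rV[R]_p) : 0 <= (v *m Sigma *m v^T) 0 0.
Proof. by case: QS => -[_ h _ _ _]; exact: h. Qed.
Lemma classQ_diag i : Sigma i i = 1. Proof. by case: QS => -[_ _ h _ _]. Qed.
Lemma classQ_symE i j : Sigma i j = Sigma j i.
Proof. by rewrite -[in LHS]classQ_sym mxE. Qed.

(** Nonnegativity of the quadratic form at e_i + e_j and at e_i - e_j, with unit diagonal. *)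
Lemma classQ_le1 i j : `|Sigma i j| <= 1.
Proof.
have q (e : R) : 0 <= Sigma i i + e * Sigma i j + e * Sigma j i + e * e * Sigma j j.
  have := classQ_psd (delta_mx 0 i + e *: delta_mx 0 j).
  rewrite linearD/= linearZ/= !trmx_delta !(mulmxDl, mulmxDr) -!scalemxAl -!scalemxAr.
  rewrite -!rowE -!colE !mxE; congr (_ <= _); ring.
have := q 1; have := q (-1); rewrite !classQ_diag (classQ_symE j i) => h1 h2.
by rewrite ler_norml; apply/andP; split; lra.
Qed.

Lemma classQ_sqsum : p%:R * phi ^+ 2 <= sqsum Sigma.
Proof. by case: QS => _; rewrite ler_pdivlMl ?ltr0n. Qed.

Lemma classQ_wsqsum_ge : peak * (sqsum Sigma - (TT%:R `^ (2 * alpha))^-1 * (p%:R * L)) <= wsqsum w Sigma.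
Proof.
apply: (@sqsum_le _ p peak w Sigma (ltW peak_gt0) _ _ (fun i j => `|i%:R - j%:R| `^ (2 * alpha))).
- by rewrite invr_ge0 powR_ge0.
- by move=> i j; exact: wstar_ge.
- by case: QS => -[_ _ _ h] _; rewrite -ler_pdivrMl ?ltr0n.
Qed.

Lemma classQ_mean_ge : peak * (phi ^+ 2 - L / TT%:R `^ (2 * alpha)) <= p%:R^-1 * wsqsum w Sigma.
Proof.
have p0 : 0 < p%:R :> R by rewrite ltr0n.
rewrite ler_pdivlMl//; apply: le_trans classQ_wsqsum_ge.
rewrite mulrCA ler_wpM2l ?(ltW peak_gt0)// mulrBr lerB ?classQ_sqsum//.
by rewrite mulrC mulrA mulrC mulrA [_ * p%:R]mulrC.
Qed.

Lemma classQ_b_le : TT%:R = t -> b alpha L phi <= p%:R^-1 * wsqsum w Sigma.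
Proof.
move=> Tt; apply: le_trans classQ_mean_ge; rewrite Tt realT_powR b_peak.
rewrite -mulrA ler_wpM2l ?(ltW peak_gt0)//.
rewrite le_eqVlt; apply/orP; left; apply/eqP; field.
by rewrite !gt_eqF.
Qed.

End ClassQ.
End Phi.
End ModelParameters.

Section Landau.
Context {R : realType}.

Lemma littleo_cst1 (f : nat * nat -> R) :
  (forall e, 0 < e -> \forall x \near np_oo, `|f x| <= e) ->
  f =o_np_oo (cst 1 : nat * nat -> R).
Proof.
move=> h; apply/eqoP => e e0; near=> x.
by rewrite /= normr1 mulr1; near: x; exact: h.
Unshelve. all: by end_near. Qed.

Lemma bigO_le (f g : nat * nat -> R) (k : R) : 0 < k ->
  (\forall x \near np_oo, `|f x| <= k * `|g x|) -> f =O_np_oo g.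
Proof. by move=> k0 h; apply/eqO_exP; exists k. Qed.

End Landau.

(** * Bandwidth and remainders as phi tends to 0 *)

Section ModelAsymptotics.
Context {R : realType}.
Variables (alpha L : R) (phi : nat -> nat -> R).
Hypotheses (alpha_gt0 : 0 < alpha) (L_gt0 : 0 < L).
Hypothesis phi_gt0 : forall n p, 0 < phi n p.
Hypothesis phi0 : (phi np.1 np.2 @[np --> np_oo]) --> (0 : R).
Hypothesis pphi : (np.2%:R * phi np.1 np.2 `^ (1 / alpha) @[np --> np_oo]) --> +oo.

Let t (np : nat * nat) := realT alpha L (phi np.1 np.2).
Let TT (np : nat * nat) := T alpha L (phi np.1 np.2).
Let W (np : nat * nat) := peak alpha L (phi np.1 np.2).

Let CT_gt0 : 0 < C_T alpha L.
Proof. by rewrite powR_gt0// mulr_gt0// addr_gt0// mulr_gt0. Qed.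

Lemma near_realT (M : R) : \forall np \near np_oo, M <= t np.
Proof.
pose M' := Num.max 1 M; have M0 : 0 < M' by rewrite lt_max ltr01.
(* The value of phi at which C_T / phi^(1 / alpha) equals M'. *)
pose e := (C_T alpha L / M') `^ alpha.
have e0 : 0 < e by rewrite powR_gt0// divr_gt0.
have := phi0 => /cvgr0Pnorm_le /(_ e e0); apply: filterS => np.
rewrite ger0_norm ?(ltW (phi_gt0 _ _))// => h.
rewrite /t realT_phi; apply: (@le_trans _ _ M'); first by rewrite le_max lexx orbT.
rewrite ler_pdivlMr ?powR_gt0// mulrC -ler_pdivlMr//.
have a1 : 0 <= 1 / alpha by rewrite divr_ge0// ltW.
have := @ge0_ler_powR R (1 / alpha) a1 _ _ _ _ h.
rewrite !nnegrE => /(_ (ltW (phi_gt0 _ _)) (ltW e0)) h2; apply: le_trans h2 _.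
by rewrite /e -powRrM [alpha * _]mulrC divfK ?gt_eqF// powRr1// ltW// divr_gt0.
Qed.

Lemma near_ratio (e : R) : 0 < e -> \forall np \near np_oo, t np / np.2%:R <= e.
Proof.
move=> e0; have := pphi => /cvgryPge /(_ (Num.max 1 (C_T alpha L / e))).
apply: filterS => np; rewrite ge_max => /andP[h1 h2].
have f0 : 0 < phi np.1 np.2 `^ (1 / alpha) by rewrite powR_gt0.
have p0 : 0 < np.2%:R :> R by have := lt_le_trans ltr01 h1; rewrite pmulr_lgt0.
rewrite /t realT_phi -mulrA -invfM mulrC ler_pdivrMl ?mulr_gt0//.
by move: h2; rewrite ler_pdivrMr// [np.2%:R * _]mulrC.
Qed.

Lemma near_T_gt0 : \forall np \near np_oo, (0 < TT np)%N.
Proof. by apply: filterS (near_realT 1) => np h; rewrite truncn_gt0. Qed.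

Lemma near_T_le : \forall np \near np_oo, (TT np <= np.2)%N.
Proof.
near=> np; have t0 : 0 < t np by apply: realT_gt0.
have h : t np / np.2%:R <= 1 by near: np; exact: near_ratio.
have [p0|p0] := posnP np.2; last first.
  rewrite -(ler_nat R); apply: le_trans (T_le alpha_gt0 L_gt0 (phi_gt0 _ _)) _.
  by move: h; rewrite ler_pdivrMr ?ltr0n// mul1r.
by exfalso; move: p0; apply/eqP; rewrite -lt0n; near: np; exact: (cvg_snd (nbhs_infty_gt 0)).
Unshelve. all: by end_near. Qed.

End ModelAsymptotics.

Section AlternativeBounds.
Context {R : realType}.
Variables (alpha L : R) (phi : nat -> nat -> R).
Hypotheses (alpha_gt0 : 0 < alpha) (L_gt0 : 0 < L).
Hypothesis phi_gt0 : forall n p, 0 < phi n p.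
Hypothesis phi0 : (phi np.1 np.2 @[np --> np_oo]) --> (0 : R).
Hypothesis pphi : (np.2%:R * phi np.1 np.2 `^ (1 / alpha) @[np --> np_oo]) --> +oo.

Let t (np : nat * nat) := realT alpha L (phi np.1 np.2).
Let TT (np : nat * nat) := T alpha L (phi np.1 np.2).
Let W (np : nat * nat) := peak alpha L (phi np.1 np.2).

Let a20 : 0 < 2 * alpha. Proof. by rewrite mulr_gt0. Qed.
Let a40 : 0 < 4 * alpha. Proof. by rewrite mulr_gt0. Qed.

(** Relative defect in the normalization (1 / p) sum w^2 = 1 / 2 of the squared weights. *)
Definition null_rem (np : nat * nat) : R :=
  2 / np.2%:R * (\sum_[i < j < np.2] wstar alpha L (phi np.1 np.2) i j ^+ 2) - 1.

Lemma near_p_gt0 : \forall np \near np_oo, (0 < np.2)%N.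
Proof. exact: (cvg_snd (nbhs_infty_gt 0)). Qed.

Lemma near_null_rem (e : R) : 0 < e -> \forall np \near np_oo, `|null_rem np| <= e.
Proof.
move=> e0; have k0 := kappa_gt0 alpha_gt0.
near=> np; have t0 : 0 < t np by apply: realT_gt0.
have p0 : (0 < np.2)%N by near: np; exact: near_p_gt0.
apply: le_trans (sum_sqr_wstar alpha_gt0 L_gt0 (phi_gt0 _ _) p0 _ _) _.
- by near: np; exact: near_T_gt0.
- by near: np; exact: near_T_le.
have h1 : (4 * kappa alpha + 1) / t np <= e / 2.
  rewrite ler_pdivrMr// [e / 2 * _]mulrC -ler_pdivrMr ?divr_gt0//.
  by near: np; exact: near_realT.
have h2 : 2 * kappa alpha * (t np / np.2%:R) <= e / 2.
  have k20 : 0 < 2 * kappa alpha by rewrite pmulr_rgt0.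
  rewrite [leLHS]mulrC -ler_pdivlMr//; near: np; by apply: near_ratio => //; rewrite !divr_gt0// pmulr_rgt0.
have e2 : e = e / 2 + e / 2 by field.
by rewrite [leRHS]e2; apply: lerD.
Unshelve. all: by end_near. Qed.

Lemma null_rem_littleo : null_rem =o_np_oo (cst 1 : nat * nat -> R).
Proof. by apply: littleo_cst1; exact: near_null_rem. Qed.

Lemma near_realT_T (q : R) : 1 < q -> \forall np \near np_oo, t np <= q * (TT np)%:R.
Proof.
move=> q1; have q0 : 0 < q - 1 by rewrite subr_gt0.
(* The condition q / (q - 1) <= t amounts to t <= q (t - 1), and t - 1 < T. *)
near=> np; have h : q / (q - 1) <= t np by near: np; exact: near_realT.
have := T_gt alpha L (phi np.1 np.2); rewrite -/(t np) -/(TT np) => Tg.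
move: h; rewrite ler_pdivrMr// => h.
have : q * (t np - 1) <= q * (TT np)%:R.
  by rewrite ler_pM2l ?(lt_trans _ q1)// lerBlDr ltW.
by apply: le_trans; lra.
Unshelve. all: by end_near. Qed.

Let x (np : nat * nat) := (t np / (TT np)%:R) `^ (2 * alpha).

Lemma near_x_le (c : R) : 1 < c -> \forall np \near np_oo, x np <= c.
Proof.
move=> c1; pose q := c `^ (1 / (2 * alpha)).
have c0 : 0 < c := lt_trans ltr01 c1.
have q1 : 1 < q.
  have := @gt0_ltr_powR R (1 / (2 * alpha)) (divr_gt0 ltr01 a20) 1 c.
  by rewrite powR1; apply; rewrite ?nnegrE ?ltW.
near=> np; have T0 : (0 < TT np)%N by near: np; exact: near_T_gt0.
have h : t np <= q * (TT np)%:R by near: np; exact: near_realT_T.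
have -> : c = q `^ (2 * alpha) by rewrite /q -powRrM divfK ?gt_eqF// powRr1// ltW.
have t0 : 0 < t np by apply: realT_gt0.
apply: (ge0_ler_powR (ltW a20)); rewrite ?nnegrE ?(ltW (lt_trans ltr01 q1))//.
  by rewrite divr_ge0// ltW.
by rewrite ler_pdivrMr ?ltr0n.
Unshelve. all: by end_near. Qed.

Let L_x np : (0 < TT np)%N ->
  L / (TT np)%:R `^ (2 * alpha) = phi np.1 np.2 ^+ 2 / (4 * alpha + 1) * x np.
Proof.
move=> T0; have t0 : 0 < t np by apply: realT_gt0.
rewrite /x powRM ?invr_ge0 ?(ltW t0)// powR_inv// realT_powR//.
by field; rewrite !gt_eqF ?powR_gt0 ?ltr0n ?addr_gt0.
Qed.

(* b (1 + b_rem) is W (phi^2 - L / T^(2 alpha)); it differs from b only because T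
   is the integer part of realT. *)
Definition b_rem np : R := (1 - x np) / (4 * alpha).

Lemma near_b_rem (e : R) : 0 < e -> \forall np \near np_oo, `|b_rem np| <= e.
Proof.
move=> e0; near=> np; have T0 : (0 < TT np)%N by near: np; exact: near_T_gt0.
have x1 : 1 <= x np.
  have := @ge0_ler_powR R (2 * alpha) (ltW a20) 1 (t np / (TT np)%:R).
  rewrite powR1; apply; rewrite ?nnegrE ?divr_ge0 ?ler01 ?(ltW (realT_gt0 _ _ _))//.
  by rewrite ler_pdivlMr ?ltr0n// mul1r; apply: T_le.
rewrite /b_rem normrM [`|_^-1|]gtr0_norm ?invr_gt0// ler_pdivrMr// distrC ger0_norm ?subr_ge0//.
rewrite lerBlDr; near: np; apply: near_x_le.
by rewrite ltrDr mulr_gt0.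
Unshelve. all: by end_near. Qed.

(** The constant in S <= K ES / W: a fraction 1 / (2 alpha + 1) of S is given up, and K is the
    inverse of the fraction that remains. *)
Let K := (2 * alpha + 1) / (2 * alpha).
Let K0 : 0 < K. Proof. by rewrite divr_gt0// addr_gt0. Qed.

Let W0 np : 0 < W np. Proof. exact: peak_gt0. Qed.

Let W_sqr np : W np ^+ 2 = kappa alpha / t np. Proof. exact: peak_sqr. Qed.

Let W_le np : (0 < TT np)%N -> W np <= Num.sqrt (kappa alpha) / Num.sqrt (TT np)%:R.
Proof.
move=> T0; have k0 := kappa_gt0 alpha_gt0.
rewrite -[leLHS]ger0_norm ?(ltW (W0 _))// -sqrtr_sqr W_sqr -sqrtrV ?(ltW k0)// -sqrtrM ?(ltW k0)//.
apply: ler_wsqrtr; rewrite ler_pM2l// lef_pV2 ?posrE ?ltr0n//.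
- by apply: T_le.
- by apply: realT_gt0.
Qed.

(** These three coefficients are read off from twice [gvarQ_le] and four times [gvarL_le], with S
    replaced by K ES / W. Since W is of order T^(-1/2), their orders are T^(3/2), T^(1/2) and
    T^(3/4). *)
Definition coefT1 np : R := 6 * W np + 128 * K * W np * (TT np)%:R ^+ 2.
Definition coefT2 np : R := 8 * W np + 32 * W np * (TT np)%:R.
Definition coefT2' np : R := 8 * (TT np)%:R * W np ^+ 2 * (2 * K / W np) `^ (3 / 2).

Let sT np := Num.sqrt (TT np)%:R : R.

Let sT_sqr np : sT np ^+ 2 = (TT np)%:R. Proof. by rewrite sqr_sqrtr. Qed.

Let sT_ge1 np : (0 < TT np)%N -> 1 <= sT np.
Proof. by move=> T0; rewrite -[leLHS]sqrtr1 ler_sqrt// ler1n. Qed.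

Lemma coefT1_bigO : coefT1 =O_np_oo (fun np : nat * nat =>
  (T alpha L (phi np.1 np.2))%:R * Num.sqrt (T alpha L (phi np.1 np.2))%:R : R).
Proof.
have k0 := kappa_gt0 alpha_gt0; have sk0 : 0 < Num.sqrt (kappa alpha) by rewrite sqrtr_gt0.
apply: (@bigO_le _ _ _ ((6 + 128 * K) * Num.sqrt (kappa alpha))).
  by rewrite mulr_gt0// addr_gt0// mulr_gt0.
near=> np; have T0 : (0 < TT np)%N by near: np; exact: near_T_gt0.
rewrite -/(TT np) -/(sT np) ger0_norm; last first.
  move: (ltW (W0 np)) (ltW K0); rewrite /coefT1; move: (W np) K => w k w0 k0'.
  by rewrite addr_ge0// !mulr_ge0.
have s1 := sT_ge1 T0; have s0 : 0 < sT np := lt_le_trans ltr01 s1.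
rewrite [X in _ <= _ * X]ger0_norm ?mulr_ge0 ?(ltW s0)// /coefT1 -!sT_sqr.
have h := W_le T0; rewrite -/(sT np) ler_pdivlMr// in h.
have h1 : W np <= Num.sqrt (kappa alpha) * (sT np ^+ 2 * sT np).
  apply: (@le_trans _ _ (W np * sT np)); first by rewrite ler_peMr// ltW.
  by apply: le_trans h _; rewrite ler_peMr ?(ltW sk0)// mulr_ege1// expr2 mulr_ege1.
have h2 : W np * (sT np ^+ 2) ^+ 2 <= Num.sqrt (kappa alpha) * (sT np ^+ 2 * sT np).
  have -> : W np * (sT np ^+ 2) ^+ 2 = (W np * sT np) * (sT np ^+ 2 * sT np) by ring.
  by rewrite ler_wpM2r// mulr_ge0 ?exprn_ge0// ltW.
set z := Num.sqrt _ * _ in h1 h2; rewrite -[X in _ + X <= _]mulrA -[leRHS]mulrA -/z [leRHS]mulrDl.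
by apply: lerD; rewrite ler_pM2l// pmulr_rgt0.
Unshelve. all: by end_near. Qed.

Lemma coefT2_bigO : coefT2 =O_np_oo (fun np : nat * nat =>
  Num.sqrt (T alpha L (phi np.1 np.2))%:R : R).
Proof.
have k0 := kappa_gt0 alpha_gt0; have sk0 : 0 < Num.sqrt (kappa alpha) by rewrite sqrtr_gt0.
apply: (@bigO_le _ _ _ (40 * Num.sqrt (kappa alpha))); first by rewrite mulr_gt0.
near=> np; have T0 : (0 < TT np)%N by near: np; exact: near_T_gt0.
rewrite -/(TT np) -/(sT np) ger0_norm; last first.
  move: (ltW (W0 np)); rewrite /coefT2; move: (W np) => w w0.
  by rewrite addr_ge0// !mulr_ge0.
have s1 := sT_ge1 T0; have s0 : 0 < sT np := lt_le_trans ltr01 s1.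
rewrite [X in _ <= _ * X]ger0_norm ?(ltW s0)// /coefT2 -!sT_sqr.
have h := W_le T0; rewrite -/(sT np) ler_pdivlMr// in h.
have h1 : W np <= Num.sqrt (kappa alpha) * sT np.
  apply: (@le_trans _ _ (W np * sT np)); first by rewrite ler_peMr// ltW.
  by apply: le_trans h _; rewrite ler_peMr ?(ltW sk0).
have h2 : W np * sT np ^+ 2 <= Num.sqrt (kappa alpha) * sT np.
  by rewrite expr2 mulrA ler_wpM2r// ltW.
by lra.
Unshelve. all: by end_near. Qed.

Lemma coefT2'_bigO : coefT2' =O_np_oo (fun np : nat * nat =>
  (T alpha L (phi np.1 np.2))%:R `^ (3 / 4) : R).
Proof.
have k0 := kappa_gt0 alpha_gt0.
apply: (@bigO_le _ _ _ (8 * (2 * K) `^ (3 / 2) * kappa alpha `^ (1 / 4))).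
  by rewrite !mulr_gt0// powR_gt0// mulr_gt0.
near=> np; have T0 : (0 < TT np)%N by near: np; exact: near_T_gt0.
have TR : 0 < (TT np)%:R :> R by rewrite ltr0n.
have t0 : 0 < t np by apply: realT_gt0.
rewrite -/(TT np) ger0_norm; last first.
  move: (ltW (W0 np)); rewrite /coefT2'; move: (W np) => w w0.
  by rewrite !mulr_ge0// powR_ge0.
rewrite [X in _ <= _ * X]ger0_norm ?powR_ge0//.
have e1 : W np ^+ 2 * (2 * K / W np) `^ (3 / 2) = (2 * K) `^ (3 / 2) * W np `^ (1 / 2).
  have K20 : 0 <= 2 * K by rewrite pmulr_rge0// ltW.
  have := W0 np => w0; rewrite powRM ?invr_ge0 ?(ltW w0)// powR_inv ?(ltW w0)// mulrCA; congr (_ * _).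
  rewrite -(powR_nat2 (ltW (W0 np))) -powRN -powRD ?(gt_eqF (W0 _)) ?implybT//.
  by congr (_ `^ _); field.
have e2 : W np `^ (1 / 2) <= kappa alpha `^ (1 / 4) / (TT np)%:R `^ (1 / 4).
  have -> : W np `^ (1 / 2) = (W np ^+ 2) `^ (1 / 4).
    by rewrite -(powR_nat2 (ltW (W0 np))) -powRrM; congr (_ `^ _); field.
  rewrite W_sqr -powR_inv ?(ltW TR)// -powRM ?invr_ge0 ?(ltW k0) ?(ltW TR)//.
  apply: ge0_ler_powR; rewrite ?nnegrE//; do ?[by apply: divr_ge0 => //; apply: ltW].
  by rewrite ler_pM2l// lef_pV2 ?posrE//; apply: T_le.
have e3 : (TT np)%:R / (TT np)%:R `^ (1 / 4) = (TT np)%:R `^ (3 / 4) :> R.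
  rewrite -{1}(powRr1 (ltW TR)) -powRN -powRD ?(gt_eqF TR) ?implybT//.
  by congr (_ `^ _); field.
rewrite /coefT2' -mulrA e1 -e3.
have -> : 8 * (TT np)%:R * ((2 * K) `^ (3 / 2) * W np `^ (1 / 2)) =
  8 * (TT np)%:R * (2 * K) `^ (3 / 2) * W np `^ (1 / 2) by ring.
have -> : 8 * (2 * K) `^ (3 / 2) * kappa alpha `^ (1 / 4) * ((TT np)%:R / (TT np)%:R `^ (1 / 4)) =
  8 * (TT np)%:R * (2 * K) `^ (3 / 2) * (kappa alpha `^ (1 / 4) / (TT np)%:R `^ (1 / 4)) by ring.
by rewrite ler_wpM2l// !mulr_ge0// powR_ge0.
Unshelve. all: by end_near. Qed.

(** The filter precedes the quantifier over Sigma: the threshold on n and p is the same for the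
    whole class. *)
Lemma near_alternative_bounds : \forall np \near np_oo,
  forall Sigma : 'M[R]_(np.2), classQ alpha L (phi np.1 np.2) Sigma ->
  let w (i j : 'I_np.2) := wstar alpha L (phi np.1 np.2) i j in
  let ED := np.2%:R^-1 * wsqsum w Sigma in
  [/\ b alpha L (phi np.1 np.2) * (1 + b_rem np) <= ED,
      2 * gvarQ Sigma w <= np.2%:R * (1 + null_rem np) + np.2%:R * ED * coefT1 np &
      4 * gvarL Sigma w <= np.2%:R * ED * coefT2 np +
        np.2%:R `^ (3 / 2) * (ED `^ (3 / 2) * coefT2' np)].
Proof.
near=> np => Sigma QS w ED.
have p0 : (0 < np.2)%N by near: np; exact: near_p_gt0.
have T0 : (0 < TT np)%N by near: np; exact: near_T_gt0.
have pR : 0 < np.2%:R :> R by rewrite ltr0n.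
have TR : 0 < (TT np)%:R :> R by rewrite ltr0n.
have f0 := phi_gt0 np.1 np.2.
have wp := W0 np.
have pED : np.2%:R * ED = wsqsum w Sigma by rewrite /ED mulrA divff ?gt_eqF// mul1r.
have ES0 : 0 <= wsqsum w Sigma by apply: wsqsum_ge0 => i j; exact: wstar_ge0.
have ED0 : 0 <= ED by rewrite mulr_ge0// invr_ge0 ltW.
have sS := classQ_sqsum p0 QS.
(* For T close enough to t, L / T^(2 alpha) is at most phi^2 / (2 alpha + 1), and p phi^2 <= S by
   the separation condition: the part of S that the weights miss is at most a fixed fraction of
   S. *)
have SK : sqsum Sigma <= K * (wsqsum w Sigma / W np).
  have hx : x np <= (4 * alpha + 1) / (2 * alpha + 1).
    near: np; apply: near_x_le; rewrite ltr_pdivlMr ?addr_gt0// mul1r ltrD2r ltr_pM2r//.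
    by rewrite ltr_nat.
  have := classQ_wsqsum_ge alpha_gt0 L_gt0 f0 p0 QS T0.
  rewrite -/(W np) -/(TT np) -/w => h.
  have hL : ((TT np)%:R `^ (2 * alpha))^-1 * (np.2%:R * L) <= sqsum Sigma / (2 * alpha + 1).
    have -> : ((TT np)%:R `^ (2 * alpha))^-1 * (np.2%:R * L) =
      np.2%:R * (L / (TT np)%:R `^ (2 * alpha)) by ring.
    rewrite L_x//; apply: (@le_trans _ _ (np.2%:R * (phi np.1 np.2 ^+ 2 / (2 * alpha + 1)))).
      rewrite ler_pM2l// -mulrA ler_wpM2l ?sqr_ge0//.
      rewrite mulrC ler_pdivrMr ?addr_gt0//; apply: le_trans hx _.
      by rewrite mulrC.
    by rewrite mulrA ler_wpM2r// invr_ge0 ltW// addr_gt0.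
  have h3 : sqsum Sigma - sqsum Sigma / (2 * alpha + 1) <= wsqsum w Sigma / W np.
    rewrite ler_pdivlMr// mulrC; apply: le_trans h.
    by rewrite ler_pM2l// lerB.
  have -> : sqsum Sigma = K * (sqsum Sigma - sqsum Sigma / (2 * alpha + 1)).
    by rewrite /K; field; rewrite !gt_eqF// addr_gt0.
  by rewrite ler_pM2l.
have wb i j : w i j <= W np * (band (TT np) i j)%:R by exact: wstar_le_band.
have [symS diagS le1S] := And3 (classQ_symE QS) (classQ_diag QS) (classQ_le1 QS).
have w0 i j : 0 <= w i j by exact: wstar_ge0.
have wsym i j : w i j = w j i by exact: wstar_sym.
split.
- apply: le_trans (classQ_mean_ge alpha_gt0 L_gt0 f0 p0 QS T0).
  rewrite -/(W np) -/(TT np) L_x// b_peak// -/(W np) /b_rem le_eqVlt; apply/orP; left; apply/eqP.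
  by field; rewrite !gt_eqF// addr_gt0.
- have := gvarQ_le symS diagS le1S (ltW wp) wsym w0 wb; set s2 := \sum_[i < j < np.2] w i j ^+ 2.
  have -> : np.2%:R * (1 + null_rem np) = 2 * s2.
    by rewrite /null_rem -/s2; field; rewrite gt_eqF.
  have h : (W np * (TT np)%:R) ^+ 2 * sqsum Sigma <=
      K * W np * (TT np)%:R ^+ 2 * wsqsum w Sigma.
    apply: le_trans (ler_wpM2l (sqr_ge0 _) SK) _.
    rewrite le_eqVlt; apply/orP; left; apply/eqP.
    by field; rewrite gt_eqF.
  rewrite pED /coefT1 => h2.
  by rewrite -mulrA in h2; lra.
- have := gvarL_le symS le1S (ltW wp) wsym w0 wb T0.
  have h : Num.sqrt (2 * sqsum Sigma) ^+ 3 <=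
      (2 * K / W np) `^ (3 / 2) * (wsqsum w Sigma) `^ (3 / 2).
    have K20 : 0 <= 2 * K by rewrite pmulr_rge0// ltW.
    have c1 : 0 <= 2 * K / W np by apply: divr_ge0 => //; apply: ltW.
    rewrite -powRM//.
    have c0 : 0 <= 2 * K / W np * wsqsum w Sigma.
      rewrite mulr_ge0// divr_ge0// ltW.
    have -> : 3 / 2 = 1 / 2 * 3 :> R by field.
    rewrite (powRrM _ (1 / 2)) (powR_mulrn 3) ?powR_ge0// div1r powR12_sqrt//.
    apply: lerXn2r; rewrite ?nnegrE ?sqrtr_ge0//; apply: ler_wsqrtr.
    have -> : 2 * K / W np * wsqsum w Sigma = 2 * (K * (wsqsum w Sigma / W np)) by ring.
    by rewrite ler_pM2l.
  have e : np.2%:R `^ (3 / 2) * ED `^ (3 / 2) = wsqsum w Sigma `^ (3 / 2).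
    by rewrite -powRM ?(ltW pR)// pED.
  have -> : np.2%:R `^ (3 / 2) * (ED `^ (3 / 2) * coefT2' np) =
    wsqsum w Sigma `^ (3 / 2) * coefT2' np by rewrite mulrA e.
  rewrite pED /coefT2 /coefT2' => h2.
  have TW : 0 <= 8 * (TT np)%:R * W np ^+ 2 by apply: mulr_ge0; [apply: mulr_ge0|exact: sqr_ge0].
  have := ler_wpM2l TW h; move: (Num.sqrt _ ^+ 3) ((2 * K / W np) `^ _) h2 => y z h2.
  by lra.
Unshelve. all: by end_near. Qed.

End AlternativeBounds.

(** * Independence of uncorrelated Gaussian coordinates *)

Section TrigonometricClass.
Context {R : realType}.
Implicit Types f g : R -> R.

(* Finite trigonometric sums, closed under bounded pointwise limits when lim is
   true; they are then the bounded Borel functions. *)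
Variable lim : bool.
Inductive trig_class : (R -> R) -> Prop :=
| TrigCos t c : trig_class (fun x => cos (t * x + c))
| TrigLin a b f g : trig_class f -> trig_class g ->
    trig_class (fun x => a * f x + b * g x)
| TrigLim (f_ : nat -> R -> R) f M : lim -> (forall n, trig_class (f_ n)) ->
    (forall n x, `|f_ n x| <= M) -> (forall x, f_ n x @[n --> \oo] --> f x) ->
    trig_class f.

Lemma trig_cst c : trig_class (cst c).
Proof.
have := TrigLin c 0 (TrigCos 0 0) (TrigCos 0 0); congr trig_class; apply/funext => x.
by rewrite mul0r addr0 cos0 mul0r addr0 mulr1.
Qed.

Lemma trigD f g : trig_class f -> trig_class g -> trig_class (fun x => f x + g x).
Proof.
move=> hf hg; have := TrigLin 1 1 hf hg; congr trig_class; apply/funext => x.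
by rewrite !mul1r.
Qed.

Lemma trigZ c f : trig_class f -> trig_class (fun x => c * f x).
Proof.
move=> hf; have := TrigLin c 0 hf hf; congr trig_class; apply/funext => x.
by rewrite mul0r addr0.
Qed.

Lemma trigB f g : trig_class f -> trig_class g -> trig_class (fun x => f x - g x).
Proof.
move=> hf hg; have := TrigLin 1 (- 1) hf hg; congr trig_class; apply/funext => x.
by rewrite mul1r mulN1r.
Qed.

Lemma trig_bounded f : trig_class f -> exists M, forall x, `|f x| <= M.
Proof.
elim=> [t c|a b {}f g _ [M hM] _ [N hN]|f_ {}f M _ _ _ hM cf].
- by exists 1 => x; exact: cos_max.
- exists (`|a| * M + `|b| * N) => x; apply: le_trans (ler_normD _ _) _.
  by rewrite !normrM; apply: lerD; rewrite ler_wpM2l.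
- exists M => x; apply: (ler_cvg_to (cvg_norm (cf x)) (cvg_cst M)).
  by apply: nearW => n; exact: hM.
Qed.

Lemma trig_meas f : trig_class f -> measurable_fun setT f.
Proof.
elim=> [t c|a b {}f g _ mf _ mg|f_ {}f M _ _ mf _ cf].
- apply: continuous_measurable_fun => x; apply: continuous_comp; last exact: continuous_cos.
  apply: cvgD; last exact: cvg_cst.
  by apply: cvgM; [exact: cvg_cst|exact: cvg_id].
- by apply: measurable_funD; apply: measurable_funM.
- by apply: measurable_fun_cvg mf _ => x _; exact: cf.
Qed.

Let trigM_cos t c f : trig_class f -> trig_class (fun x => cos (t * x + c) * f x).
Proof.
elim=> [t' c'|a b {}f g _ hf _ hg|f_ {}f M l _ hf hM cf].
- have := TrigLin (1 / 2) (1 / 2) (TrigCos (t + t') (c + c')) (TrigCos (t - t') (c - c')).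
  congr trig_class; apply/funext => x.
  have -> : (t + t') * x + (c + c') = (t * x + c) + (t' * x + c') by ring.
  have -> : (t - t') * x + (c - c') = (t * x + c) - (t' * x + c') by ring.
  by rewrite cosD cosB; field.
- have := TrigLin a b hf hg; by congr trig_class; apply/funext => x; ring.
- apply: (TrigLim (M := 1 * M) l hf) => [n x|x]; last by apply: cvgM => //; exact: cvg_cst.
  by rewrite normrM ler_pM// cos_max.
Qed.

(** Induction on one factor and then, in [trigM_cos], on the other, down to the product-to-sum
    formula; bounded limits survive because the other factor is bounded. *)
Lemma trigM f g : trig_class f -> trig_class g -> trig_class (fun x => f x * g x).
Proof.
move=> + hg; have [N hN] := trig_bounded hg.
elim=> [t c|a b {}f f' _ hf _ hf'|f_ {}f M l _ hf hM cf].
- exact: trigM_cos.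
- have := TrigLin a b hf hf'; by congr trig_class; apply/funext => x; ring.
- apply: (TrigLim (M := M * N) l hf) => [n x|x]; last by apply: cvgM => //; exact: cvg_cst.
  by rewrite normrM ler_pM.
Qed.

End TrigonometricClass.
Arguments TrigCos {R lim}.

Section SignIteration.
Context {R : realType}.

(* This iteration attracts [-1, 1] \ {0} to {-1, 1}: it turns a sine into its
   sign. *)
Definition sgn_step (z : R) := (3 * z - z ^+ 3) / 2.
Local Notation step := sgn_step.

Lemma trig_iter_sin lim n t c : trig_class lim (fun x => iter n step (sin (t * x + c))).
Proof.
elim: n => [|n IHn] /=.
  have := @TrigCos R lim t (c - pi / 2); congr trig_class; apply/funext => x.
  by rewrite addrA cosBpihalf.
have := TrigLin (3 / 2) (- (1 / 2)) IHn (trigM IHn (trigM IHn IHn)).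
by congr trig_class; apply/funext => x; rewrite /step; field.
Qed.

Let step_N z : step (- z) = - step z.
Proof. by rewrite /step; field. Qed.

Lemma iter_stepN n z : iter n step (- z) = - iter n step z.
Proof. by elim: n => //= n ->; rewrite step_N. Qed.

(** 1 - step y = (1 - y)(1 - y (1 + y) / 2), and the last factor is at most 1 - z / 2 because the
    iterates increase from z: the convergence to 1 is geometric. *)
Lemma iter_step_bounds n (z : R) : 0 <= z <= 1 ->
  z <= iter n step z <= 1 /\ 1 - iter n step z <= (1 - z / 2) ^+ n.
Proof.
move=> /andP[z0 z1]; elim: n => [|n [/andP[h1 h2] h3]] /=.
  by rewrite expr0; split; [rewrite lexx z1|lra].
move: (iter n step z) h1 h2 h3 => y h1 h2 h3.
have e : 1 - step y = (1 - y) * (1 - y * (1 + y) / 2) by rewrite /step; field.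
have y0 : 0 <= y := le_trans z0 h1.
have f0 : 0 <= 1 - y * (1 + y) / 2 by nra.
split; last by rewrite e exprSr; apply: ler_pM => //; nra.
apply/andP; split; last by rewrite -subr_ge0 e mulr_ge0// subr_ge0.
apply: le_trans h1 _; rewrite -subr_ge0.
have -> : step y - y = y * (1 - y) * (1 + y) / 2 by rewrite /step; field.
by rewrite divr_ge0// !mulr_ge0 ?subr_ge0// addr_ge0.
Qed.

Lemma iter_step_cvg (z : R) : `|z| <= 1 -> iter n step z @[n --> \oo] --> Num.sg z.
Proof.
have pos (y : R) : 0 < y -> y <= 1 -> iter n step y @[n --> \oo] --> (1 : R).
  move=> y0 y1; have yy : 0 <= y <= 1 by rewrite ltW.
  have cq : 1 - (1 - y / 2) ^+ n @[n --> \oo] --> (1 : R).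
    rewrite -[X in _ --> X]subr0; apply: cvgB; first exact: cvg_cst.
    by apply: cvg_expr; rewrite ger0_norm; lra.
  apply: squeeze_cvgr cq (cvg_cst (1 : R)); apply: nearW => n /=.
  by have [/andP[_ h1] h2] := iter_step_bounds n yy; rewrite h1 andbT; lra.
case: (ltrgt0P z) => [z0 z1|z0 z1|-> _].
- by rewrite gtr0_sg//; exact: pos.
- rewrite ltr0_sg//; have -> : (fun n => iter n step z) = fun n => - iter n step (- z).
    by apply/funext => n; rewrite iter_stepN opprK.
  by apply: cvgN; apply: pos; rewrite ?oppr_gt0.
- rewrite sgr0; have -> : (fun n => iter n step 0) = fun=> 0.
    by apply/funext; elim=> //= n ->; rewrite /step; field.
  exact: cvg_cst.
Qed.

Lemma iter_step_bounded n (z : R) : `|z| <= 1 -> `|iter n step z| <= 1.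
Proof.
have pos (y : R) : 0 <= y -> y <= 1 -> `|iter n step y| <= 1.
  move=> y0 y1; have yy : 0 <= y <= 1 by rewrite y0.
  have [/andP[h1 h2] _] := iter_step_bounds n yy.
  by rewrite ger0_norm// (le_trans y0).
case: (ler0P z) => [z0 h|z0 h]; last by apply: pos => //; exact: ltW.
by rewrite -[z]opprK iter_stepN normrN; apply: pos; rewrite ?oppr_ge0.
Qed.

End SignIteration.

Section BorelFunctions.
Context {R : realType}.
Local Notation trig_class := (@trig_class R true).
Local Notation step := (@sgn_step R).

Lemma trig_sg_sin t c : trig_class (fun x => Num.sg (sin (t * x + c))).
Proof.
apply: (@TrigLim _ true (fun n x => iter n step (sin (t * x + c))) _ 1) => //.
- by move=> n; exact: trig_iter_sin.
- by move=> n x; apply: iter_step_bounded; exact: sin_max.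
- by move=> x; apply: iter_step_cvg; exact: sin_max.
Qed.

(** sin((x - a) / (n + 1)) has the sign of x - a as soon as its argument is less than pi in absolute
    value, so a slowed-down square wave converges to the sign. *)
Lemma trig_sg a : trig_class (fun x => Num.sg (x - a)).
Proof.
apply: (@TrigLim _ true (fun n x => Num.sg (sin (n.+1%:R^-1 * x + - (n.+1%:R^-1 * a)))) _ 1) => //.
- by move=> n; exact: trig_sg_sin.
- by move=> n x; rewrite normr_sg; case: (_ != 0).
have small (y : R) : \forall n \near \oo, y / n.+1%:R < pi.
  near=> n; rewrite ltr_pdivrMr// -ltr_pdivrMl ?pi_gt0//.
  apply: (@lt_trans _ _ n%:R); last by rewrite ltr_nat.
  by near: n; exact: nbhs_infty_gtr.
move=> x; under eq_fun do rewrite -mulrBr mulrC.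
move: (x - a) => y; apply: cvg_near_cst; near=> n.
have n0 : 0 < n.+1%:R :> R by rewrite ltr0n.
have [y0|y0|y0] := ltrgt0P y; last by rewrite y0 mul0r sin0.
- rewrite [RHS]gtr0_sg// gtr0_sg// sin_gt0_pi// divr_gt0//=; near: n; exact: small.
- rewrite [RHS]ltr0_sg// ltr0_sg// -[y]opprK mulNr sinN oppr_lt0 sin_gt0_pi//.
  rewrite divr_gt0 ?oppr_gt0//=; near: n; exact: small.
Unshelve. all: by end_near. Qed.

(** The sets whose indicator is in the class form a sigma-algebra: complements by linearity,
    countable unions as bounded limits of 1 - prod (1 - indicator). It contains the intervals ]a,
    b], which generate the Borel sets. *)
Lemma trig_indic (A : set R) :
  measurable (A : set (measurableTypeR R)) -> trig_class (\1_A : R -> R).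
Proof.
(* With s the sign of x - a, (s + s^2) / 2 is the indicator of x > a. *)
have half a : trig_class (fun x => (x <= a)%R%:R : R).
  have := trigB (trig_cst true 1) (trigZ (1 / 2) (trigD (trig_sg a) (trigM (trig_sg a) (trig_sg a)))).
  congr trig_class; apply/funext => x /=; rewrite -[x <= a]subr_le0.
  by case: sgrP => _ /=; field.
move: A; apply: smallest_sub.
  split=> /=.
  - have := @trig_cst R true 0; congr trig_class; apply/funext => x.
    by rewrite indicE in_set0.
  - move=> A hA; have := trigB (trig_cst true 1) hA; congr trig_class; apply/funext => x.
    by rewrite setTD !indicE in_setC/=; case: (x \in A); rewrite ?subrr ?subr0.
  move=> A hA; have h n : trig_class (fun x => 1 - \prod_(k < n) (1 - \1_(A k) x)).
    apply: trigB; first exact: (trig_cst true 1).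
    elim: n => [|n IHn].
      by have := @trig_cst R true 1; congr trig_class; apply/funext => x; rewrite big_ord0.
    have := trigM IHn (trigB (trig_cst true 1) (hA n)); congr trig_class; apply/funext => x.
    by rewrite big_ord_recr.
  have v (x : R) k : 1 - \1_(A k) x = (x \notin A k)%:R :> R.
    by rewrite indicE; case: (x \in A k); rewrite ?subrr ?subr0.
  have pv (x : R) n : \prod_(k < n) (1 - \1_(A k) x) = [forall k : 'I_n, x \notin A k]%:R :> R.
    under eq_bigr do rewrite v.
    case: forallP => [h0|/forallP]; first by rewrite big1// => k _; rewrite h0.
    rewrite negb_forall => /existsP[k hk].
    by rewrite (bigD1 k)//= (negbTE hk) mul0r.
  apply: (TrigLim (M := 1) isT h) => [n x|x].
    by rewrite pv; case: [forall _, _]; rewrite ?subrr ?subr0 ?normr0 ?normr1.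
  apply: cvg_near_cst.
  have [[k _ hk]|hx] := pselect ((\bigcup_k A k) x).
    near=> n; rewrite pv indicE mem_set; last by exists k.
    have kn : (k < n)%N by near: n; exact: nbhs_infty_gt.
    have -> : [forall k0 : 'I_n, x \notin A k0] = false; last by rewrite subr0.
    by apply/negbTE/forallP => /(_ (Ordinal kn)); rewrite mem_set.
  near=> n; rewrite pv indicE memNset//.
  have -> : [forall k : 'I_n, x \notin A k] = true; last by rewrite subrr.
  by apply/forallP => k; rewrite memNset// => hk; apply: hx; exists k.
move=> _ [[a b] _ <-] /=.
have := trigM (half b) (trigB (trig_cst true 1) (half a)); congr trig_class; apply/funext => x.
by rewrite indicE mem_setE in_itv/= ltNge; case: (x <= a) => /=; rewrite ?subrr ?subr0 ?mulr0 ?mulr1.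
Unshelve. all: by end_near. Qed.

End BorelFunctions.

Section TrigExtension.
Context {R : realType} {d : measure_display} {Om : measurableType d}.
Variable P : probability Om R.

Lemma mean_bounded_cvg (F_ : nat -> Om -> R) (F : Om -> R) (M : R) :
  (forall n, measurable_fun setT (F_ n)) -> (forall n w, `|F_ n w| <= M) ->
  (forall w, F_ n w @[n --> \oo] --> F w) ->
  mean P (F_ n) @[n --> \oo] --> mean P F.
Proof.
move=> mF bF cF; have mF' : measurable_fun setT F.
  by apply: measurable_fun_cvg mF _ => w _; exact: cF.
have bF' w : `|F w| <= M.
  apply: (ler_cvg_to (cvg_norm (cF w)) (cvg_cst M)).
  by apply: nearW => n; exact: bF.
have := @dominated_cvg _ _ R P setT measurableT (fun n w => (F_ n w)%:E) (EFin \o F) (cst M%:E).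
rewrite meanE; last exact: integ_bounded bF'.
under eq_fun do rewrite (meanE (integ_bounded P (mF _) (bF _))).
move=> h; suff : (mean P (F_ n))%:E @[n --> \oo] --> (mean P F)%:E by move=> /fine_cvg.
apply: h => //.
- by move=> n; apply/measurable_EFinP.
- by move=> w _; apply: cvg_EFin; [exact: nearW|exact: cF].
- exact: (integ_cst P M).
- by move=> n w _; rewrite lee_fin.
Qed.

Variables (V Z : Om -> R) (K M : R).
Hypotheses (mV : measurable_fun setT V) (bV : forall w, `|V w| <= M).
Hypothesis mZ : measurable_fun setT Z.

Lemma trig_integ lim f : trig_class lim f -> integ P (fun w => f (Z w)).
Proof.
move=> hf; have [N hN] := trig_bounded hf.
by apply: (@integ_bounded _ _ _ P _ N) => //; apply: measurableT_comp (trig_meas hf) mZ.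
Qed.

Lemma trig_integM lim f : trig_class lim f -> integ P (fun w => f (Z w) * V w).
Proof.
move=> hf; have [N hN] := trig_bounded hf.
apply: (@integ_bounded _ _ _ P _ (N * M)) => [|w].
  by apply: measurable_funM => //; apply: measurableT_comp (trig_meas hf) mZ.
by rewrite normrM ler_pM.
Qed.

(** Both sides are linear in f and pass to bounded pointwise limits by dominated convergence; K
    stands for the mean of V. *)
Lemma trig_extension :
  (forall t c, mean P (fun w => cos (t * Z w + c) * V w) =
    mean P (fun w => cos (t * Z w + c)) * K) ->
  forall lim f, trig_class lim f -> mean P (fun w => f (Z w) * V w) =
    mean P (fun w => f (Z w)) * K.
Proof.
move=> hcos lim f; elim=> [t c|a b {}f g hf ihf hg ihg|f_ {}f N _ hf_ ih hN cf]; first exact: hcos.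
  have i1 := trig_integM hf; have i2 := trig_integM hg.
  have j1 := trig_integ hf; have j2 := trig_integ hg.
  under eq_mean do rewrite mulrDl -!mulrA.
  rewrite meanD; [|exact: integZ|exact: integZ].
  rewrite (meanZ a i1) (meanZ b i2) meanD; [|exact: integZ|exact: integZ].
  by rewrite (meanZ a j1) (meanZ b j2) ihf ihg; ring.
have c1 : mean P (fun w => f_ n (Z w)) * K @[n --> \oo] --> mean P (fun w => f (Z w) * V w).
  under eq_fun do rewrite -ih.
  apply: (@mean_bounded_cvg _ _ (N * M)).
  - by move=> n; apply: integ_meas; exact: trig_integM.
  - by move=> n w; rewrite normrM ler_pM.
  - by move=> w; apply: cvgM => //; exact: cvg_cst.
have c2 : mean P (fun w => f_ n (Z w)) * K @[n --> \oo] --> mean P (fun w => f (Z w)) * K.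
  apply: cvgM; last exact: cvg_cst.
  apply: (@mean_bounded_cvg _ _ N) => //.
  by move=> n; apply: integ_meas; exact: trig_integ.
exact: cvg_unique c1 c2.
Qed.

End TrigExtension.

Section StandardGaussian.
Context {R : realType} {d : measure_display} {Om : measurableType d}.
Variables (P : probability Om R) (p : nat) (Y : {RV P >-> p.-tuple R}).
Hypothesis hG : centered_gaussian Y 1%:M.

Let y i w := tnth (Y w) i.
Let my i : measurable_fun setT (y i). Proof. exact: measurable_coord. Qed.

Lemma std_coord_law i (A : set R) : measurable A -> P (y i @^-1` A) = normal_law 0 1 A.
Proof.
move=> mA; have := hG (delta_mx 0 i) mA; rewrite mulmx1 trmx_delta mul_delta_mx mxE !eqxx/=.
move=> <-; congr (P _); apply/seteqP; split=> w /=; rewrite (bigD1 i)//= big1 ?mxE ?eqxx ?mul1r ?addr0//.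
- by move=> j ji; rewrite mxE (negbTE ji) andbF mul0r.
- by move=> j ji; rewrite mxE (negbTE ji) andbF mul0r.
Qed.

Let lin (s : 'I_p -> R) w := \sum_i s i * y i w.

Let mean_lin_cos s c : mean P (fun w => cos (lin s w + c)) =
  expR (- ((\sum_i s i ^+ 2) / 2)) * cos c.
Proof.
have mlin : measurable_fun setT (lin s).
  by apply: measurable_sum => i; apply: measurable_funM.
have q0 : 0 <= \sum_i s i ^+ 2 by apply: sumr_ge0 => i _; exact: sqr_ge0.
have law (A : set R) : measurable A -> P (lin s @^-1` A) = normal_law 0 (\sum_i s i ^+ 2) A.
  move=> mA; have := hG (\row_i s i) mA; rewrite mulmx1 !mxE.
  under eq_bigr do rewrite !mxE -expr2; move=> <-; congr (P _).
  by apply/seteqP; split=> w /=; under eq_bigr do rewrite mxE.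
have := gaussian_cos q0 mlin law 1 c; under eq_mean do rewrite mul1r.
by move=> ->; rewrite expr1n mulr1.
Qed.

Let mean_coord_cos i t c : mean P (fun w => cos (t * y i w + c)) =
  expR (- (t ^+ 2 / 2)) * cos c.
Proof. by rewrite (gaussian_cos ler01 (my i) (@std_coord_law i)) mul1r. Qed.

Let mcos t i c : measurable_fun setT (fun w => cos (t * y i w + c)).
Proof.
apply: (measurableT_comp (f := fun x : R => cos (t * x + c))) (my i).
exact: (@trig_meas _ true) (TrigCos t c).
Qed.

(* One factor at a time, product-to-sum formulas move the cosines into the
   linear combination. *)
Let mean_prod_cos (t c : 'I_p -> R) m : (m <= p)%N ->
  forall s c0, (forall i : 'I_p, (i < m)%N -> s i = 0) ->
  mean P (fun w => (\prod_(i < p | (i < m)%N) cos (t i * y i w + c i)) * cos (lin s w + c0)) =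
  (\prod_(i < p | (i < m)%N) mean P (fun w => cos (t i * y i w + c i))) *
  (expR (- ((\sum_i s i ^+ 2) / 2)) * cos c0).
Proof.
elim: m => [_ s c0 _|m IHm mp s c0 s0].
  rewrite big_pred0// mul1r -mean_lin_cos; apply: eq_mean => w.
  by rewrite big_pred0// mul1r.
pose k := Ordinal mp.
have prodS (f : 'I_p -> R) : \prod_(i < p | (i < m.+1)%N) f i =
    (\prod_(i < p | (i < m)%N) f i) * f k.
  rewrite (bigD1 k) ?leqnn//= mulrC; congr (_ * _); apply: eq_bigl => i.
  by rewrite ltnS leq_eqVlt -val_eqE/=; case: ltngtP.
(* The coefficient of s at k is zero, so putting e there raises the sum of squares by exactly e^2,
   and the exponential factorizes. *)
pose s' (e : R) i := s i + e * (i == k)%:R.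
have s'0 e (i : 'I_p) : (i < m)%N -> s' e i = 0.
  move=> im; rewrite /s' (s0 i (ltnW im)) add0r -val_eqE/= ltn_eqF// mulr0//.
have linS e w : lin (s' e) w = lin s w + e * y k w.
  rewrite /lin /s'; under eq_bigr do rewrite mulrDl; rewrite big_split/=; congr (_ + _).
  rewrite (bigD1 k)//= eqxx mulr1 big1 ?addr0// => i ik.
  by rewrite (negbTE ik) mulr0 mul0r.
have qS e : \sum_i s' e i ^+ 2 = \sum_i s i ^+ 2 + e ^+ 2.
  rewrite (bigD1 k)//= [in RHS](bigD1 k)//= /s' eqxx s0 ?leqnn// add0r mulr1.
  rewrite expr0n add0r addrC; congr (_ + _); apply: eq_bigr => i ik.
  by rewrite (negbTE ik) mulr0 addr0.
pose Q w := \prod_(i < p | (i < m)%N) cos (t i * y i w + c i).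
have mlin e : measurable_fun setT (lin e).
  by apply: measurable_sum => i; apply: measurable_funM.
have iQ e b : integ P (fun w => Q w * cos (lin e w + b)).
  apply: (@integ_bounded _ _ _ P _ 1) => [|w].
    apply: measurable_funM; first by rewrite /Q; under eq_fun do rewrite -big_filter; apply: measurable_prod.
    have := measurableT_comp (trig_meas (@TrigCos R true 1 b)) (mlin e).
    by rewrite /comp; under eq_fun do rewrite mul1r.
  rewrite normrM mulr_ile1 ?cos_max// normr_prod.
  by apply: prodr_ile1 => i _; rewrite normr_ge0 cos_max.
transitivity (mean P (fun w => 1 / 2 * (Q w * cos (lin (s' (t k)) w + (c0 + c k))) +
    1 / 2 * (Q w * cos (lin (s' (- t k)) w + (c0 - c k))))).
  apply: eq_mean => w; rewrite prodS -/(Q w) !linS.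
  have -> : lin s w + t k * y k w + (c0 + c k) = (lin s w + c0) + (t k * y k w + c k) by ring.
  have -> : lin s w + - t k * y k w + (c0 - c k) = (lin s w + c0) - (t k * y k w + c k) by ring.
  move: (lin s w + c0) (t k * y k w + c k) => u v.
  by rewrite cosD cosB; field.
rewrite meanD; [|exact: integZ|exact: integZ].
rewrite (meanZ _ (iQ _ _)) (meanZ _ (iQ _ _)) !IHm ?(ltnW mp)//; try exact: s'0.
rewrite prodS mean_coord_cos !qS sqrrN mulrDl opprD expRD cosD cosB.
by field.
Qed.

(** Induction on the number m of leading factors that need not be cosines: one of them is extended
    from cosines to the whole class by [trig_extension], with the product of the other factors as
    V. *)
Lemma mean_prod_trig (f : 'I_p -> R -> R) : (forall i, trig_class true (f i)) ->
  mean P (fun w => \prod_i f i (y i w)) = \prod_i mean P (fun w => f i (y i w)).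
Proof.
suff h m : forall f : 'I_p -> R -> R, (forall i, trig_class true (f i)) ->
    (forall i : 'I_p, (m <= i)%N -> exists t c, f i = (fun x => cos (t * x + c))) ->
    mean P (fun w => \prod_i f i (y i w)) = \prod_i mean P (fun w => f i (y i w)).
  move=> tf; apply: (h p) => // i; by rewrite leqNgt ltn_ord.
elim: m => [|m IHm] {}f tf cf.
  have /choice[t /choice[c ft]] : forall i, exists t c, f i = (fun x => cos (t * x + c)).
    by move=> i; exact: cf.
  have z2 : \sum_(i < p) (0 : R) ^+ 2 = 0 by rewrite big1// => i _; rewrite expr0n.
  have := @mean_prod_cos t c p (leqnn p) (fun=> 0) 0 _; rewrite z2 mul0r oppr0 expR0 cos0 !mulr1 => h.
  transitivity (\prod_(i < p | (i < p)%N) mean P (fun w => cos (t i * y i w + c i))).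
    rewrite -h; last by [].
    apply: eq_mean => w; have -> : lin (fun=> 0) w = 0.
      by rewrite /lin big1// => i _; rewrite mul0r.
    rewrite addr0 cos0 mulr1.
    by apply: eq_big => i; [rewrite ltn_ord|rewrite ft].
  by apply: eq_big => i; [rewrite ltn_ord|rewrite ft].
have [mp|pm] := ltnP m p; last first.
  by apply: IHm => // i mi; move: (ltn_ord i); rewrite ltnNge (leq_trans pm mi).
pose k := Ordinal mp.
pose V w := \prod_(i | i != k) f i (y i w).
pose K := \prod_(i | i != k) mean P (fun w => f i (y i w)).
have [B hB] : exists B, forall w, `|V w| <= B.
  have /choice[B hB] : forall i, exists B, forall x, `|f i x| <= B.
    by move=> i; exact: trig_bounded.
  exists (\prod_(i | i != k) B i) => w; rewrite normr_prod.
  by apply: ler_prod => i _; rewrite normr_ge0 hB.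
have mV : measurable_fun setT V.
  by rewrite /V; under eq_fun do rewrite -big_filter; apply: measurable_prod => i _;
    apply: measurableT_comp (trig_meas (tf i)) (my i).
have h : forall g, trig_class true g -> mean P (fun w => g (y k w) * V w) =
    mean P (fun w => g (y k w)) * K.
  move=> g; apply: (trig_extension mV hB (my k)) => t c.
  pose f' i := if i == k then fun x => cos (t * x + c) else f i.
  have -> : mean P (fun w => cos (t * y k w + c)) * K = \prod_i mean P (fun w => f' i (y i w)).
    rewrite (bigD1 k)//= /f' eqxx; congr (_ * _).
    by apply: eq_bigr => i /negbTE ->.
  rewrite -IHm.
  - apply: eq_mean => w; rewrite [RHS](bigD1 k)//= /f' eqxx; congr (_ * _).
    by apply: eq_bigr => i /negbTE ->.
  - by move=> i; rewrite /f'; case: ifP => // _; exact: TrigCos.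
  - move=> i mi; rewrite /f'; case: eqP => [_|ik]; first by exists t, c.
    apply: cf; rewrite ltn_neqAle mi andbT; apply/eqP => e; apply: ik.
    exact: val_inj.
rewrite (bigD1 k)//= -h//; apply: eq_mean => w.
by rewrite (bigD1 k).
Qed.

Lemma std_coord_independent : independent_family P y.
Proof.
move=> A mA.
have mB i : measurable (y i @^-1` A i) by rewrite -[_ @^-1` _]setTI; exact: my.
have mI (B : set Om) : measurable B -> P B = (mean P (\1_B))%:E.
  move=> mB'; rewrite -expectE ?expectation_indic//.
  apply: (@integ_bounded _ _ _ P _ 1); first exact: measurable_indic.
  by move=> w; rewrite indicE; case: (_ \in _); rewrite ?normr1 ?normr0.
under eq_bigr do rewrite mI//.
rewrite mI; last by apply: fin_bigcap_measurable => // i _; exact: mB.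
rewrite prodEFin; congr (_%:E).
have := @mean_prod_trig (fun i => \1_(A i)) (fun i => trig_indic (mA i)).
move=> h; transitivity (mean P (fun w => \prod_i (\1_(A i) (y i w) : R))); last first.
  by rewrite h; apply: eq_bigr => i _; apply: eq_mean => w; rewrite !indicE.
apply: eq_mean => w; rewrite indicE.
under eq_bigr do rewrite indicE.
have [hw|hw] := boolP (w \in _).
  rewrite big1// => i _; rewrite mem_set//.
  by move/set_mem : hw => /(_ i I).
have [i hi] : exists i, ~ A i (y i w).
  apply/existsNP => hA; move: hw; rewrite notin_setE; apply => i _; exact: hA.
by rewrite (bigD1 i)//= memNset// mul0r.
Qed.

End StandardGaussian.

(** * Central limit theorem under the null hypothesis *)

Section CauchySchwarz.
Context {R : realType} {d : measure_display} {Om : measurableType d}.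
Variable P : probability Om R.

Lemma discriminant_le (x y z : R) : 0 <= z ->
  (forall t, 0 <= x + 2 * t * y + t ^+ 2 * z) -> y ^+ 2 <= x * z.
Proof.
rewrite le_eqVlt => /predU1P[<-|z0] h.
  rewrite mulr0; have [->|y0] := eqVneq y 0; first by rewrite expr0n.
  (* At this t the affine function takes the value -1. *)
  have := h (- ((x + 1) / (2 * y))); rewrite mulr0 addr0.
  have -> : x + 2 * - ((x + 1) / (2 * y)) * y = - 1 by field.
  by rewrite oppr_ge0 ler10.
have := h (- (y / z)); have -> : x + 2 * - (y / z) * y + (- (y / z)) ^+ 2 * z = (x * z - y ^+ 2) / z.
  by field; rewrite gt_eqF.
by rewrite pmulr_lge0 ?invr_gt0// subr_ge0.
Qed.

Lemma mean_mul_sqr_le (f g : Om -> R) : allmom P f -> allmom P g ->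
  mean P (fun w => f w * g w) ^+ 2 <=
  mean P (fun w => f w ^+ 2) * mean P (fun w => g w ^+ 2).
Proof.
move=> hf hg; apply: discriminant_le => [|t]; first by apply: mean_ge0 => w; exact: sqr_ge0.
have i1 := allmom_integ (allmomX 2 hf); have i2 := allmom_integ (allmomX 2 hg).
have i3 := allmom_integ (allmomM hf hg).
rewrite -(meanZ (2 * t) i3) -(meanZ (t ^+ 2) i2).
rewrite -meanD//; last exact: integZ.
rewrite -meanD//; [|by apply: integD => //; exact: integZ|exact: integZ].
apply: mean_ge0 => w; have -> : f w ^+ 2 + 2 * t * (f w * g w) + t ^+ 2 * g w ^+ 2 =
  (f w + t * g w) ^+ 2 by ring.
exact: sqr_ge0.
Qed.

End CauchySchwarz.

Section Hypercontractivity.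
Context {R : realType} {dO : measure_display} {Om : measurableType dO}.
Variables (P : probability Om R) (I : finType) (xi : I -> Om -> R).
Hypothesis xi_meas : forall c, measurable_fun setT (xi c).
Hypothesis xi_ind : independent_family P xi.
Hypothesis xi_allmom : forall c, allmom P (xi c).
Hypothesis xi_mean1 : forall c, mean P (xi c) = 0.
Hypothesis xi_mean2 : forall c, mean P (fun w => xi c w ^+ 2) = 1.
Hypothesis xi_mean3 : forall c, mean P (fun w => xi c w ^+ 3) = 0.
Hypothesis xi_mean4 : forall c, mean P (fun w => xi c w ^+ 4) = 3.
Implicit Types (s : seq I) (f g : Om -> R).

(** For [s] without repetition, polynomials of degree at most [d] in which no variable is squared,
    split along the first variable of [s]: this is the shape on which the induction of Bonami's
    inequality runs. At degree 0 the cofactor of a variable must vanish. *)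
Fixpoint multilinear s (d : nat) f : Prop :=
  if s is c :: s' then exists A B, [/\ multilinear s' d A,
    (if d is d'.+1 then multilinear s' d' B else B = cst 0) &
    f = (fun w => A w + xi c w * B w)]
  else exists a, f = cst a.

Lemma multilinear_cst s d a : multilinear s d (cst a).
Proof.
elim: s d a => [|c s IHs] d a /=; first by exists a.
exists (cst a), (cst 0); split; first exact: IHs.
  by case: d => // d; exact: IHs.
by apply/funext => w; rewrite mulr0 addr0.
Qed.

Lemma multilinear_lin s d a b f g : multilinear s d f -> multilinear s d g ->
  multilinear s d (fun w => a * f w + b * g w).
Proof.
elim: s d f g => [|c s IHs] d f g /=.
  by move=> [x ->] [y ->]; exists (a * x + b * y).
move=> [A [B [hA hB ->]]] [A' [B' [hA' hB' ->]]].
exists (fun w => a * A w + b * A' w), (fun w => a * B w + b * B' w); split.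
- exact: IHs.
- case: d hB hB' {hA hA'} => [-> ->|d hB hB']; last exact: IHs.
  by apply/funext => w /=; rewrite !mulr0 addr0.
- by apply/funext => w; ring.
Qed.

Lemma mlpolyZ s d a f : multilinear s d f -> multilinear s d (fun w => a * f w).
Proof.
move=> hf; have := multilinear_lin a 0 hf hf; congr multilinear.
by apply/funext => w; rewrite mul0r addr0.
Qed.

Lemma multilinear_sum s d (J : Type) (r : seq J) (A : pred J) (F : J -> Om -> R) :
  (forall j, A j -> multilinear s d (F j)) ->
  multilinear s d (fun w => \sum_(j <- r | A j) F j w).
Proof.
move=> hF; elim: r => [|j r IHr].
  by under eq_fun do rewrite big_nil; exact: multilinear_cst.
case Aj: (A j); under eq_fun do rewrite big_cons Aj; last exact: IHr.
have := multilinear_lin 1 1 (hF _ Aj) IHr; congr multilinear.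
by apply/funext => w; rewrite !mul1r.
Qed.

Lemma multilinear_monomial s d (S : {set I}) : uniq s -> (#|S| <= d)%N ->
  (forall c, c \in S -> c \in s) -> multilinear s d (fun w => \prod_(c in S) xi c w).
Proof.
elim: s d S => [|c s IHs] d S /=.
  move=> _ _ hS; exists 1; apply/funext => w; rewrite big1// => c /hS.
  by rewrite in_nil.
move=> /andP[cs us] Sd Ss; have [cS|cS] := boolP (c \in S); last first.
  exists (fun w => \prod_(c in S) xi c w), (cst 0); split.
  - apply: IHs => // c' c'S; have := Ss _ c'S; rewrite in_cons => /predU1P[e|//].
    by move: cS; rewrite -e c'S.
  - by case: d {Sd} => // d; exact: multilinear_cst.
  - by apply/funext => w; rewrite mulr0 addr0.
exists (cst 0), (fun w => \prod_(c' in S :\ c) xi c' w); split.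
- exact: multilinear_cst.
- have := Sd; rewrite (cardsD1 c) cS; case: d {Sd} => // d Sd.
  apply: IHs => // c'; rewrite !inE => /andP[ne /Ss].
  by rewrite in_cons (negbTE ne).
- by apply/funext => w; rewrite add0r (big_setD1 c).
Qed.

Lemma multilinear_depends s d f : multilinear s d f -> depends_on xi [pred c | c \in s] f.
Proof.
elim: s d f => [|c s IHs] d f /=; first by case=> a ->; exact: depends_cst.
case=> A [B [hA hB ->]].
have sub : forall c', [pred c' | c' \in s] c' -> [pred c' | c' \in c :: s] c'.
  by move=> c' /= h; rewrite in_cons h orbT.
apply: dependsD; first exact: (depends_sub sub (IHs _ _ hA)).
apply: dependsM; first by apply: (@depends_comp _ _ _ _ _ _ _ _ c id); rewrite /= ?mem_head.
case: d hB {hA} => [->|d hB]; first exact: depends_cst.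
exact: (depends_sub sub (IHs _ _ hB)).
Qed.

Lemma multilinear_allmom s d f : multilinear s d f -> allmom P f.
Proof.
elim: s d f => [|c s IHs] d f /=; first by case=> a ->; exact: allmom_cst.
case=> A [B [hA hB ->]]; apply: allmomD; first exact: IHs hA.
apply: allmomM => //; case: d hB {hA} => [->|d hB]; first exact: allmom_cst.
exact: IHs hB.
Qed.

(* Bonami's inequality; the constant 9 suffices because E xi^3 = 0 and
   E xi^4 = 3. *)
Lemma multilinear_mean4_le s d f : uniq s -> multilinear s d f ->
  mean P (fun w => f w ^+ 4) <= 9 ^+ d * mean P (fun w => f w ^+ 2) ^+ 2.
Proof.
elim: s d f => [|c s IHs] d f /=.
  move=> _ [a ->]; rewrite (mean_cst P (a ^+ 4)) (mean_cst P (a ^+ 2)).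
  by rewrite -exprM ler_peMl ?exprn_even_ge0// exprn_ege1// ler1n.
move=> /andP[cs us] [A [B [hA hB ->]]]; case: d hA hB => [|d] hA hB.
  by rewrite hB; under eq_mean do rewrite mulr0 addr0; under [in leRHS]eq_mean do rewrite mulr0 addr0;
    exact: IHs hA.
have mA := multilinear_allmom hA; have mB := multilinear_allmom hB; have dB := multilinear_depends hB.
have dA := multilinear_depends hA; have mx := xi_allmom c.
have dx k : depends_on xi (pred1 c) (fun w => xi c w ^+ k).
  apply: (depends_comp xi (c := c) (f := fun x : R => x ^+ k)); first by rewrite /= eqxx.
  exact: measurable_funX.
have split_mean k (U : Om -> R) : allmom P U -> depends_on xi [pred c | c \in s] U ->
    mean P (fun w => xi c w ^+ k * U w) = mean P (fun w => xi c w ^+ k) * mean P U.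
  move=> mU dU; apply: (depends_mean xi_meas xi_ind _ (dx k) dU) => //; last exact: allmomX.
  by move=> c' /= /eqP ->.
have dX (U : Om -> R) k : depends_on xi [pred c | c \in s] U ->
    depends_on xi [pred c | c \in s] (fun w => U w ^+ k).
  move=> dU; elim: k => [|k IHk].
    by exact: (depends_cst xi _ (1 : R)).
  have -> : (fun w => U w ^+ k.+1) = fun w => U w * U w ^+ k by apply/funext => w; rewrite exprS.
  exact: dependsM.
have hx1 : mean P (fun w => xi c w ^+ 1) = 0 := xi_mean1 c.
have e2 : mean P (fun w => (A w + xi c w * B w) ^+ 2) =
    mean P (fun w => A w ^+ 2) + mean P (fun w => B w ^+ 2).
  transitivity (mean P (fun w => A w ^+ 2 + (2 * (xi c w ^+ 1 * (A w * B w)) + xi c w ^+ 2 * B w ^+ 2))).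
    by apply: eq_mean => w; ring.
  have AB := allmomM mA mB; have A2 := allmomX 2 mA; have B2 := allmomX 2 mB.
  have x1 := allmomM (allmomX 1 mx) AB; have x2 := allmomM (allmomX 2 mx) B2.
  rewrite meanD; [|exact: allmom_integ|by apply: allmom_integ; apply: allmomD => //; exact: allmomZ].
  rewrite meanD; [|by apply: allmom_integ; exact: allmomZ|exact: allmom_integ].
  rewrite (meanZ 2 (allmom_integ x1)) !split_mean//; [|exact: dX|exact: dependsM].
  by rewrite hx1 xi_mean2 mul0r mulr0 add0r mul1r.
have e4 : mean P (fun w => (A w + xi c w * B w) ^+ 4) =
    mean P (fun w => A w ^+ 4) + 6 * mean P (fun w => A w ^+ 2 * B w ^+ 2) +
    3 * mean P (fun w => B w ^+ 4).
  transitivity (mean P (fun w => A w ^+ 4 + (4 * (xi c w ^+ 1 * (A w ^+ 3 * B w)) +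
    (6 * (xi c w ^+ 2 * (A w ^+ 2 * B w ^+ 2)) + (4 * (xi c w ^+ 3 * (A w * B w ^+ 3)) +
     xi c w ^+ 4 * B w ^+ 4))))).
    by apply: eq_mean => w; ring.
  have a1 := allmomM (allmomX 3 mA) mB; have a2 := allmomM (allmomX 2 mA) (allmomX 2 mB).
  have a3 := allmomM mA (allmomX 3 mB); have a4 := allmomX 4 mB; have a0 := allmomX 4 mA.
  have x1 := allmomM (allmomX 1 mx) a1; have x2 := allmomM (allmomX 2 mx) a2.
  have x3 := allmomM (allmomX 3 mx) a3; have x4 := allmomM (allmomX 4 mx) a4.
  have y1 := allmomZ 4 x1; have y2 := allmomZ 6 x2; have y3 := allmomZ 4 x3.
  have z3 := allmomD y3 x4; have z2 := allmomD y2 z3; have z1 := allmomD y1 z2.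
  rewrite (meanD (allmom_integ a0) (allmom_integ z1)) (meanD (allmom_integ y1) (allmom_integ z2)).
  rewrite (meanD (allmom_integ y2) (allmom_integ z3)) (meanD (allmom_integ y3) (allmom_integ x4)).
  rewrite (meanZ 4 (allmom_integ x1)) (meanZ 6 (allmom_integ x2)) (meanZ 4 (allmom_integ x3)).
  rewrite !split_mean//; try by [exact: dX|apply: dependsM => //; exact: dX].
  by rewrite hx1 xi_mean2 xi_mean3 xi_mean4 !mul0r !mulr0 !add0r mul1r addrA.
have hA4 := IHs d.+1 A us hA.
have CS := mean_mul_sqr_le (allmomX 2 mA) (allmomX 2 mB).
have sq (U : Om -> R) : mean P (fun w => (U w ^+ 2) ^+ 2) = mean P (fun w => U w ^+ 4).
  by apply: eq_mean => w; rewrite -exprM.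
rewrite !sq in CS.
have A20 : 0 <= mean P (fun w => A w ^+ 2) by apply: mean_ge0 => w; exact: sqr_ge0.
have B20 : 0 <= mean P (fun w => B w ^+ 2) by apply: mean_ge0 => w; exact: sqr_ge0.
have A40 : 0 <= mean P (fun w => A w ^+ 4) by apply: mean_ge0 => w; exact: exprn_even_ge0.
have B40 : 0 <= mean P (fun w => B w ^+ 4) by apply: mean_ge0 => w; exact: exprn_even_ge0.
have AB0 : 0 <= mean P (fun w => A w ^+ 2 * B w ^+ 2).
  by apply: mean_ge0 => w; rewrite mulr_ge0// sqr_ge0.
have hB4 := IHs d B us hB; rewrite exprS in hA4 *.
have N0 : 0 <= (9 : R) ^+ d by rewrite exprn_ge0.
rewrite e2 e4; move: (mean P (fun w => A w ^+ 2 * B w ^+ 2)) (mean P (fun w => A w ^+ 2))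
  (mean P (fun w => B w ^+ 2)) (mean P (fun w => A w ^+ 4)) (mean P (fun w => B w ^+ 4))
  A20 B20 A40 B40 AB0 hA4 hB4 CS N0.
move: (9 ^+ d : R) => N ab a b a4 b4 a0 b0 a40 b40 ab0 hA4 hB4 CS N0.
(* By Cauchy-Schwarz, ab^2 <= a4 b4 <= (9 N a^2)(N b^2). Then 6 ab <= 18 N a b is exactly the cross
   term of 9 N (a + b)^2, which is how the constant 9 arises. *)
have abN : ab <= 3 * N * (a * b).
  rewrite -(ler_pXn2r (n := 2))// ?nnegrE ?mulr_ge0//.
  apply: le_trans CS _; have -> : (3 * N * (a * b)) ^+ 2 = (9 * N * a ^+ 2) * (N * b ^+ 2) by ring.
  by apply: ler_pM.
have := mulr_ge0 N0 (sqr_ge0 b); nra.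
Qed.

End Hypercontractivity.

Section TaylorBounds.
Context {R : realType}.
Implicit Types h x y r : R.

(** The mean value theorem in place of integration loses a harmless factor 1 / (k + 1). Starting
    from |cos| <= 1 it yields in turn the bounds for sin h, cos h - 1, sin h - h and cos h - 1 + h^2
    / 2. *)
Lemma le_power_of_derivative (f f' : R -> R) (k : nat) : f 0 = 0 ->
  (forall x, is_derive x 1 f (f' x)) ->
  (forall x, 0 <= x -> `|f' x| <= x ^+ k) ->
  forall h, 0 <= h -> `|f h| <= h ^+ k.+1.
Proof.
move=> f0 df f'k h; rewrite le_eqVlt => /predU1P[<-|h0].
  by rewrite f0 normr0 expr0n.
have [|c] := @MVT R f f' 0 h h0 (fun x _ => df x).
  by apply: derivable_within_continuous => x _; have := df x => ?; exact: ex_derive.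
rewrite in_itv/= f0 !subr0 => /andP[c0 ch] ->.
rewrite normrM [`|h|]gtr0_norm// exprSr ler_pM2r//.
apply: le_trans (f'k c (ltW c0)) _.
by apply: lerXn2r; rewrite ?nnegrE ltW.
Qed.

Lemma norm_sin_le h : `|sin h| <= `|h|.
Proof.
wlog h0 : h / 0 <= h.
  move=> wl; have [/wl//|h0] := leP 0 h.
  by have := wl (- h); rewrite sinN !normrN oppr_ge0 => -> //; exact: ltW.
rewrite [leRHS]ger0_norm//.
apply: (@le_power_of_derivative sin cos 0) => //; first exact: sin0.
by move=> x _; exact: cos_max.
Qed.

Let norm_cosB1 h : 0 <= h -> `|cos h - 1| <= h ^+ 2.
Proof.
apply: (@le_power_of_derivative (fun x => cos x - 1) (fun x => - sin x)).
- by rewrite cos0 subrr.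
- by move=> x; apply: (is_derive_eq (f := fun x => cos x - 1)); rewrite oppr0 addr0.
- by move=> x x0; rewrite normrN expr1 -[leRHS]ger0_norm//; exact: norm_sin_le.
Qed.

Let norm_sinB_ge0 h : 0 <= h -> `|sin h - h| <= h ^+ 3.
Proof.
apply: (@le_power_of_derivative (fun x => sin x - x) (fun x => cos x - 1)).
- by rewrite sin0 subrr.
- by move=> x x0; exact: norm_cosB1.
Qed.

Lemma norm_sinB_le h : `|sin h - h| <= `|h| ^+ 3.
Proof.
have [h0|h0] := leP 0 h; first by rewrite [X in X ^+ 3]ger0_norm//; exact: norm_sinB_ge0.
have -> : sin h - h = - (sin (- h) - - h) by rewrite sinN; ring.
by rewrite normrN [`|h|]ltr0_norm//; apply: norm_sinB_ge0; rewrite oppr_ge0 ltW.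
Qed.

Lemma norm_cosB_le h : `|cos h - 1 + h ^+ 2 / 2| <= h ^+ 4.
Proof.
have H x : 0 <= x -> `|cos x - 1 + x ^+ 2 / 2| <= x ^+ 4.
  apply: (@le_power_of_derivative (fun x => cos x - 1 + x ^+ 2 / 2) (fun x => - sin x + x)).
  - by rewrite cos0 subrr expr0n mul0r addr0.
  - move=> y; apply: is_derive_eq; rewrite /GRing.scale/= /GRing.scale/=; by field.
  - by move=> y y0; rewrite addrC -normrN opprB; exact: norm_sinB_ge0.
have [h0|h0] := leP 0 h; first exact: H.
have := H (- h); rewrite cosN sqrrN => /(_ _)/le_trans; apply; first by rewrite oppr_ge0 ltW.
by have -> : (- h) ^+ 4 = h ^+ 4 by ring.
Qed.

Lemma norm_expRNB_le r : 0 <= r -> `|expR (- r) - 1 + r| <= r ^+ 2.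
Proof.
move=> r0; have h1 := expR_ge1Dx (- r); rewrite ger0_norm; last by lra.
have r1 : 0 < 1 + r by lra.
have h2 : expR (- r) <= (1 + r)^-1.
  by rewrite expRN lef_pV2 ?posrE ?expR_gt0//; exact: expR_ge1Dx.
have h3 : (1 + r)^-1 <= 1 - r + r ^+ 2.
  rewrite -[leLHS]mul1r ler_pdivrMr//.
  have -> : (1 - r + r ^+ 2) * (1 + r) = 1 + r ^+ 3 by ring.
  by rewrite lerDl exprn_ge0.
lra.
Qed.

Lemma norm_cos_sub_le x y : `|cos x - cos y| <= `|x - y|.
Proof.
wlog xy : x y / y <= x.
  move=> wl; have [/wl//|/ltW/wl] := leP y x.
  by rewrite distrC [leRHS]distrC.
move: xy; rewrite le_eqVlt => /predU1P[->|xy]; first by rewrite !subrr.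
have [|c _ ->] := @MVT R cos (fun x => - sin x) y x xy (fun z _ => is_derive_cos z).
  by apply: derivable_within_continuous => z _; exact: ex_derive.
by rewrite normrM normrN ler_piMl// sin_max.
Qed.

Lemma norm_expRN_sub_le x y : 0 <= x -> 0 <= y ->
  `|expR (- x) - expR (- y)| <= `|x - y|.
Proof.
wlog xy : x y / x <= y.
  move=> wl x0 y0; have [/wl|/ltW /wl] := leP x y; first exact.
  by move=> H; rewrite distrC [leRHS]distrC; exact: H.
move=> x0 y0; have -> : expR (- y) = expR (- x) * expR (- (y - x)).
  by rewrite -expRD; congr expR; ring.
have h := expR_ge1Dx (- (y - x)).
have e1 : expR (- (y - x)) <= 1 by rewrite -[leRHS]expR0 ler_expR oppr_le0 subr_ge0.
rewrite -[X in X - _]mulr1 -mulrBr normrM [`|expR _|]ger0_norm ?expR_ge0//.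
rewrite [leRHS]distrC [leRHS]ger0_norm ?subr_ge0// ger0_norm ?subr_ge0//.
rewrite -[leRHS]mul1r; apply: ler_pM; rewrite ?expR_ge0 ?subr_ge0//; last lra.
by rewrite -expR0 ler_expR oppr_le0.
Qed.

End TaylorBounds.

(** * Sums of independent blocks and their Gaussian factors *)

Section IndependentBlocks.
Context {R : realType} {dO : measure_display} {Om : measurableType dO}.
Variables (P : probability Om R) (I : finType) (xi : I -> Om -> R).
Hypothesis xi_meas : forall c, measurable_fun setT (xi c).
Hypothesis xi_ind : independent_family P xi.

Lemma depends_fun (J : pred I) (f : R -> R) (U : Om -> R) :
  measurable_fun setT f -> depends_on xi J U -> depends_on xi J (fun w => f (U w)).
Proof. by move=> mf [mU]; split; exact: measurableT_comp mf mU. Qed.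

Lemma allmom_bounded (U : Om -> R) (M : R) : measurable_fun setT U ->
  (forall w, `|U w| <= M) -> allmom P U.
Proof.
move=> mU UM; split=> // k; apply: (@integ_bounded _ _ _ P _ (M ^+ k)) => [|w].
  by apply: measurable_funX; exact: measurableT_comp.
by rewrite normrX normr_id; apply: lerXn2r; rewrite ?nnegrE// (le_trans _ (UM w)).
Qed.

Lemma allmom_cos (U : Om -> R) t c : measurable_fun setT U ->
  allmom P (fun w => cos (t * U w + c)).
Proof.
move=> mU; apply: (@allmom_bounded _ 1) => [|w]; last exact: cos_max.
exact: (measurableT_comp (@trig_meas _ true _ (TrigCos t c)) mU).
Qed.

Variables (g : I -> nat) (U : nat -> Om -> R) (K dl : R).
Local Notation q b := (mean P (fun w => U b w ^+ 2)).
Hypothesis U_dep : forall b, depends_on xi [pred c | g c == b] (U b).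
Hypothesis U_allmom : forall b, allmom P (U b).
Hypothesis U_mean : forall b, mean P (U b) = 0.
Hypothesis K_ge0 : 0 <= K.
Hypothesis U_mean4 : forall b, mean P (fun w => U b w ^+ 4) <= K * q b ^+ 2.
Hypothesis dl_gt0 : 0 < dl.
Hypothesis dl_le1 : dl <= 1.
Hypothesis q_le : forall b, q b <= dl ^+ 2.

(** The power t^4 comes from the cosine of a block, |t|^3 from its sine. *)
Definition block_cst (t : R) := (K + 1) * (t ^+ 4 + `|t| ^+ 3).

Let q_ge0 b : 0 <= q b. Proof. by apply: mean_ge0 => w; exact: sqr_ge0. Qed.

Let q_sqr b : q b ^+ 2 <= dl * q b.
Proof.
rewrite expr2 ler_wpM2r//; apply: le_trans (q_le b) _.
by rewrite expr2 ler_piMl// ltW.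
Qed.

(** The mean cosine and the exponential both agree with 1 - t^2 q / 2 up to O(t^4 q^2), and one
    factor q is traded for dl since q <= dl^2 <= dl. *)
Lemma block_cos t b : `|mean P (fun w => cos (t * U b w + 0)) - expR (- (t ^+ 2 * q b / 2))| <=
  block_cst t * (dl * q b).
Proof.
have i0 := allmom_integ (allmom_cos t 0 (allmom_meas (U_allmom b))).
have i2 := allmom_integ (allmomX 2 (U_allmom b)).
have i4 := allmom_integ (allmomX 4 (U_allmom b)).
have h1 : `|mean P (fun w => cos (t * U b w + 0)) - (1 - t ^+ 2 * q b / 2)| <= t ^+ 4 * (K * q b ^+ 2).
  have -> : mean P (fun w => cos (t * U b w + 0)) - (1 - t ^+ 2 * q b / 2) =
      mean P (fun w => cos (t * U b w + 0) - 1 + t ^+ 2 / 2 * U b w ^+ 2).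
    rewrite meanD; [|by apply: integB => //; exact: integ_cst|exact: integZ].
    rewrite (meanB i0 (integ_cst P 1)) (meanZ _ i2) (mean_cst P 1); by ring.
  apply: (@le_trans _ _ (t ^+ 4 * mean P (fun w => U b w ^+ 4))); last first.
    by rewrite ler_wpM2l// exprn_even_ge0.
  rewrite -(meanZ _ i4); apply: le_mean_norm.
  - by apply: integD; [apply: integB => //; exact: integ_cst|exact: integZ].
  - exact: integZ.
  - move=> w; rewrite addr0 -exprMn; apply: le_trans (norm_cosB_le _).
    by rewrite exprMn mulrAC.
have r0 : 0 <= t ^+ 2 * q b / 2 by rewrite divr_ge0// mulr_ge0// sqr_ge0.
have h2 := norm_expRNB_le r0.
have t40 : 0 <= t ^+ 4 by rewrite exprn_even_ge0.
apply: (@le_trans _ _ (t ^+ 4 * (K * q b ^+ 2) + (t ^+ 2 * q b / 2) ^+ 2)).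
  rewrite -[X in X - _](subrK (1 - t ^+ 2 * q b / 2)) -addrA.
  apply: le_trans (ler_normD _ _) _; apply: lerD h1 _.
  have -> : 1 - t ^+ 2 * q b / 2 - expR (- (t ^+ 2 * q b / 2)) =
    - (expR (- (t ^+ 2 * q b / 2)) - 1 + t ^+ 2 * q b / 2) by ring.
  by rewrite normrN.
apply: (@le_trans _ _ ((K + 1) * t ^+ 4 * q b ^+ 2)).
  have := mulr_ge0 t40 (sqr_ge0 (q b)).
  have -> : (t ^+ 2 * q b / 2) ^+ 2 = t ^+ 4 * q b ^+ 2 / 4 by field.
  by nra.
apply: (@le_trans _ _ ((K + 1) * t ^+ 4 * (dl * q b))).
  by rewrite ler_wpM2l// mulr_ge0// addr_ge0.
rewrite ler_wpM2r ?mulr_ge0 ?(ltW dl_gt0)// /block_cst ler_wpM2l ?addr_ge0//.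
by rewrite lerDl exprn_ge0.
Qed.

(** The linear term of the sine has mean zero. The cubic remainder is interpolated between the
    second and the fourth moments with weight dl, which makes it O(dl q). *)
Lemma block_sin t b : `|mean P (fun w => sin (t * U b w))| <= block_cst t * (dl * q b).
Proof.
have mU := U_allmom b; have i1 := allmom_integ mU.
have i2 := allmom_integ (allmomX 2 mU); have i4 := allmom_integ (allmomX 4 mU).
have iS : integ P (fun w => sin (t * U b w)).
  have := allmom_integ (allmom_cos t (- (pi / 2)) (allmom_meas mU)).
  by under eq_fun do rewrite cosBpihalf.
have -> : mean P (fun w => sin (t * U b w)) = mean P (fun w => sin (t * U b w) - t * U b w).
  by rewrite meanB//; [rewrite (meanZ _ i1) U_mean mulr0 subr0|exact: integZ].
pose G w := `|t| ^+ 3 * (dl / 2 * U b w ^+ 2 + (2 * dl)^-1 * U b w ^+ 4).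
have iG : integ P G by apply: integZ; apply: integD; exact: integZ.
apply: (@le_trans _ _ (mean P G)).
  apply: le_mean_norm => // [|w]; first by apply: integB => //; exact: integZ.
  apply: le_trans (norm_sinB_le _) _; rewrite normrM exprMn ler_wpM2l ?exprn_ge0//.
  have -> : U b w ^+ 2 = `|U b w| ^+ 2 by rewrite real_normK ?num_real.
  have -> : U b w ^+ 4 = `|U b w| ^+ 4 by rewrite -normrX ger0_norm// exprn_even_ge0.
  (* AM-GM *)
  have -> : dl / 2 * `|U b w| ^+ 2 + (2 * dl)^-1 * `|U b w| ^+ 4 = `|U b w| ^+ 3 +
    (dl * `|U b w| - `|U b w| ^+ 2) ^+ 2 / (2 * dl) by field; rewrite gt_eqF.
  by rewrite lerDl divr_ge0 ?sqr_ge0// mulr_ge0// ltW.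
rewrite /G (meanZ _ (integD (integZ _ i2) (integZ _ i4))) meanD; [|exact: integZ|exact: integZ].
rewrite (meanZ _ i2) (meanZ _ i4) /block_cst.
have h4 : mean P (fun w => U b w ^+ 4) <= K * dl ^+ 2 * q b.
  apply: le_trans (U_mean4 b) _; rewrite -mulrA ler_wpM2l// expr2 ler_wpM2r//.
have h5 : dl / 2 * q b + (2 * dl)^-1 * mean P (fun w => U b w ^+ 4) <= (K + 1) * (dl * q b).
  apply: (@le_trans _ _ (dl / 2 * q b + (2 * dl)^-1 * (K * dl ^+ 2 * q b))).
    by rewrite lerD2l ler_wpM2l// invr_ge0 mulr_ge0// ltW.
  have -> : dl / 2 * q b + (2 * dl)^-1 * (K * dl ^+ 2 * q b) = (K + 1) * (dl * q b) / 2.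
    by field; rewrite gt_eqF.
  have : 0 <= (K + 1) * (dl * q b) by rewrite !mulr_ge0 ?addr_ge0 ?(ltW dl_gt0).
  by lra.
apply: le_trans (ler_wpM2l (exprn_ge0 3 (normr_ge0 t)) h5) _.
rewrite [leLHS]mulrA; have k0 : 0 <= dl * q b by rewrite mulr_ge0// ltW.
apply: (ler_wpM2r k0).
by rewrite mulrC ler_wpM2l ?addr_ge0// lerDr exprn_even_ge0.
Qed.

(* Lindeberg's replacement, multiplicative here: each block contributes the factor
   exp(- t^2 q / 2). *)
Lemma block_sum_cos t c N :
  `|mean P (fun w => cos (t * (\sum_(b < N) U b w) + c)) -
    expR (- (t ^+ 2 * (\sum_(b < N) q b) / 2)) * cos c| <=
  2 * block_cst t * dl * \sum_(b < N) q b.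
Proof.
elim: N => [|N IHN].
  under eq_mean do rewrite big_ord0 mulr0 add0r.
  by rewrite !big_ord0 (mean_cst P (cos c)) mulr0 mul0r oppr0 expR0 mul1r subrr normr0 mulr0.
pose S w := \sum_(b < N) U b w.
have S_dep : depends_on xi [pred i | (g i < N)%N] S.
  apply: depends_sum => b _; apply: depends_sub (U_dep b) => i /= /eqP ->; exact: ltn_ord.
have mS := depends_meas xi_meas S_dep.
have mU := allmom_meas (U_allmom N).
have disj i : [pred i | (g i < N)%N] i -> ~~ [pred i | g i == N] i.
  by move=> /= h; rewrite neq_ltn h.
have ca := allmom_cos t c mS; have ca' := allmom_cos t (c - pi / 2) mS.
have cb := allmom_cos t 0 mU; have cb' := allmom_cos t (0 - pi / 2) mU.
have dep (V : Om -> R) J x : depends_on xi J V -> depends_on xi J (fun w => cos (t * V w + x)).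
  by move=> dV; apply: (depends_fun (f := fun y => cos (t * y + x))) => //; apply: (@trig_meas _ true) (TrigCos _ _).
(* cos(x + y) = cos x cos y - sin x sin y, sines being cosines with phase shifted by pi / 2; each
   product then factorizes because the last block involves none of the previous coordinates. *)
have e : mean P (fun w => cos (t * (\sum_(b < N.+1) U b w) + c)) =
    mean P (fun w => cos (t * S w + c)) * mean P (fun w => cos (t * U N w + 0)) -
    mean P (fun w => cos (t * S w + (c - pi / 2))) * mean P (fun w => cos (t * U N w + (0 - pi / 2))).
  rewrite -(depends_mean xi_meas xi_ind disj (dep _ _ c S_dep) (dep _ _ 0 (U_dep N)) ca cb).
  rewrite -(depends_mean xi_meas xi_ind disj (dep _ _ _ S_dep) (dep _ _ _ (U_dep N)) ca' cb').
  rewrite -meanB; [|exact: allmom_integ (allmomM ca cb)|exact: allmom_integ (allmomM ca' cb')].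
  apply: eq_mean => w; rewrite big_ord_recr /= -/(S w) !addrA !cosBpihalf -cosD.
  by congr cos; ring.
have hs : `|mean P (fun w => cos (t * U N w + (0 - pi / 2)))| <= block_cst t * (dl * q N).
  have := block_sin t N; congr (`|_| <= _); apply: eq_mean => w.
  by rewrite addrA cosBpihalf addr0.
have hc := block_cos t N.
have bd x V : measurable_fun setT V -> `|mean P (fun w => cos (t * V w + x))| <= 1.
  move=> mV; rewrite -[leRHS](mean_cst P 1); apply: le_mean_norm.
  - exact: allmom_integ (allmom_cos t x mV).
  - exact: integ_cst.
  - by move=> w; exact: cos_max.
have b1 := bd c S mS; have b2 := bd (c - pi / 2) S mS.
have Q0 : 0 <= \sum_(b < N) q b by apply: sumr_ge0.
have x0 : 0 <= t ^+ 2 * q N / 2 by rewrite divr_ge0// mulr_ge0// sqr_ge0.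
rewrite e [in leLHS]big_ord_recr [in leRHS]big_ord_recr /=.
have -> : expR (- (t ^+ 2 * (\sum_(b < N) q b + q N) / 2)) =
    expR (- (t ^+ 2 * q N / 2)) * expR (- (t ^+ 2 * (\sum_(b < N) q b) / 2)).
  by rewrite -expRD; congr expR; field.
have e0 : 0 <= expR (- (t ^+ 2 * q N / 2)) := expR_ge0 _.
have e1 : expR (- (t ^+ 2 * q N / 2)) <= 1 by rewrite -[leRHS]expR0 ler_expR oppr_le0.
move: IHN hs hc b1 b2 e0 e1; rewrite -/S.
set a := mean P (fun w => cos (t * _ + c)); set a' := mean P (fun w => cos (t * _ + (c - _))).
set u := mean P (fun w => cos (t * _ + 0)); set u' := mean P (fun w => cos (t * _ + (0 - _))).
set x := expR (- (t ^+ 2 * q N / 2)); set y := expR _ * cos c.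
set Q := \sum_(b < N) q b => IHN hs hc b1 b2 e0 e1.
have -> : a * u - a' * u' - x * expR (- (t ^+ 2 * Q / 2)) * cos c =
    a * (u - x) + x * (a - expR (- (t ^+ 2 * Q / 2)) * cos c) - a' * u' by ring.
apply: le_trans (ler_normB _ _) _.
apply: (@le_trans _ _ (1 * (block_cst t * (dl * q N)) + 1 * (2 * block_cst t * dl * Q) +
    1 * (block_cst t * (dl * q N)))); last by rewrite le_eqVlt; apply/orP; left; apply/eqP; ring.
apply: lerD; last by rewrite normrM ler_pM.
apply: le_trans (ler_normD _ _) _; apply: lerD; rewrite normrM ler_pM//.
by rewrite ger0_norm.
Qed.

End IndependentBlocks.

(** * From means of cosines to distribution functions *)

Section SmoothedStep.
Context {R : realType}.

Let sin_ge (s y : R) : 0 <= s -> s <= y -> y <= pi / 2 -> sin s <= sin y.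
Proof.
move=> s0 sy y2; have pi2 : 0 <= pi / 2 :> R by rewrite divr_ge0// pi_ge0.
move: sy; rewrite le_eqVlt => /predU1P[->//|sy]; apply/ltW.
rewrite ltr_sin// in_itv/=; apply/andP; split => //.
- by apply: le_trans s0; rewrite oppr_le0.
- exact: le_trans (ltW sy) y2.
- by apply: le_trans (le_trans s0 (ltW sy)); rewrite oppr_le0.
Qed.

(* f is periodic; x ^+ 2 / M ^+ 2 pays for the points with |x| > M. *)
Lemma smoothed_step (c e M h : R) : 0 < e -> 0 < M -> 0 < h ->
  exists2 f : R -> R, trig_class false f & forall x,
    (x <= c - e)%R%:R - h - x ^+ 2 / M ^+ 2 <= f x <= (x <= c + e)%R%:R + h + x ^+ 2 / M ^+ 2.
Proof.
move=> e0 M0 h0; pose B := M + `|c| + e.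
have B0 : 0 < B by rewrite addr_gt0// ltr_pwDl.
have pi2 : 0 < pi / 2 :> R by rewrite divr_gt0// pi_gt0.
(* With this frequency |t (x - c)| <= pi / 2 whenever |x| <= M, where the sine increases; the term e
   in B keeps t e in this range too. *)
pose t := pi / 2 / B; have t0 : 0 < t by rewrite divr_gt0.
have te : t * e <= pi / 2.
  rewrite /t mulrAC ler_pdivrMr// ler_pM2l// lerDr addr_ge0// ltW//.
have te0 : 0 < t * e by rewrite mulr_gt0.
have s0 : 0 < sin (t * e).
  rewrite sin_gt0_pi// te0 (le_lt_trans te)// ltr_pdivrMr// ltr_pMr ?pi_gt0// ltr1n//.
have s1 : sin (t * e) <= 1 by exact: le_trans (ler_norm _) (sin_max _).
have [m hm] : exists m, (1 - sin (t * e) / 2) ^+ m <= h.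
  have : (1 - sin (t * e) / 2) ^+ m @[m --> \oo] --> (0 : R).
    by apply: cvg_expr; rewrite ger0_norm; lra.
  move=> /cvgr0Pnorm_le /(_ h h0)[m _ /(_ m (leqnn m))] hm.
  by exists m; apply: le_trans hm; exact: ler_norm.
pose it x := iter m (@sgn_step R) (sin (t * x + - (t * c))).
have it1 x : -1 <= it x <= 1.
  by rewrite -ler_norml; apply: iter_step_bounded; exact: sin_max.
exists (fun x => 1 / 2 * 1 + - (1 / 2) * it x).
  by apply: TrigLin; [exact: (trig_cst false 1)|exact: trig_iter_sin].
move=> x; have /andP[i1 i2] := it1 x.
have xM0 : 0 <= x ^+ 2 / M ^+ 2 by rewrite divr_ge0 ?sqr_ge0.
have [xM|Mx] := leP `|x| M; last first.
  have xM1 : 1 <= x ^+ 2 / M ^+ 2.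
    rewrite ler_pdivlMr ?exprn_gt0// mul1r -[x ^+ 2]real_normK ?num_real//.
    by apply: lerXn2r; rewrite ?nnegrE// ltW.
  have b01 (b : bool) : (0 <= b%:R :> R) && (b%:R <= 1 :> R) by case: b; rewrite ?lexx ?ler01.
  have /andP[u1 u2] := b01 (x <= c - e)%R; have /andP[v1 v2] := b01 (x <= c + e)%R.
  by apply/andP; split; lra.
have big y : 0 <= y -> sin (t * e) <= sin y -> 1 - h <= iter m (@sgn_step R) (sin y).
  move=> y0 sy; have sy1 : 0 <= sin y <= 1.
    by rewrite (le_trans (ltW s0))//=; exact: le_trans (ler_norm _) (sin_max _).
  have [_ hy] := iter_step_bounds m sy1.
  rewrite lerBlDr -lerBlDl; apply: le_trans hy _; apply: le_trans hm.
  by move/andP: sy1 => [sy0 sy1]; apply: lerXn2r; rewrite ?nnegrE; lra.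
have bound y : `|y| <= M + `|c| -> t * y <= pi / 2.
  move=> hy; rewrite /t mulrAC ler_pdivrMr// ler_pM2l//.
  by apply: le_trans (ler_norm _) _; apply: le_trans hy _; rewrite lerDl ltW.
have xc : `|x - c| <= M + `|c| by apply: le_trans (ler_normB _ _) _; rewrite lerD2r.
have itE : it x = iter m (@sgn_step R) (sin (t * (x - c))) by rewrite mulrBr.
have [h1|h1] := leP x (c - e).
  have -> : (x <= c + e) = true by apply: le_trans h1 _; lra.
  have : 1 - h <= - it x.
    rewrite itE -iter_stepN -sinN -mulrN; apply: big.
      by rewrite mulr_ge0 ?(ltW t0)//; lra.
    apply: sin_ge; [exact: ltW|by rewrite ler_pM2l//; lra|].
    by apply: bound; rewrite normrN.
  by move=> hi /=; apply/andP; split; lra.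
have [h2|h2] := leP x (c + e); first by apply/andP; split=> /=; lra.
have : 1 - h <= it x.
  rewrite itE; apply: big; first by rewrite mulr_ge0 ?(ltW t0)//; lra.
  by apply: sin_ge; [exact: ltW|by rewrite ler_pM2l//; lra|exact: bound].
by move=> hi /=; apply/andP; split; lra.
Qed.

End SmoothedStep.

Section CdfBounds.
Context {R : realType} {d : measure_display} {Om : measurableType d}.
Variables (P : probability Om R) (Z : Om -> R).
Hypothesis mZ : measurable_fun setT Z.

Definition cdf_at (x : R) := mean P (fun w => (Z w <= x)%R%:R).

Let m_le x : measurable_fun setT (fun w => (Z w <= x)%R%:R : R).
Proof.
apply: measurableT_comp => //; apply: measurable_fun_ler => //.
Qed.

Let i_le x : integ P (fun w => (Z w <= x)%R%:R).
Proof.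
apply: (@integ_bounded _ _ _ P _ 1) => // w.
by case: (Z w <= x); rewrite ?normr1 ?normr0.
Qed.

Lemma cdf_atE x : P [set w | Z w <= x] = (cdf_at x)%:E.
Proof.
have mS : measurable [set w | Z w <= x].
  rewrite -[X in measurable X]setTI.
  by apply: (mZ measurableT (Y := [set` `]-oo, x]])); exact: measurable_itv.
rewrite -expectation_indic// expectE; last first.
  apply: (@integ_bounded _ _ _ P _ 1); first exact: measurable_indic.
  by move=> w; rewrite indicE; case: (_ \in _); rewrite ?normr1 ?normr0.
congr (_%:E); apply: eq_mean => w; rewrite indicE; congr (_%:R).
by have [h|h] := boolP (Z w <= x); [rewrite mem_set|rewrite memNset//; exact/negP].
Qed.

Hypothesis Z2 : integ P (fun w => Z w ^+ 2).
Variables (f : R -> R) (c e M h : R).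
Hypothesis f_trig : trig_class false f.
Hypothesis f_step : forall x,
  (x <= c - e)%R%:R - h - x ^+ 2 / M ^+ 2 <= f x <= (x <= c + e)%R%:R + h + x ^+ 2 / M ^+ 2.
Local Notation m2 := (mean P (fun w => Z w ^+ 2)).

Let if_ : integ P (fun w => f (Z w)). Proof. exact: trig_integ f_trig. Qed.

Lemma cdf_at_le : cdf_at (c - e) <= mean P (fun w => f (Z w)) + h + m2 / M ^+ 2.
Proof.
have ic := integ_cst P h; have iZ := integZ (M ^+ 2)^-1 Z2.
rewrite mulrC -(meanZ _ Z2) -[X in _ + X + _](mean_cst P) -(meanD if_ ic).
rewrite -(meanD (integD if_ ic) iZ).
apply: le_mean; [exact: i_le|exact: integD (integD if_ ic) iZ|move=> w].
have /andP[h1 _] := f_step (Z w); rewrite /= mulrC; lra.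
Qed.

Lemma cdf_at_ge : mean P (fun w => f (Z w)) <= cdf_at (c + e) + h + m2 / M ^+ 2.
Proof.
have ic := integ_cst P h; have iZ := integZ (M ^+ 2)^-1 Z2; have il := i_le (c + e).
rewrite mulrC -(meanZ _ Z2) -[X in _ + X + _](mean_cst P) -(meanD il ic).
rewrite -(meanD (integD il ic) iZ).
apply: le_mean; [exact: if_|exact: integD (integD il ic) iZ|move=> w].
have /andP[_ h1] := f_step (Z w); rewrite /= mulrC; lra.
Qed.

End CdfBounds.

Section CosineConvergence.
Context {R : realType} {I : Type} (F : set_system I) {FF : Filter F}.
Variables (d : I -> measure_display) (Om : forall i, measurableType (d i)).
Variables (P : forall i, probability (Om i) R) (Z : forall i, Om i -> R).
Arguments Z : clear implicits.
Hypothesis mZ : forall i, measurable_fun setT (Z i).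
Hypothesis Z2 : forall i, integ (P i) (fun w => Z i w ^+ 2).
Hypothesis Z2_le : \forall i \near F, mean (P i) (fun w => Z i w ^+ 2) <= 2.
Hypothesis Z_cos : forall t c,
  mean (P i) (fun w => cos (t * Z i w + c)) @[i --> F] --> expR (- (t ^+ 2 / 2)) * cos c.

Local Notation mu := (normal_prob 0 (1 : R)).

(** Restricted to finite trigonometric sums, where linearity suffices: a pointwise limit inside the
    class need not commute with the limit along F. *)
Lemma trig_mean_cvg f : trig_class false f ->
  mean (P i) (fun w => f (Z i w)) @[i --> F] --> mean mu f.
Proof.
elim=> [t c|a b {}f g hf ihf hg ihg|//].
  by rewrite mean_normal_cos ?oner_neq0// expr1n mul1r; exact: Z_cos.
have e i : mean (P i) (fun w => a * f (Z i w) + b * g (Z i w)) =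
    a * mean (P i) (fun w => f (Z i w)) + b * mean (P i) (fun w => g (Z i w)).
  have h1 := trig_integ (P i) (@mZ i) hf; have h2 := trig_integ (P i) (@mZ i) hg.
  by rewrite meanD; [rewrite (meanZ _ h1) (meanZ _ h2)|exact: integZ|exact: integZ].
under eq_fun do rewrite e.
have h1 := trig_integ mu (@measurable_id _ _ setT) hf.
have h2 := trig_integ mu (@measurable_id _ _ setT) hg.
rewrite meanD; [rewrite (meanZ _ h1) (meanZ _ h2)|exact: integZ|exact: integZ].
by apply: cvgD; apply: cvgM => //; exact: cvg_cst.
Qed.

(** Smoothed steps centred at x + r / 2 and x - r / 2 enclose the distribution function of Z at x
    between values of the limiting one at x - r and x + r, up to small errors; r comes from
    continuity at x. *)
Lemma cvg_in_distribution_cos : cvg_in_distribution F P Z mu.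
Proof.
move=> x cont; pose G y := cdf_at mu idfun y.
have mid := @measurable_id _ _ setT : measurable_fun setT (idfun : measurableTypeR R -> R).
have muE y : mu [set` `]-oo, y]] = (G y)%:E by rewrite -(cdf_atE mu mid); congr (mu _).
have n0 : (1 : R) != 0 by exact: oner_neq0.
have I2 : integ mu (fun y : R => y ^+ 2).
  exact: allmom_integ (allmomX 2 (allmom_normal n0)).
have mu2 : mean mu (fun y : R => y ^+ 2) = 1.
  by rewrite (mean_normalSS n0) (mean_cst mu 1) expr1n !mulr1.
have contG : G y @[y --> x] --> G x.
  move: cont; rewrite (_ : (fun y : R => _) = EFin \o G); last by apply/funext => y; exact: muE.
  by move/fine_cvg.
suff g : P i [set w | Z i w <= x] @[i --> F] --> (G x)%:E by move: g; rewrite -muE.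
under eq_fun do rewrite (cdf_atE _ (@mZ _)).
apply: cvg_EFin; first exact: nearW.
apply/cvgrPdist_le => /= e e0.
have [r r0 hr] : exists2 r, 0 < r & forall y, `|y - x| <= r -> `|G y - G x| <= e / 2.
  have : \forall y \near x, `|G x - G y| <= e / 2.
    by move/cvgrPdist_le : contG; apply; rewrite divr_gt0.
  move=> /nbhs_normP[r r0 hr]; exists (r / 2); first by rewrite divr_gt0.
  move=> y hy; rewrite distrC; apply: hr; rewrite /= distrC.
  by apply: le_lt_trans hy _; rewrite ltr_pdivrMr// ltr_pMr// ltr1n.
(* Each side costs at most 6 h: 2 h for using the smoothed step under both laws, h for the
   convergence of means, and 2 h + h for the tails, since M^(-2) = h and the second moments are at
   most 2 and 1. Continuity adds e / 2. *)
pose h := e / 16; have h0 : 0 < h by rewrite divr_gt0.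
pose M := Num.sqrt h^-1; have M0 : 0 < M by rewrite sqrtr_gt0 invr_gt0.
have M2 : (M ^+ 2)^-1 = h by rewrite sqr_sqrtr ?invr_ge0 ?ltW// invrK.
have r20 : 0 < r / 2 by rewrite divr_gt0.
have [f1 tf1 hf1] := smoothed_step (x + r / 2) r20 M0 h0.
have [f2 tf2 hf2] := smoothed_step (x - r / 2) r20 M0 h0.
have near1 := trig_mean_cvg tf1; have near2 := trig_mean_cvg tf2.
move/cvgrPdist_le : near1 => /(_ h h0) near1; move/cvgrPdist_le : near2 => /(_ h h0) near2.
near=> i.
have a1 : `|mean mu f1 - mean (P i) (fun w => f1 (Z i w))| <= h by near: i; exact: near1.
have a2 : `|mean mu f2 - mean (P i) (fun w => f2 (Z i w))| <= h by near: i; exact: near2.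
have z2 : mean (P i) (fun w => Z i w ^+ 2) <= 2 by near: i; exact: Z2_le.
have u1 := cdf_at_le (@mZ i) (Z2 i) tf1 hf1.
have u2 := cdf_at_ge (@mZ i) (Z2 i) tf2 hf2.
have v1 := cdf_at_ge mid I2 tf1 hf1; have v2 := cdf_at_le mid I2 tf2 hf2.
rewrite /= !mu2 !M2 in u1 u2 v1 v2.
have e1 : x + r / 2 - r / 2 = x by ring.
have e2 : x - r / 2 + r / 2 = x by ring.
have e3 : x + r / 2 + r / 2 = x + r by field.
have e4 : x - r / 2 - r / 2 = x - r by field.
rewrite e1 in u1; rewrite e2 in u2; rewrite e3 in v1; rewrite e4 in v2.
have g1 : `|G (x + r) - G x| <= e / 2 by apply: hr; rewrite addrAC subrr add0r ger0_norm// ltW.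
have g2 : `|G (x - r) - G x| <= e / 2.
  by apply: hr; rewrite addrAC subrr add0r normrN ger0_norm// ltW.
rewrite -/(G _) in v1; rewrite -/(G _) in v2.
have zh : mean (P i) (fun w => Z i w ^+ 2) * h <= 2 * h by rewrite ler_pM2r.
have hE : h = e / 16 by [].
rewrite !ler_norml in a1 a2 g1 g2 *.
move/andP: a1 => [a1 a1']; move/andP: a2 => [a2 a2'].
move/andP: g1 => [g1 g1']; move/andP: g2 => [g2 g2'].
apply/andP; split; lra.
Unshelve. all: by end_near. Qed.

End CosineConvergence.

(** * The statistic under the null hypothesis, cut into blocks *)

Section BlockSums.
Context {R : realType} {d : measure_display} {Om : measurableType d}.
Variables (P : probability Om R) (n p : nat) (X : 'I_n -> {RV P >-> p.-tuple R}).
Hypothesis hX : iid_gaussian X 1%:M.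
Implicit Type W : 'I_p -> 'I_p -> R.

Definition coord (c : 'I_n * 'I_p) w := tnth (X c.1 w) c.2.
Local Notation xi := coord.

Lemma coord_meas c : measurable_fun setT (xi c). Proof. exact: measurable_coord. Qed.

(** Two layers: the vectors are independent by hypothesis, and the coordinates inside each vector by
    [std_coord_independent]. *)
Lemma coord_independent : independent_family P xi.
Proof.
move=> A mA; pose B k := \bigcap_(i in [set: 'I_p]) [set t : p.-tuple R | A (k, i) (tnth t i)].
have mB k : measurable (B k).
  apply: fin_bigcap_measurable => // i _; rewrite -[X in measurable X]setTI.
  exact: (measurable_tnth i measurableT (mA (k, i))).
have e : \bigcap_(c in setT) (xi c @^-1` A c) = \bigcap_(k in [set: 'I_n]) (X k @^-1` B k).
  apply/seteqP; split=> w h; first by move=> k _ i _; exact: (h (k, i) I).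
  by move=> [k i] _; exact: (h k I i I).
rewrite e (hX.1 B mB).
rewrite (eq_bigr (fun c => P ((fun w => tnth (X c.1 w) c.2) @^-1` A (c.1, c.2)))); last by case.
rewrite -(pair_bigA _ (fun k i => P ((fun w => tnth (X k w) i) @^-1` A (k, i))))/=.
apply: eq_bigr => k _; rewrite -(std_coord_independent (hX.2 k) (fun i => mA (k, i))).
by congr (P _).
Qed.

Let lawxi c (A : set R) : measurable A -> P (xi c @^-1` A) = normal_law 0 1 A.
Proof. exact: (std_coord_law (hX.2 c.1)). Qed.

Let xi_allmom c : allmom P (xi c).
Proof. exact: (allmom_gaussian ler01 (coord_meas c) (@lawxi c)). Qed.

(** k != l and i < j make the four coordinates of each monomial distinct, so that no variable is
    squared. *)
Lemma gstat_mlpoly W : multilinear xi (enum {: 'I_n * 'I_p}) 4 (gstat X W).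
Proof.
apply: multilinear_sum => k _; apply: multilinear_sum => l kl; apply: multilinear_sum => i _.
apply: multilinear_sum => j ij.
pose S := (k, i) |: ((k, j) |: ((l, i) |: [set (l, j)])).
have ne1 : i == j = false by rewrite -val_eqE/= ltn_eqF.
have ne2 : k == l = false by exact/negbTE.
have -> : (fun w => W i j * tnth (X k w) i * tnth (X k w) j * tnth (X l w) i * tnth (X l w) j) =
    (fun w => W i j * \prod_(c in S) xi c w).
  apply/funext => w; rewrite /S !big_setU1 ?big_set1 ?inE ?xpair_eqE ?eqxx ?ne1 ?ne2//=.
  by rewrite /coord/= !mulrA.
apply: mlpolyZ; apply: multilinear_monomial; first exact: enum_uniq.
  by rewrite /S !cardsU1 cards1 !inE !xpair_eqE !eqxx ne1 ne2.
by move=> c _; rewrite mem_enum.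
Qed.

Lemma mean4_gstat_le W :
  mean P (fun w => gstat X W w ^+ 4) <= 9 ^+ 4 * mean P (fun w => gstat X W w ^+ 2) ^+ 2.
Proof.
apply: (multilinear_mean4_le coord_meas coord_independent xi_allmom _ _ _ _ _ (gstat_mlpoly W)).
- by move=> c; exact: (gaussian_moment1 (v := 1) ler01 (coord_meas c) (@lawxi c)).
- by move=> c; rewrite (gaussian_moment2 ler01 (coord_meas c) (@lawxi c)).
- by move=> c; rewrite (gaussian_moment3 ler01 (coord_meas c) (@lawxi c)).
- by move=> c; rewrite (gaussian_moment4 ler01 (coord_meas c) (@lawxi c)) expr1n mulr1.
- exact: enum_uniq.
Qed.

Lemma gstat_depends W (J : pred 'I_p) : (forall i j, W i j != 0 -> J i && J j) ->
  depends_on xi [pred c | J c.2] (gstat X W).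
Proof.
move=> WJ; apply: depends_sum => k _; apply: depends_sum => l _.
apply: depends_sum => i _; apply: depends_sum => j _.
have [W0|/WJ/andP[Ji Jj]] := eqVneq (W i j) 0.
  have -> : (fun w => W i j * tnth (X k w) i * tnth (X k w) j * tnth (X l w) i * tnth (X l w) j) =
    cst 0 by apply/funext => w; rewrite W0 !mul0r.
  exact: depends_cst.
have dep k' i' : J i' -> depends_on xi [pred c | J c.2] (fun w => tnth (X k' w) i').
  by move=> Ji'; apply: (depends_comp xi (c := (k', i')) (f := @id R)).
by do 4![apply: dependsM; last exact: dep]; exact: depends_cst.
Qed.

Lemma gstat_add W W' w : gstat X (fun i j => W i j + W' i j) w = gstat X W w + gstat X W' w.
Proof.
rewrite -big_split; apply: eq_bigr => k _; rewrite -big_split; apply: eq_bigr => l _.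
rewrite -big_split; apply: eq_bigr => i _; rewrite -big_split; apply: eq_bigr => j _.
by rewrite /= !mulrDl.
Qed.

Lemma gstat_sum N (W : nat -> 'I_p -> 'I_p -> R) w :
  gstat X (fun i j => \sum_(b < N) W b i j) w = \sum_(b < N) gstat X (W b) w.
Proof.
elim: N => [|N IHN].
  rewrite big_ord0; apply: big1 => k _; apply: big1 => l _; apply: big1 => i _.
  by apply: big1 => j _; rewrite big_ord0 !mul0r.
rewrite big_ord_recr -IHN /= -gstat_add; congr (gstat X _ w).
by apply/funext => i; apply/funext => j; rewrite big_ord_recr.
Qed.

Hypotheses (n_gt1 : (1 < n)%N) (p_gt0 : (0 < p)%N).

(** This is n sqrt p Dhat when W is the weight matrix of the model. Keeping it linear in W lets a
    splitting of the weights split the statistic; [nvar] below is its variance under the null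
    hypothesis. *)
Definition nstat W w : R := ((n%:R - 1) * Num.sqrt p%:R)^-1 * gstat X W w.

Definition nvar W : R := n%:R / (n%:R - 1) * (2 / p%:R * \sum_[i < j < p] W i j ^+ 2).

Let n1 : 0 < n%:R - 1 :> R. Proof. by rewrite subr_gt0 ltr1n. Qed.
Let p0 : 0 < p%:R :> R. Proof. by rewrite ltr0n. Qed.
Let mom W := allmom_gstat (@psd_1 R p) hX W.

Lemma allmom_nstat W : allmom P (nstat W).
Proof. exact: allmomZ. Qed.

Let mean_gstat_0 W : mean P (gstat X W) = 0.
Proof.
rewrite (mean_gstat (sym_1 p) (@psd_1 R p) hX) big1 ?mulr0// => i _; apply: big1 => j ij.
by rewrite mxE -val_eqE/= ltn_eqF// expr0n mulr0.
Qed.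

Lemma mean_nstat W : mean P (nstat W) = 0.
Proof. by rewrite /nstat (meanZ _ (allmom_integ (mom W))) mean_gstat_0 mulr0. Qed.

Lemma mean_sqr_nstat W : mean P (fun w => nstat W w ^+ 2) = nvar W.
Proof.
have := mean_sqr_gstat (sym_1 p) (@psd_1 R p) hX W.
rewrite gvarL_1 gvarQ_1 mean_gstat_0 mulr0 add0r; under eq_mean do rewrite subr0.
move=> h; rewrite /nstat; under eq_mean do rewrite exprMn.
rewrite (meanZ _ (allmom_integ (allmomX 2 (mom W)))) h /nvar exprVn exprMn sqr_sqrtr ?ltW//.
by field; rewrite !gt_eqF.
Qed.

Lemma mean4_nstat_le W :
  mean P (fun w => nstat W w ^+ 4) <= 9 ^+ 4 * mean P (fun w => nstat W w ^+ 2) ^+ 2.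
Proof.
rewrite /nstat; under eq_mean do rewrite exprMn; under [in leRHS]eq_mean do rewrite exprMn.
rewrite (meanZ _ (allmom_integ (allmomX 2 (mom W)))) (meanZ _ (allmom_integ (allmomX 4 (mom W)))).
rewrite exprMn -exprM mulrCA ler_wpM2l ?exprn_even_ge0//; exact: mean4_gstat_le.
Qed.

Variables (w : 'I_p -> 'I_p -> R) (B : nat).

Definition block_weight b (i j : 'I_p) : R :=
  w i j * ((i %/ B == b)%N && (j %/ B == b)%N)%:R.

Definition cross_weight (i j : 'I_p) : R := w i j * (i %/ B != j %/ B)%N%:R.

Lemma block_decomposition i j :
  w i j = (\sum_(b < p) block_weight b i j) + cross_weight i j.
Proof.
(* Block indices below p are enough whatever [B] is, since i / B <= i < p. *)
have iB : (i %/ B < p)%N by apply: leq_ltn_trans (leq_div _ _) (ltn_ord i).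
rewrite (bigD1 (Ordinal iB))//= big1 ?addr0 => [|b bi]; last first.
  have /negbTE h : (i %/ B)%N != b by rewrite eq_sym; exact: bi.
  by rewrite /block_weight h mulr0.
rewrite /block_weight /cross_weight eqxx /= eq_sym -mulrDr.
by case: (_ == _); rewrite ?addr0 ?add0r mulr1.
Qed.

Lemma block_decomposition_sqr i j :
  w i j ^+ 2 = (\sum_(b < p) block_weight b i j ^+ 2) + cross_weight i j ^+ 2.
Proof.
have iB : (i %/ B < p)%N by apply: leq_ltn_trans (leq_div _ _) (ltn_ord i).
rewrite (bigD1 (Ordinal iB))//= big1 ?addr0 => [|b bi]; last first.
  have /negbTE h : (i %/ B)%N != b by rewrite eq_sym; exact: bi.
  by rewrite /block_weight h mulr0 expr0n.
rewrite /block_weight /cross_weight eqxx /= eq_sym.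
by case: (_ == _); rewrite ?mulr1 ?mulr0 expr0n ?addr0 ?add0r.
Qed.

Lemma nstat_decomposition o :
  nstat w o = \sum_(b < p) nstat (block_weight b) o + nstat cross_weight o.
Proof.
rewrite /nstat -mulr_sumr -mulrDr; congr (_ * _); rewrite -gstat_sum -gstat_add.
by congr (gstat X _ o); apply/funext => i; apply/funext => j; exact: block_decomposition.
Qed.

Lemma nvar_decomposition :
  nvar w = \sum_(b < p) nvar (block_weight b) + nvar cross_weight.
Proof.
rewrite /nvar -!mulr_sumr -!mulrDr; congr (_ * (_ * _)).
rewrite exchange_big -big_split; apply: eq_bigr => i _ /=.
rewrite exchange_big -big_split; apply: eq_bigr => j _ /=.
exact: block_decomposition_sqr.
Qed.

Lemma nvar_ge0 W : 0 <= nvar W.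
Proof. by rewrite -mean_sqr_nstat; apply: mean_ge0 => o; exact: sqr_ge0. Qed.

(** Three errors: dropping the cross-block part costs |t| h, then each block is replaced by its
    Gaussian factor, and finally the variance retained in the blocks is replaced by 1. *)
Lemma nstat_cos (t c dl h : R) : 0 < dl <= 1 -> 0 < h ->
  (forall b, nvar (block_weight b) <= dl ^+ 2) -> nvar cross_weight <= h ^+ 2 ->
  `|mean P (fun o => cos (t * nstat w o + c)) - expR (- (t ^+ 2 / 2)) * cos c| <=
  `|t| * h + 2 * block_cst (9 ^+ 4) t * dl * nvar w + t ^+ 2 / 2 * (`|nvar w - 1| + h ^+ 2).
Proof.
move=> /andP[dl0 dl1] h0 hb hc.
pose U b := nstat (block_weight b); pose S o := \sum_(b < p) U b o.
pose g (c' : 'I_n * 'I_p) := (c'.2 %/ B)%N.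
have dU b : depends_on xi [pred c' | g c' == b] (U b).
  apply: dependsM; first exact: depends_cst.
  apply: (gstat_depends (J := fun i : 'I_p => (i %/ B)%N == b)) => i j.
  by rewrite /block_weight; case: (_ && _) => //; rewrite mulr0 eqxx.
have mS : allmom P S by apply: allmom_sum => b _; exact: allmom_nstat.
have K0 : 0 <= (9 : R) ^+ 4 by rewrite exprn_ge0.
have hq b : mean P (fun o => U b o ^+ 2) <= dl ^+ 2 by rewrite mean_sqr_nstat.
have H := block_sum_cos coord_meas coord_independent dU (fun b => allmom_nstat (block_weight b))
  (fun b => mean_nstat (block_weight b)) K0 (fun b => mean4_nstat_le (block_weight b)) dl0 dl1 hq t c p.
rewrite (eq_bigr (fun b : 'I_p => nvar (block_weight b))) in H; last by move=> b _; exact: mean_sqr_nstat.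
set Q := \sum_(b < p) nvar (block_weight b) in H.
have QE : nvar w = Q + nvar cross_weight := nvar_decomposition.
have Q0 : 0 <= Q by apply: sumr_ge0 => b _; exact: nvar_ge0.
have c0 := nvar_ge0 cross_weight.
have h1 : `|mean P (fun o => cos (t * nstat w o + c)) - mean P (fun o => cos (t * S o + c))| <= `|t| * h.
  have i1 := allmom_integ (allmom_cos P t c (allmom_meas (allmom_nstat w))).
  have i2 := allmom_integ (allmom_cos P t c (allmom_meas mS)).
  have i3 := allmom_integ (allmomX 2 (allmom_nstat cross_weight)).
  rewrite -(meanB i1 i2).
  (* AM-GM |z| <= h / 2 + z^2 / (2 h), with h the bound on the standard deviation of the cross-block
     part. *)
  pose G o := `|t| * (h / 2 * 1 + (2 * h)^-1 * nstat cross_weight o ^+ 2).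
  have j1 := integD (integ_cst P (h / 2 * 1)) (integZ (2 * h)^-1 i3).
  apply: (@le_trans _ _ (mean P G)).
    apply: le_mean_norm; [exact: integB|exact: integZ|move=> o].
    apply: le_trans (norm_cos_sub_le _ _) _.
    have -> : t * nstat w o + c - (t * S o + c) = t * nstat cross_weight o.
      by rewrite nstat_decomposition -/(S o); ring.
    rewrite normrM ler_wpM2l//; set z := nstat _ o.
    have -> : h / 2 * 1 + (2 * h)^-1 * z ^+ 2 = `|z| + (h - `|z|) ^+ 2 / (2 * h).
      by rewrite -[z ^+ 2]real_normK ?num_real//; field; rewrite gt_eqF.
    by rewrite lerDl divr_ge0 ?sqr_ge0// mulr_ge0// ltW.
  rewrite /G (meanZ _ j1) (meanD (integ_cst P (h / 2 * 1)) (integZ _ i3)) (meanZ _ i3).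
  rewrite (mean_cst P (h / 2 * 1)) mean_sqr_nstat ler_wpM2l//.
  apply: (@le_trans _ _ (h / 2 * 1 + (2 * h)^-1 * h ^+ 2)).
    by rewrite lerD2l ler_wpM2l// invr_ge0 mulr_ge0// ltW.
  by rewrite le_eqVlt; apply/orP; left; apply/eqP; field; rewrite gt_eqF.
have h3 : `|expR (- (t ^+ 2 * Q / 2)) * cos c - expR (- (t ^+ 2 / 2)) * cos c| <=
    t ^+ 2 / 2 * (`|nvar w - 1| + h ^+ 2).
  rewrite -mulrBl normrM; apply: (@le_trans _ _ (`|expR (- (t ^+ 2 * Q / 2)) - expR (- (t ^+ 2 / 2))| * 1)).
    by rewrite ler_wpM2l// cos_max.
  rewrite mulr1; apply: le_trans (norm_expRN_sub_le _ _) _.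
  - by rewrite divr_ge0// mulr_ge0// sqr_ge0.
  - by rewrite divr_ge0// sqr_ge0.
  have -> : t ^+ 2 * Q / 2 - t ^+ 2 / 2 = t ^+ 2 / 2 * ((nvar w - 1) - nvar cross_weight).
    by rewrite QE; field.
  have t20 : 0 <= t ^+ 2 / 2 by rewrite divr_ge0// sqr_ge0.
  rewrite normrM (ger0_norm t20) ler_wpM2l//; apply: le_trans (ler_normB _ _) _.
  by rewrite lerD2l ger0_norm.
have h2 : 2 * block_cst (9 ^+ 4) t * dl * Q <= 2 * block_cst (9 ^+ 4) t * dl * nvar w.
  rewrite ler_wpM2l//; last by rewrite QE lerDl.
  rewrite mulr_ge0 ?(ltW dl0)// mulr_ge0// /block_cst mulr_ge0 ?addr_ge0//.
  by rewrite exprn_even_ge0.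
move: H h1 h2 h3; set a := mean P _; set x := mean P _; set y := _ * cos c; set z := _ * cos c.
move=> H h1 h2 h3.
have -> : x - z = (x - a) + (a - y) + (y - z) by ring.
apply: le_trans (ler_normD _ _) _; apply: lerD h3; apply: le_trans (ler_normD _ _) _.
by apply: lerD h1 _; apply: le_trans h2.
Qed.

End BlockSums.

Section BlockCounting.

(** Shifting by one more unit changes the sum by (p + T) / B - T / B only. As the quotient by B
    grows by at least 1 when i and i + T lie in different blocks, this counts in [sum_block_exits]
    the indices close to a block boundary. *)
Lemma sum_shift_divn B T p :
  (\sum_(i < p) (i + T) %/ B <= \sum_(i < p) i %/ B + T * ((p + T) %/ B))%N.
Proof.
elim: T => [|T IHT]; first by rewrite mul0n addn0; under eq_bigr do rewrite addn0.
have e : (\sum_(i < p) (i + T.+1) %/ B + T %/ B = \sum_(i < p) (i + T) %/ B + (p + T) %/ B)%N.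
  transitivity (\sum_(i < p.+1) (i + T) %/ B)%N; last by rewrite big_ord_recr.
  rewrite big_ord_recl /= add0n addnC; congr (_ + _)%N.
  by apply: eq_bigr => i _; rewrite /= /bump /= addnS.
apply: leq_trans (leq_addr (T %/ B) _) _; rewrite e.
apply: leq_trans (leq_add IHT (leqnn _)) _; rewrite -addnA leq_add2l.
have h : ((p + T) %/ B <= (p + T.+1) %/ B)%N by rewrite leq_div2r// leq_add2l.
by rewrite mulSn addnC; apply: leq_add => //; rewrite leq_mul2l h orbT.
Qed.

Lemma sum_block_exits B T p :
  (\sum_(i < p) (i %/ B != (i + T) %/ B) <= T * ((p + T) %/ B))%N.
Proof.
rewrite -(leq_add2l (\sum_(i < p) i %/ B)); apply: leq_trans (sum_shift_divn B T p).
rewrite -big_split; apply: leq_sum => i _ /=.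
have h : (i %/ B <= (i + T) %/ B)%N by rewrite leq_div2r// leq_addr.
by case: eqP => [<-|/eqP ne]; rewrite ?addn0// addn1 ltn_neqAle ne.
Qed.

End BlockCounting.

Section BlockVariances.
Context {R : realType} (n p T B : nat) (W0 : R) (w : 'I_p -> 'I_p -> R).
Hypotheses (n_gt1 : (1 < n)%N) (p_gt0 : (0 < p)%N) (B_gt0 : (0 < B)%N).
Hypothesis w_ge0 : forall i j, 0 <= w i j.
Hypothesis w_band : forall i j, w i j <= W0 * (band T i j)%:R.

Let w_sqr i j : w i j ^+ 2 <= W0 ^+ 2 * (band T i j)%:R.
Proof.
have -> : (band T i j)%:R = (band T i j)%:R ^+ 2 :> R by case: band; rewrite ?expr1n ?expr0n.
rewrite -exprMn; apply: lerXn2r; rewrite ?nnegrE//; exact: le_trans (w_band i j).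
Qed.

Let sum_le (a : 'I_p -> bool) (W : 'I_p -> 'I_p -> R) :
  (forall i j : 'I_p, (i < j)%N -> W i j ^+ 2 <= w i j ^+ 2 * (a i)%:R) ->
  \sum_[i < j < p] W i j ^+ 2 <= W0 ^+ 2 * (2 * T%:R) * \sum_(i < p) (a i)%:R.
Proof.
move=> ha; rewrite mulr_sumr; apply: ler_sum => i _.
apply: (@le_trans _ _ (\sum_(j < p) W0 ^+ 2 * (a i)%:R * (band T i j)%:R)).
  rewrite big_mkcond; apply: ler_sum => j _; case: ifP => ij.
    apply: le_trans (ha i j ij) _; rewrite [leRHS]mulrAC; apply: ler_wpM2r => //; exact: w_sqr.
  by apply: mulr_ge0 => //; apply: mulr_ge0 => //; exact: sqr_ge0.
rewrite -mulr_sumr; have := @sum_band R p T i.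
have : 0 <= W0 ^+ 2 * (a i)%:R by apply: mulr_ge0 => //; exact: sqr_ge0.
move=> h0 h; apply: le_trans (ler_wpM2l h0 h) _.
by rewrite mulrAC.
Qed.

Let nvar_le (W : 'I_p -> 'I_p -> R) x : \sum_[i < j < p] W i j ^+ 2 <= x ->
  nvar n W <= 4 * x / p%:R.
Proof.
move=> hx; have p0 : 0 < p%:R :> R by rewrite ltr0n.
have n1 : 0 < n%:R - 1 :> R by rewrite subr_gt0 ltr1n.
have n2 : 2 <= n%:R :> R by rewrite ler_nat.
have S0 : 0 <= \sum_[i < j < p] W i j ^+ 2.
  by apply: sumr_ge0 => i _; apply: sumr_ge0 => j _; exact: sqr_ge0.
have -> : 4 * x / p%:R = 2 * (2 / p%:R * x) by field; rewrite gt_eqF.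
apply: ler_pM; rewrite ?divr_ge0 ?mulr_ge0 ?(ltW n1) ?(ltW p0) ?invr_ge0//.
- by rewrite ler_pdivrMr//; lra.
- by rewrite ler_wpM2l// divr_ge0// ltW.
Qed.

Lemma nvar_block_le b : nvar n (block_weight w B b) <=
  16 * (W0 ^+ 2 * T%:R) * B%:R / p%:R.
Proof.
have h : \sum_(i < p) (i %/ B == b)%N%:R <= 2 * B%:R :> R.
  case: (pickP (fun i : 'I_p => (i %/ B == b)%N)) => [i0 /eqP hi0|h0]; last first.
    by rewrite big1 ?mulr_ge0// => i _; have := h0 i => /= ->.
  (* A block lies in the band of half-width B around any of its elements. *)
  apply: (@le_trans _ _ (\sum_i (band B i0 i)%:R)); last exact: sum_band.
  apply: ler_sum => i _.
  case: eqP => [hi|_]; last by rewrite ler0n.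
  suff -> : band B i0 i by [].
  have e1 := divn_eq i B; have e2 := divn_eq i0 B; have r1 := ltn_pmod i B_gt0.
  have r2 := ltn_pmod i0 B_gt0; rewrite /band e1 e2 hi hi0.
  by move: (b * B)%N (i %% B)%N (i0 %% B)%N r1 r2; clear; lia.
apply: (@le_trans _ _ (4 * (W0 ^+ 2 * (2 * T%:R) * (2 * B%:R)) / p%:R)).
  apply: nvar_le; apply: le_trans (sum_le (a := fun i => (i %/ B == b)%N) _) _.
    move=> i j _; rewrite /block_weight exprMn ler_wpM2l ?sqr_ge0//.
    by case: (i %/ B == b)%N; case: (j %/ B == b)%N; rewrite ?expr1n ?expr0n.
  by apply: ler_wpM2l h; rewrite mulr_ge0 ?sqr_ge0 ?mulr_ge0.
by rewrite le_eqVlt; apply/orP; left; apply/eqP; ring.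
Qed.

Lemma nvar_cross_le : nvar n (cross_weight w B) <=
  8 * (W0 ^+ 2 * T%:R) * (T%:R * (p + T)%:R / B%:R) / p%:R.
Proof.
have B0 : 0 < B%:R :> R by rewrite ltr0n.
have h : \sum_(i < p) (i %/ B != (i + T) %/ B)%N%:R <= T%:R * (p + T)%:R / B%:R :> R.
  rewrite -natr_sum; apply: (@le_trans _ _ (T * ((p + T) %/ B))%:R).
    by rewrite ler_nat sum_block_exits.
  rewrite natrM -mulrA ler_wpM2l// ler_pdivlMr// -natrM ler_nat leq_trunc_div//.
apply: (@le_trans _ _ (4 * (W0 ^+ 2 * (2 * T%:R) * (T%:R * (p + T)%:R / B%:R)) / p%:R)).
  apply: nvar_le; apply: le_trans (sum_le (a := fun i => (i %/ B != (i + T) %/ B)%N) _) _.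
    move=> i j ij; rewrite /cross_weight exprMn.
    (* For j >= i + T the weight is zero; otherwise, if i and j are in different blocks, so are i
       and i + T. *)
    have [iT|jT] := ltnP j (i + T); last first.
      have -> : w i j = 0.
        apply/eqP; rewrite eq_le w_ge0 andbT; apply: le_trans (w_band i j) _.
        by rewrite /band [(j < i + T)%N]ltnNge jT andbF mulr0.
      by rewrite expr0n !mul0r.
    rewrite ler_wpM2l ?sqr_ge0//; case: eqP => [|/eqP ne] /=; first by rewrite expr0n ler0n.
    rewrite expr1n; have -> // : (i %/ B != (i + T) %/ B)%N.
    have h1 : (i %/ B <= j %/ B)%N by rewrite leq_div2r// ltnW.
    have h2 : (j %/ B <= (i + T) %/ B)%N by rewrite leq_div2r// ltnW.
    by rewrite neq_ltn (leq_trans _ h2)// ltn_neqAle ne.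
  by apply: ler_wpM2l h; rewrite mulr_ge0 ?sqr_ge0 ?mulr_ge0.
by rewrite le_eqVlt; apply/orP; left; apply/eqP; ring.
Qed.

End BlockVariances.

Section NullLimit.
Context {R : realType}.
Variables (alpha L : R) (phi : nat -> nat -> R).
Hypotheses (alpha_gt0 : 0 < alpha) (L_gt0 : 0 < L).
Hypothesis phi_gt0 : forall n p, 0 < phi n p.
Hypothesis phi0 : (phi np.1 np.2 @[np --> np_oo]) --> (0 : R).
Hypothesis pphi : (np.2%:R * phi np.1 np.2 `^ (1 / alpha) @[np --> np_oo]) --> +oo.

Let TT (np : nat * nat) := T alpha L (phi np.1 np.2).
Let w (np : nat * nat) (i j : 'I_np.2) := wstar alpha L (phi np.1 np.2) i j.

Lemma near_n_gt (m : nat) : \forall np \near np_oo, (m < np.1)%N.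
Proof. exact: (cvg_fst (nbhs_infty_gt m)). Qed.

Lemma near_nvar (e : R) : 0 < e -> \forall np \near np_oo, `|nvar np.1 (@w np) - 1| <= e.
Proof.
move=> e0; pose e1 := Num.min 1 (e / 4).
have e10 : 0 < e1 by rewrite lt_min ltr01 divr_gt0.
near=> np.
have h : `|null_rem alpha L phi np| <= e1.
  by near: np; exact: (near_null_rem alpha_gt0 L_gt0 phi_gt0 phi0 pphi).
have n2 : (2 < np.1)%N by near: np; exact: near_n_gt.
have hn : (e1^-1 + 1) < np.1%:R.
  near: np; have := nbhs_infty_gtr (e1^-1 + 1) => H; exact: (cvg_fst H).
have nE : nvar np.1 (@w np) = np.1%:R / (np.1%:R - 1) * (1 + null_rem alpha L phi np).
  by rewrite /nvar /null_rem; congr (_ * _); rewrite addrC subrK.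
have n1 : 0 < np.1%:R - 1 :> R by rewrite subr_gt0 ltr1n ltnW.
have h1 : (np.1%:R - 1)^-1 <= e1.
  by rewrite -[leRHS]invrK lef_pV2 ?posrE ?invr_gt0// ltW// ltrBrDr.
have -> : nvar np.1 (@w np) - 1 =
    (np.1%:R - 1)^-1 * (1 + null_rem alpha L phi np) + null_rem alpha L phi np.
  by rewrite nE; field; rewrite gt_eqF.
have e1e : e1 <= e / 4 by rewrite ge_min lexx orbT.
have e11 : e1 <= 1 by rewrite ge_min lexx.
apply: le_trans (ler_normD _ _) _; rewrite normrM ger0_norm ?invr_ge0 ?(ltW n1)//.
have h2 : `|1 + null_rem alpha L phi np| <= 2.
  by apply: le_trans (ler_normD _ _) _; rewrite normr1; lra.
have h3 : (np.1%:R - 1)^-1 * `|1 + null_rem alpha L phi np| <= e1 * 2.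
  by apply: ler_pM => //; rewrite invr_ge0 ltW.
lra.
Unshelve. all: by end_near. Qed.

Let kappa0 := kappa_gt0 alpha_gt0.

(** M depends on h and not on dl: the cross-block variance is at most 16 kappa / M. Once M is fixed,
    a block has variance at most 16 kappa M T / p, which tends to 0 with T / p. *)
Let near_blocks (h dl : R) : 0 < h -> 0 < dl -> exists M : nat,
  \forall np \near np_oo, (0 < M * TT np)%N /\
    (forall b, nvar np.1 (block_weight (@w np) (M * TT np) b) <= dl ^+ 2) /\
    nvar np.1 (cross_weight (@w np) (M * TT np)) <= h ^+ 2.
Proof.
move=> h0 dl0; pose M := (Num.truncn (16 * kappa alpha / h ^+ 2)).+1.
have h20 : 0 < h ^+ 2 by rewrite exprn_gt0.
have M0 : 0 < M%:R :> R by rewrite ltr0n.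
have Mh : 16 * kappa alpha <= h ^+ 2 * M%:R.
  by rewrite [leRHS]mulrC -ler_pdivrMr//; apply/ltW/truncnS_gt.
have k16 : 0 < 16 * kappa alpha * M%:R by rewrite mulr_gt0// pmulr_rgt0.
exists M; near=> np.
have n1 : (1 < np.1)%N by near: np; exact: near_n_gt.
have p0 : (0 < np.2)%N by near: np; exact: near_p_gt0.
have T0 : (0 < TT np)%N by near: np; exact: near_T_gt0.
have Tp : (TT np <= np.2)%N by near: np; exact: near_T_le.
have hr : realT alpha L (phi np.1 np.2) / np.2%:R <= dl ^+ 2 / (16 * kappa alpha * M%:R).
  by near: np; apply: near_ratio => //; rewrite divr_gt0// exprn_gt0.
have B0 : (0 < M * TT np)%N by rewrite muln_gt0 T0.
have pR : 0 < np.2%:R :> R by rewrite ltr0n.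
have TR : 0 < (TT np)%:R :> R by rewrite ltr0n.
have f0 := phi_gt0 np.1 np.2; have t0 := realT_gt0 alpha_gt0 L_gt0 f0.
have Tt : (TT np)%:R <= realT alpha L (phi np.1 np.2) by exact: T_le.
have hk : peak alpha L (phi np.1 np.2) ^+ 2 * (TT np)%:R <= kappa alpha.
  by rewrite peak_sqr// mulrAC ler_pdivrMr// ler_pM2l.
have w0 i j : 0 <= @w np i j by exact: wstar_ge0.
have wb i j : @w np i j <= peak alpha L (phi np.1 np.2) * (band (TT np) i j)%:R.
  exact: wstar_le_band.
split; first exact: B0.
split=> [b|].
  apply: le_trans (nvar_block_le n1 p0 B0 w0 wb b) _.
  rewrite natrM; apply: (@le_trans _ _ (16 * kappa alpha * M%:R * ((TT np)%:R / np.2%:R))).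
    have -> : 16 * (peak alpha L (phi np.1 np.2) ^+ 2 * (TT np)%:R) * (M%:R * (TT np)%:R) / np.2%:R =
      peak alpha L (phi np.1 np.2) ^+ 2 * (TT np)%:R * (16 * M%:R * ((TT np)%:R / np.2%:R)) by ring.
    have -> : 16 * kappa alpha * M%:R * ((TT np)%:R / np.2%:R) =
      kappa alpha * (16 * M%:R * ((TT np)%:R / np.2%:R)) by ring.
    by rewrite ler_wpM2r// mulr_ge0 ?divr_ge0 ?mulr_ge0.
  rewrite mulrC -ler_pdivlMr//; apply: le_trans hr.
  by rewrite ler_pM2r ?invr_gt0.
apply: le_trans (nvar_cross_le n1 p0 B0 w0 wb) _.
apply: (@le_trans _ _ (8 * kappa alpha * (2 / M%:R))).
  have -> : 8 * (peak alpha L (phi np.1 np.2) ^+ 2 * (TT np)%:R) *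
      ((TT np)%:R * (np.2 + TT np)%:R / (M * TT np)%:R) / np.2%:R =
      8 * (peak alpha L (phi np.1 np.2) ^+ 2 * (TT np)%:R) * ((np.2 + TT np)%:R / np.2%:R / M%:R).
    by rewrite natrM; field; rewrite !gt_eqF.
  apply: ler_pM.
  - by rewrite mulr_ge0// mulr_ge0// sqr_ge0.
  - by rewrite !divr_ge0.
  - by rewrite ler_pM2l.
  - rewrite ler_pM2r ?invr_gt0// ler_pdivrMr// -natrM ler_nat.
    by rewrite mul2n -addnn leq_add2l.
rewrite mulrA ler_pdivrMr//; apply: le_trans Mh.
by rewrite le_eqVlt; apply/orP; left; apply/eqP; ring.
Unshelve. all: by end_near. Qed.

Lemma Dhat_cvg_normal (d : nat * nat -> measure_display)
    (Om : forall np, measurableType (d np)) (P : forall np, probability (Om np) R)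
    (X : forall np, 'I_np.1 -> {RV (P np) >-> np.2.-tuple R}) :
  (forall np, iid_gaussian (X np) 1%:M) ->
  cvg_in_distribution np_oo P
    (fun np o => np.1%:R * Num.sqrt np.2%:R * Dhat alpha L (phi np.1 np.2) (X np) o)
    (normal_prob 0 1).
Proof.
move=> hX.
have mZ np : allmom (P np) (fun o => np.1%:R * Num.sqrt np.2%:R * Dhat alpha L (phi np.1 np.2) (X np) o).
  apply: allmomZ; apply: allmomZ; exact: (allmom_gstat (@psd_1 R np.2) (hX np)).
have ZE np : (1 < np.1)%N -> (0 < np.2)%N ->
    forall o, np.1%:R * Num.sqrt np.2%:R * Dhat alpha L (phi np.1 np.2) (X np) o =
    nstat (X np) (@w np) o.
  move=> n1 p0 o; rewrite DhatE mulrA; congr (_ * _).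
  have n1' : 0 < np.1%:R - 1 :> R by rewrite subr_gt0 ltr1n.
  have s0 : 0 < Num.sqrt np.2%:R :> R by rewrite sqrtr_gt0 ltr0n.
  rewrite -[in X in X^-1](sqr_sqrtr (ler0n R np.2)).
  by field; rewrite !gt_eqF ?ltr0n// ltnW.
apply: cvg_in_distribution_cos.
- by move=> np; exact: allmom_meas (mZ np).
- by move=> np; exact: allmom_integ (allmomX 2 (mZ np)).
- near=> np.
  have n1 : (1 < np.1)%N by near: np; exact: near_n_gt.
  have p0 : (0 < np.2)%N by near: np; exact: near_p_gt0.
  under eq_mean do rewrite (ZE np n1 p0).
  rewrite (mean_sqr_nstat (hX np) n1 p0).
  have : `|nvar np.1 (@w np) - 1| <= 1 by near: np; exact: near_nvar.
  by move=> /(le_trans (ler_norm _)); lra.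
move=> t c; apply/cvgrPdist_le => e e0.
pose C := block_cst (9 ^+ 4) t.
have C0 : 0 <= C.
  by rewrite /C /block_cst mulr_ge0 ?addr_ge0// exprn_even_ge0.
pose D := `|t| + t ^+ 2 + 1.
have t20 : 0 <= t ^+ 2 := sqr_ge0 t.
have D0 : 0 < D by rewrite ltr_wpDl// addr_ge0.
(* D collects the coefficients of h in the bound of [nstat_cos], so these terms add up to at most e
   / 4. The choice of dl below gives 4 C dl <= e / 4 for the block term, the variance being at most
   2. *)
pose h := Num.min 1 (e / (4 * D)).
have h0 : 0 < h by rewrite lt_min ltr01 divr_gt0// mulr_gt0.
pose dl := Num.min 1 (e / (16 * (C + 1))).
have C10 : 0 < C + 1 by rewrite ltr_wpDl.
have dl0 : 0 < dl by rewrite lt_min ltr01 divr_gt0// mulr_gt0.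
have dl1 : dl <= 1 by rewrite ge_min lexx.
have [M nearM] := near_blocks h0 dl0.
near=> np.
have n1 : (1 < np.1)%N by near: np; exact: near_n_gt.
have p0 : (0 < np.2)%N by near: np; exact: near_p_gt0.
have [B0 [hb hc]] : (0 < M * TT np)%N /\
    (forall b, nvar np.1 (block_weight (@w np) (M * TT np) b) <= dl ^+ 2) /\
    nvar np.1 (cross_weight (@w np) (M * TT np)) <= h ^+ 2 by near: np; exact: nearM.
have hv : `|nvar np.1 (@w np) - 1| <= h by near: np; exact: near_nvar.
under eq_mean do rewrite (ZE np n1 p0).
rewrite distrC.
have dl01 : 0 < dl <= 1 by rewrite dl0.
apply: le_trans (nstat_cos (hX np) n1 p0 t c dl01 h0 hb hc) _; rewrite -/C.
have h1 : h <= 1 by rewrite ge_min lexx.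
have v2 : nvar np.1 (@w np) <= 2.
  by have := le_trans (ler_norm _) hv; lra.
have hD : h * D <= e / 4.
  have : h <= e / (4 * D) by rewrite ge_min lexx orbT.
  by rewrite -ler_pdivlMr// => /le_trans; apply; rewrite invfM mulrA.
have dC : C * dl <= e / 16.
  have : dl <= e / (16 * (C + 1)) by rewrite ge_min lexx orbT.
  rewrite invfM mulrA ler_pdivlMr// => /(le_trans _); apply.
  by rewrite mulrC ler_pM2l// lerDl.
have x1 : 2 * C * dl * nvar np.1 (@w np) <= 2 * (C * dl) * 2.
  by rewrite -[2 * C * dl]mulrA ler_wpM2l// mulr_ge0// mulr_ge0// ltW.
have x2 : t ^+ 2 / 2 * (`|nvar np.1 (@w np) - 1| + h ^+ 2) <= t ^+ 2 / 2 * (h + h).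
  apply: ler_wpM2l; first by rewrite divr_ge0.
  by apply: lerD => //; rewrite expr2 ler_piMr// ltW.
have x3 : h * D = `|t| * h + t ^+ 2 * h + h by rewrite /D; ring.
have x4 : t ^+ 2 / 2 * (h + h) = t ^+ 2 * h by field.
have x5 : 0 <= `|t| * h by rewrite mulr_ge0// ltW.
have x6 : 0 <= t ^+ 2 * h by rewrite mulr_ge0// ltW.
lra.
Unshelve. all: by end_near. Qed.

End NullLimit.

Theorem proposition1 (R : realType) (alpha L : R) (phi : nat -> nat -> R)
    (alpha_gt0 : 0 < alpha) (L_gt0 : 0 < L)
    (phi_gt0 : forall n p, 0 < phi n p) :
  (* null hypothesis, exact moments *)
  (forall (n p : nat) (n_gt1 : (1 < n)%N) (p_gt0 : (0 < p)%N)
      (d : measure_display) (Om : measurableType d) (P : probability Om R)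
      (X : 'I_n -> {RV P >-> p.-tuple R}),
    iid_gaussian X 1%:M ->
    ('E_P[Dhat alpha L (phi n p) X] = 0)%E /\
    'V_P[Dhat alpha L (phi n p) X]%E =
      (2 / (n%:R * (n%:R - 1) * p%:R ^+ 2) *
       (\sum_[i < j < p] wstar alpha L (phi n p) i j ^+ 2))%:E) /\
  ((phi np.1 np.2 @[np --> np_oo]) --> (0 : R) ->
   (np.2%:R * phi np.1 np.2 `^ (1 / alpha) @[np --> np_oo]) --> +oo ->
   (* null hypothesis, normalized variance and limit law *)
   (exists r : nat * nat -> R, (r =o_np_oo (cst 1 : nat * nat -> R)) /\
     forall (n p : nat) (n_gt1 : (1 < n)%N) (p_gt0 : (0 < p)%N)
       (d : measure_display) (Om : measurableType d) (P : probability Om R)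
       (X : 'I_n -> {RV P >-> p.-tuple R}),
     iid_gaussian X 1%:M ->
     'V_P[Dhat alpha L (phi n p) X]%E =
       ((1 + r (n, p)) / (n%:R * (n%:R - 1) * p%:R))%:E) /\
   (forall (d : nat * nat -> measure_display)
       (Om : forall np, measurableType (d np))
       (P : forall np, probability (Om np) R)
       (X : forall np, 'I_np.1 -> {RV (P np) >-> np.2.-tuple R}),
     (forall np, iid_gaussian (X np) 1%:M) ->
     cvg_in_distribution np_oo P
       (fun np w => np.1%:R * Num.sqrt np.2%:R *
          Dhat alpha L (phi np.1 np.2) (X np) w)
       (normal_prob 0 1)) /\
   (* alternative *)
   (1 / 2 < alpha ->
    (forall (n p : nat) (n_gt1 : (1 < n)%N) (p_gt0 : (0 < p)%N)
        (Sigma : 'M[R]_p) (d : measure_display) (Om : measurableType d)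
        (P : probability Om R) (X : 'I_n -> {RV P >-> p.-tuple R}),
      classQ alpha L (phi n p) Sigma -> iid_gaussian X Sigma ->
      [/\ 'E_P[Dhat alpha L (phi n p) X]%E =
            (p%:R^-1 * (\sum_[i < j < p]
               wstar alpha L (phi n p) i j * Sigma i j ^+ 2))%:E,
          ((T alpha L (phi n p))%:R = realT alpha L (phi n p) ->
            (b alpha L (phi n p))%:E <= 'E_P[Dhat alpha L (phi n p) X])%E &
          ('V_P[Dhat alpha L (phi n p) X] =
            T1 alpha L (phi n p) Sigma
               (X (Ordinal (ltnW n_gt1))) (X (Ordinal n_gt1)) *
              ((n%:R * (n%:R - 1) * p%:R ^+ 2)^-1)%:E +
            T2 alpha L (phi n p) Sigma (X (Ordinal (ltnW n_gt1))) *
              ((n%:R * p%:R ^+ 2)^-1)%:E)%E]) /\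
    (exists o0 o1 O1 O2 O3 o3 : nat * nat -> R,
      [/\ o0 =o_np_oo (cst 1 : nat * nat -> R),
          o1 =o_np_oo (cst 1 : nat * nat -> R) &
          o3 =o_np_oo (cst 1 : nat * nat -> R)] /\
      [/\ O1 =O_np_oo (fun np : nat * nat =>
            (T alpha L (phi np.1 np.2))%:R *
            Num.sqrt (T alpha L (phi np.1 np.2))%:R : R),
          O2 =O_np_oo (fun np : nat * nat =>
            Num.sqrt (T alpha L (phi np.1 np.2))%:R : R) &
          O3 =O_np_oo (fun np : nat * nat =>
            (T alpha L (phi np.1 np.2))%:R `^ (3 / 4) : R)] /\
      \forall np \near np_oo,
        forall (n_gt1 : (1 < np.1)%N) (p_gt0 : (0 < np.2)%N)
          (Sigma : 'M[R]_(np.2)) (d : measure_display)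
          (Om : measurableType d) (P : probability Om R)
          (X : 'I_np.1 -> {RV P >-> np.2.-tuple R}),
        classQ alpha L (phi np.1 np.2) Sigma -> iid_gaussian X Sigma ->
        let ED := 'E_P[Dhat alpha L (phi np.1 np.2) X]%E in
        [/\ ((b alpha L (phi np.1 np.2) * (1 + o0 np))%:E <= ED)%E,
            (T1 alpha L (phi np.1 np.2) Sigma
                (X (Ordinal (ltnW n_gt1))) (X (Ordinal n_gt1))
             <= (np.2%:R * (1 + o1 np))%:E + np.2%:R%:E * ED * (O1 np)%:E)%E &
            (T2 alpha L (phi np.1 np.2) Sigma (X (Ordinal (ltnW n_gt1)))
             <= np.2%:R%:E * ED * (O2 np)%:E +
                (np.2%:R `^ (3 / 2))%R%:E *
                (ED `^ (3 / 2) * (O3 np)%:E + ED * (o3 np)%:E))%E]))).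

Proof.
split.
  move=> n p n_gt1 p_gt0 d Om P X hX; split.
    rewrite (expect_Dhat alpha L (phi n p) (sym_1 p) (@psd_1 R p) hX n_gt1 p_gt0).
    rewrite big1 ?mulr0// => i _; apply: big1 => j ij.
    by rewrite mxE -val_eqE/= ltn_eqF// expr0n mulr0.
  rewrite (var_Dhat_gvar alpha L (phi n p) (sym_1 p) (@psd_1 R p) hX n_gt1 p_gt0).
  by rewrite gvarL_1 gvarQ_1 mulr0 mul0r addr0 mulrAC.
move=> phi0 pphi; split.
  exists (null_rem alpha L phi); split; first exact: null_rem_littleo.
  move=> n p n_gt1 p_gt0 d Om P X hX.
  rewrite (var_Dhat_gvar alpha L (phi n p) (sym_1 p) (@psd_1 R p) hX n_gt1 p_gt0).
  rewrite gvarL_1 gvarQ_1 mulr0 mul0r addr0; congr (_%:E).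
  have n0 : 0 < n%:R :> R by rewrite ltr0n ltnW.
  have n1 : 0 < n%:R - 1 :> R by rewrite subr_gt0 ltr1n.
  have p0 : 0 < p%:R :> R by rewrite ltr0n.
  rewrite /null_rem/= [1 + _]addrC subrK; move: (\sum_(i < p) _) => S.
  by field; rewrite !gt_eqF.
split; first by move=> d Om P X hX; exact: Dhat_cvg_normal.
move=> _; split.
  move=> n p n_gt1 p_gt0 Sigma d Om P X QS hX.
  have ED := expect_Dhat alpha L (phi n p) (classQ_sym QS) (classQ_psd QS) hX n_gt1 p_gt0.
  split; first exact: ED.
  - move=> Tt; rewrite ED lee_fin; apply: (classQ_b_le alpha_gt0 L_gt0 (phi_gt0 n p) p_gt0 QS) => //.
    by rewrite -(ltr0n R) Tt realT_gt0.
  - exact: (var_Dhat alpha L (phi n p) (classQ_sym QS) (classQ_psd QS) hX n_gt1 p_gt0).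
(* The o(1) term in the bound on T2 is realized by 0: the terms with a coincidence of indices are
   wholly absorbed in [coefT2]. *)
exists (b_rem alpha L phi), (null_rem alpha L phi), (coefT1 alpha L phi),
  (coefT2 alpha L phi), (coefT2' alpha L phi), (cst 0); split.
  split.
  - by apply: littleo_cst1; exact: near_b_rem.
  - exact: null_rem_littleo.
  - by apply: littleo_cst1 => e e0; apply: nearW => np; rewrite normr0 ltW.
split.
  by split; [exact: coefT1_bigO|exact: coefT2_bigO|exact: coefT2'_bigO].
have near_bounds := near_alternative_bounds alpha_gt0 L_gt0 phi_gt0 phi0.
apply: filterS near_bounds.
move=> np bounds n_gt1 p_gt0 Sigma d Om P X QS hX.
have [hb h1 h2] := bounds Sigma QS.
rewrite (expect_Dhat alpha L _ (classQ_sym QS) (classQ_psd QS) hX n_gt1 p_gt0).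
rewrite (T1E alpha L _ (classQ_sym QS) (classQ_psd QS) hX) ?(T2E alpha L _ (classQ_sym QS) (classQ_psd QS) hX)//.
split.
- by rewrite lee_fin.
- by rewrite -!EFinM -EFinD lee_fin.
- by rewrite mule0 adde0 poweR_EFin -!EFinM -EFinD lee_fin.
Qed.
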